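(* Let $F$ be an analytic function on the unit disk $\mathbb{D}$ such that $F(z)=O\big((1-|z|)^{-M}\big)$ for some $M$. Assume $F$ has a nontangential boundary limit $F(\zeta)$ at almost every $\zeta\in\partial\mathbb{D}$ and that $$F(\zeta)=f(\zeta):=\sum_{n=-\infty}^{-1}c(n)\zeta^{n}\quad\text{for a.e. }\zeta\in\partial\mathbb{D},$$ where the coefficients satisfy $c(n)=O\big(e^{-\omega(\log|n|)}\big)$ for $n<0$, with $\omega:\mathbb{R}^+\to\mathbb{R}^+$ such that $\omega(t)/t$ is increasing and $\sum_{n\ge1}\frac1{\omega(n)}<\infty$. Then $F$ and $f$ are identically zero.
   Context: $\mathbb{D}=\{z:|z|<1\}$. *)

(* Defs.v *)
From Stdlib Require Import Reals ZArith.
From Coquelicot Require Import Coquelicot.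
Open Scope R_scope.

Definition in_disk (z : C) : Prop := Cmod z < 1.

Definition analytic_on_disk (F : C -> C) : Prop :=
  forall z : C, in_disk z -> @ex_derive C_AbsRing C_NormedModule F z.

Definition eit (theta : R) : C := (cos theta, sin theta).

Definition nt_limit (F : C -> C) (zeta L : C) : Prop :=
  forall alpha : R, 1 < alpha ->
  forall eps : R, 0 < eps -> exists delta : R, 0 < delta /\
    forall z : C, in_disk z -> Cmod (z - zeta) < alpha * (1 - Cmod z) ->
      Cmod (z - zeta) < delta -> Cmod (F z - L) < eps.

Definition null_set (E : R -> Prop) : Prop :=
  forall eps : R, 0 < eps -> exists a b : nat -> R,
    (forall n, a n <= b n) /\
    (forall x, E x -> exists n, a n < x < b n) /\
    (forall N, sum_f_R0 (fun n => b n - a n) N <= eps).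

Definition f_term (c : Z -> C) (zeta : C) (k : nat) : C :=
  (c (- Z.of_nat (S k))%Z * pow_n (Cinv zeta) (S k))%C.
(* f(zeta) = sum_{n <= -1} c(n) zeta^n, summed componentwise
   (the series converges absolutely under the hypotheses). *)
Definition f_boundary (c : Z -> C) (zeta : C) : C :=
  (Series (fun k => Re (f_term c zeta k)), Series (fun k => Im (f_term c zeta k))).

(* Main.v *)
(** Call a point of the disk bad if [|F| >= A] there, for a constant [A] larger than [sup |f|].
    Let [N_i = 3^(2^i)] and [phi_i = omega(2^i)/2^i], so that [sum 1/phi_i] is finite, and let
    [f_N] be the N-th partial sum of the series of [f].

    Nontangential convergence a.e. yields a rational [Q] with [Re Q >= 0], with [Re Q >= c_0]
    at the bad points of a thin annulus and at the points of an outer circle [|z| = r] where [F]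
    is not yet close to [f], and with [Re Q] arbitrarily small at a given point: [Q] is a
    discretised Poisson integral of the set of [theta] whose cones meet these points.

    If [Re Q >= c] at all bad points with [1 - |z| <= 1/N_(i+1)], the maximum principle for
    [z^N (F - f_N) exp (- L Q)], with [N = N_i] and [L = phi_i 2^i / 2], on the region where
    [1 - |z| > 1/N_(i+1)] or [|F| < A], gives [Re Q >= c - C/phi_i] at the bad points with
    [1 - |z| <= 1/N_i]: the polynomial growth of [F] only costs a factor [N_i^(2m)], while
    [|f - f_N| <= K' exp (- L)] on the circle.  Descending in [i] loses at most a tail of
    [C sum 1/phi_i], so there is no bad point close to the circle and [F] is bounded.  A bounded
    [F] satisfies [|z^N (F - f_N)| <= sup |f - f_N|] in the disk, which kills every [c(n)]. *)

Require Import Defs.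
From Stdlib Require Import Reals ZArith Lra Lia Psatz Classical ClassicalEpsilon.
From Coquelicot Require Import Coquelicot.
Open Scope R_scope.

(** * Complex differentiability *)

(** The maximum principle cannot be applied to F directly: F may be unbounded near an unknown set of
    boundary points, and convergence at almost every point says nothing there. The factor exp (- L
    Q) is worth exp (- L c) near that set, while the growth of F costs a power of 1/(1-|z|). The
    usable L is limited by how small z^N (F - f_N) is at the boundary, and with c <= 1 a value of
    size exp (- L) is as good as exp (- L c). Each scale therefore loses (log of the growth) / L in
    the level of Re Q. Since log N_i is proportional to 2^i, this ratio is C/phi_i, and Cauchy
    condensation makes it summable.

    Measure theory stays within Riemann integration. Null sets are interval covers, arcs are
    replaced by continuous tents, and a bounded convergence argument shows that some tent integral
    is small. Q is a finite sum of Herglotz kernels, so it is analytic without differentiation under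
    an integral. The maximum principle itself rests on Goursat's theorem. *)

Definition cdiff (f : C -> C) (z : C) : Prop :=
  exists l : C, forall eps, 0 < eps -> exists delta, 0 < delta /\
    forall w, Cmod (w - z) < delta ->
      Cmod (f w - f z - l * (w - z)) <= eps * Cmod (w - z).

Lemma is_derive_C_spec (f : C -> C) (z l : C) :
  @is_derive C_AbsRing (AbsRing_NormedModule C_AbsRing) f z l <->
  (forall eps, 0 < eps -> exists delta, 0 < delta /\
    forall w, Cmod (w - z) < delta ->
      Cmod (f w - f z - l * (w - z)) <= eps * Cmod (w - z)).
Proof.
split.
- intros [_ H] eps Heps.
  destruct (H z (fun P HP => HP) (mkposreal eps Heps)) as [d Hd].
  exists d; split; [apply cond_pos|]; intros w Hw.
  specialize (Hd w Hw); cbn in Hd.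
  replace (l * (w - z))%C with ((w - z) * l)%C by ring; exact Hd.
- intros H; split; [apply is_linear_scal_l|].
  intros x Hx eps.
  rewrite <- (@is_filter_lim_locally_unique C_AbsRing (AbsRing_NormedModule C_AbsRing) z x Hx).
  destruct (H eps (cond_pos eps)) as [d [Hd0 Hd]].
  exists (mkposreal d Hd0); intros w Hw.
  specialize (Hd w Hw); cbn.
  replace (l * (w - z))%C with ((w - z) * l)%C in Hd by ring; exact Hd.
Qed.

Lemma cdiff_ex_derive (f : C -> C) (z : C) :
  cdiff f z <-> exists l, @is_derive C_AbsRing (AbsRing_NormedModule C_AbsRing) f z l.
Proof.
split; intros [l Hl]; exists l; apply (is_derive_C_spec f z l); exact Hl.
Qed.

(** The theorem differentiates into [C_NormedModule], the calculus rules below into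
    [AbsRing_NormedModule C_AbsRing]; the epsilon-delta form of [cdiff] is common ground for
    both. *)
Lemma ex_derive_cdiff (f : C -> C) (z : C) :
  @ex_derive C_AbsRing C_NormedModule f z -> cdiff f z.
Proof.
intros [l [_ H]]; exists l; intros eps Heps.
destruct (H z (fun P HP => HP) (mkposreal eps Heps)) as [d Hd].
exists d; split; [apply cond_pos|]; intros w Hw.
specialize (Hd w Hw).
change (Cmod (f w - f z - (w - z) * l) <= eps * Cmod (w - z)) in Hd.
rewrite (Cmult_comm l); exact Hd.
Qed.

Lemma cdiff_const (a z : C) : cdiff (fun _ => a) z.
Proof.
apply cdiff_ex_derive; eexists; apply (@is_derive_const C_AbsRing (AbsRing_NormedModule C_AbsRing)).
Qed.

Lemma cdiff_id (z : C) : cdiff (fun w => w) z.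
Proof.
apply cdiff_ex_derive; eexists; apply (@is_derive_id C_AbsRing).
Qed.

Lemma cdiff_plus (f g : C -> C) (z : C) :
  cdiff f z -> cdiff g z -> cdiff (fun w => f w + g w)%C z.
Proof.
rewrite !cdiff_ex_derive; intros [a Ha] [b Hb]; eexists.
exact (@is_derive_plus C_AbsRing (AbsRing_NormedModule C_AbsRing) f g z a b Ha Hb).
Qed.

Lemma cdiff_mult (f g : C -> C) (z : C) :
  cdiff f z -> cdiff g z -> cdiff (fun w => f w * g w)%C z.
Proof.
rewrite !cdiff_ex_derive; intros [a Ha] [b Hb]; eexists.
exact (@is_derive_mult C_AbsRing f g z a b Ha Hb Cmult_comm).
Qed.

Lemma cdiff_comp (f g : C -> C) (z : C) :
  cdiff f (g z) -> cdiff g z -> cdiff (fun w => f (g w)) z.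
Proof.
rewrite !cdiff_ex_derive; intros [a Ha] [b Hb]; eexists.
exact (@is_derive_comp C_AbsRing (AbsRing_NormedModule C_AbsRing) f g z a b Ha Hb).
Qed.

Lemma cdiff_ext (f g : C -> C) (z : C) :
  (forall w, f w = g w) -> cdiff f z -> cdiff g z.
Proof.
intros E [l H]; exists l; intros eps Heps; destruct (H eps Heps) as [d [Hd Hw]].
exists d; split; [exact Hd|]; intros w; rewrite <- !E; apply Hw.
Qed.

Lemma cdiff_scal (a : C) (f : C -> C) (z : C) : cdiff f z -> cdiff (fun w => a * f w)%C z.
Proof. intros H; apply cdiff_mult; [apply cdiff_const | exact H]. Qed.

Lemma cdiff_opp (f : C -> C) (z : C) : cdiff f z -> cdiff (fun w => - f w)%C z.
Proof.
intros H; apply (cdiff_ext (fun w => -(1) * f w)%C); [intros; ring | apply cdiff_scal, H].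
Qed.

Lemma cdiff_minus (f g : C -> C) (z : C) :
  cdiff f z -> cdiff g z -> cdiff (fun w => f w - g w)%C z.
Proof. intros Hf Hg; apply cdiff_plus; [exact Hf | apply cdiff_opp, Hg]. Qed.

Lemma cdiff_pow (f : C -> C) (n : nat) (z : C) : cdiff f z -> cdiff (fun w => f w ^ n)%C z.
Proof.
intros H; induction n as [|n IH]; simpl; [apply cdiff_const | apply cdiff_mult; assumption].
Qed.

Lemma Cmod_minus_sym (z w : C) : Cmod (z - w) = Cmod (w - z).
Proof. rewrite <- Cmod_opp; f_equal; ring. Qed.

Lemma Cmod_triangle_rev (z w : C) : Cmod z - Cmod w <= Cmod (z - w).
Proof.
pose proof (Cmod_triangle (z - w) w) as H.
replace (z - w + w)%C with z in H by ring; lra.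
Qed.

Lemma Cmod_minus_le (z w : C) : Cmod (z - w) <= Cmod z + Cmod w.
Proof. pose proof (Cmod_triangle z (- w)) as H; rewrite Cmod_opp in H; exact H. Qed.

Lemma cdiff_inv (z : C) : z <> 0%C -> cdiff (fun w => / w)%C z.
Proof.
intros Hz; exists (- (/ z * / z))%C; intros eps Heps.
pose proof (proj1 (Cmod_gt_0 z) Hz) as Hm.
set (m := Cmod z) in *.
(* The remainder is (w-z)^2 / (w z^2). The first bound keeps |w| >= m/2, and the second makes 2
   |w-z| / m^3 at most [eps]. *)
exists (Rmin (m / 2) (eps * (m * m * m) / 2)).
assert (Hm3 : 0 < m * m * m) by (apply Rmult_lt_0_compat; nra).
split.
{ apply Rmin_pos; [lra | nra]. }
intros w Hw.
assert (H1 : Cmod (w - z) < m / 2) by (eapply Rlt_le_trans; [exact Hw | apply Rmin_l]).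
assert (H2 : Cmod (w - z) < eps * (m * m * m) / 2) by (eapply Rlt_le_trans; [exact Hw | apply Rmin_r]).
assert (Hwm : m / 2 <= Cmod w).
{ pose proof (Cmod_triangle_rev z w); rewrite Cmod_minus_sym in H1; fold m in H; lra. }
assert (Hw0 : w <> 0%C) by (apply Cmod_gt_0; lra).
replace (/ w - / z - - (/ z * / z) * (w - z))%C
  with ((w - z) * (w - z) * (/ w * / z * / z))%C by (field; split; assumption).
rewrite !Cmod_mult, !Cmod_inv by assumption; fold m.
set (t := Cmod (w - z)) in *.
assert (Ht : 0 <= t) by apply Cmod_ge_0.
assert (Hi : / Cmod w <= 2 / m).
{ replace (2 / m) with (/ (m / 2)) by (field; lra); apply Rinv_le_contravar; lra. }
assert (Hi0 : 0 < / m) by (apply Rinv_0_lt_compat; lra).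
apply Rle_trans with (t * t * (2 / m * / m * / m)).
{ apply Rmult_le_compat_l; [nra|]. apply Rmult_le_compat_r; [lra|].
  apply Rmult_le_compat_r; lra. }
replace (t * t * (2 / m * / m * / m)) with (t * (2 * / (m * m * m)) * t) by (field; lra).
apply Rmult_le_compat_r; [exact Ht|].
apply Rmult_le_reg_r with (m * m * m); [exact Hm3|].
replace (t * (2 * / (m * m * m)) * (m * m * m)) with (2 * t) by (field; lra).
lra.
Qed.

Lemma cdiff_continuous (f : C -> C) (z : C) : cdiff f z ->
  forall eps, 0 < eps -> exists delta, 0 < delta /\
    forall w, Cmod (w - z) < delta -> Cmod (f w - f z) < eps.
Proof.
intros [l H] eps Heps; destruct (H 1 Rlt_0_1) as [d [Hd Hf]].
pose proof (Cmod_ge_0 l) as Hl.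
exists (Rmin d (eps / (Cmod l + 2))); split.
{ apply Rmin_pos; [exact Hd | apply Rdiv_lt_0_compat; lra]. }
intros w Hw.
assert (H1 : Cmod (w - z) < d) by (eapply Rlt_le_trans; [exact Hw | apply Rmin_l]).
assert (H2 : Cmod (w - z) < eps / (Cmod l + 2)) by (eapply Rlt_le_trans; [exact Hw | apply Rmin_r]).
specialize (Hf w H1).
assert (H3 : (Cmod l + 2) * Cmod (w - z) < eps).
{ apply Rmult_lt_compat_l with (r := Cmod l + 2) in H2; [|lra].
  replace ((Cmod l + 2) * (eps / (Cmod l + 2))) with eps in H2 by (field; lra); exact H2. }
replace (f w - f z)%C with ((f w - f z - l * (w - z)) + l * (w - z))%C by ring.
eapply Rle_lt_trans; [apply Cmod_triangle|]; rewrite Cmod_mult.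
pose proof (Cmod_ge_0 (w - z)); nra.
Qed.

(** * The complex exponential *)

Definition Cexp (w : C) : C := (exp (Re w) * cos (Im w), exp (Re w) * sin (Im w)).

Lemma Cexp_plus (z w : C) : Cexp (z + w) = (Cexp z * Cexp w)%C.
Proof.
unfold Cexp, Cmult; destruct z as [a b], w as [c d]; simpl.
rewrite exp_plus, cos_plus, sin_plus; f_equal; ring.
Qed.

Lemma Cexp_0 : Cexp 0 = 1%C.
Proof. unfold Cexp, RtoC; simpl; rewrite exp_0, cos_0, sin_0; f_equal; ring. Qed.

Lemma Cmod_eq (x y : R) : Cmod (x, y) = sqrt (x ^ 2 + y ^ 2).
Proof. reflexivity. Qed.

Lemma Cmod_Cexp (w : C) : Cmod (Cexp w) = exp (Re w).
Proof.
unfold Cexp; rewrite Cmod_eq.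
replace ((exp (Re w) * cos (Im w)) ^ 2 + (exp (Re w) * sin (Im w)) ^ 2)
  with ((exp (Re w)) ^ 2 * (Rsqr (sin (Im w)) + Rsqr (cos (Im w)))) by (unfold Rsqr; ring).
rewrite sin2_cos2, Rmult_1_r; apply sqrt_pow2, Rlt_le, exp_pos.
Qed.

Lemma im_le_Cmod (z : C) : Rabs (Im z) <= Cmod z.
Proof. eapply Rle_trans; [apply Rmax_r | apply Rmax_Cmod]. Qed.

Lemma Cmod_le_Rabs (x y : R) : Cmod (x, y) <= Rabs x + Rabs y.
Proof.
pose proof (Rabs_pos x); pose proof (Rabs_pos y).
rewrite Cmod_eq, <- (pow2_abs x), <- (pow2_abs y).
rewrite <- (sqrt_pow2 (Rabs x + Rabs y)) by lra.
apply sqrt_le_1_alt; nra.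
Qed.

Lemma is_derive_small (f : R -> R) (l : R) : is_derive f 0 l ->
  forall eps, 0 < eps -> exists d, 0 < d /\
    forall x, Rabs x < d -> Rabs (f x - f 0 - l * x) <= eps * Rabs x.
Proof.
intros H eps Heps; destruct H as [_ H].
destruct (H 0 (fun P HP => HP) (mkposreal eps Heps)) as [d Hd].
exists d; split; [apply cond_pos|]; intros x Hx.
specialize (Hd x); cbn in Hd.
assert (Hb : ball 0 d x) by (change (Rabs (x - 0) < d); rewrite Rminus_0_r; exact Hx).
specialize (Hd Hb).
change (Rabs (f x - f 0 - (x - 0) * l) <= eps * Rabs (x - 0)) in Hd.
rewrite Rminus_0_r, (Rmult_comm x) in Hd; exact Hd.
Qed.

(* e^x cos y - 1 - x = e^x (cos y - 1) + (e^x - 1 - x), and similarly for the sine. *)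
Lemma cdiff_Cexp_0 : cdiff Cexp 0.
Proof.
exists 1%C; intros eps Heps.
assert (De : is_derive exp 0 1) by (auto_derive; [exact I | rewrite exp_0; ring]).
assert (Dc : is_derive cos 0 0) by (auto_derive; [exact I | rewrite sin_0; ring]).
assert (Ds : is_derive sin 0 1) by (auto_derive; [exact I | rewrite cos_0; ring]).
destruct (is_derive_small _ _ De (eps / 20)) as [d1 [Hd1 H1]]; [lra|].
destruct (is_derive_small _ _ De 1) as [d4 [Hd4 H4]]; [lra|].
destruct (is_derive_small _ _ Dc (eps / 20)) as [d2 [Hd2 H2]]; [lra|].
destruct (is_derive_small _ _ Ds (eps / 20)) as [d3 [Hd3 H3]]; [lra|].
exists (Rmin (Rmin (Rmin d1 d2) (Rmin d3 d4)) (Rmin (1/2) (eps / 20))); split.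
{ repeat apply Rmin_pos; lra. }
intros [x y] Hw; rewrite Cexp_0.
replace ((x, y) - 0)%C with (x, y) in * by (unfold Cminus, Cplus, Copp; simpl; f_equal; ring).
set (t := Cmod (x, y)) in *.
assert (Hx : Rabs x <= t) by (apply (re_le_Cmod (x, y))).
assert (Hy : Rabs y <= t) by (apply (im_le_Cmod (x, y))).
repeat apply Rmin_Rgt_l in Hw.
destruct Hw as [Hw1 Hw2]; apply Rmin_Rgt_l in Hw1; apply Rmin_Rgt_l in Hw2.
destruct Hw1 as [Hw1 Hw3]; apply Rmin_Rgt_l in Hw1; apply Rmin_Rgt_l in Hw3.
specialize (H1 x ltac:(lra)); specialize (H2 y ltac:(lra)); specialize (H3 y ltac:(lra)).
specialize (H4 x ltac:(lra)).
rewrite exp_0 in H1, H4; rewrite cos_0 in H2; rewrite sin_0 in H3.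
set (e := exp x) in *; set (c := cos y) in *; set (s := sin y) in *.
assert (Ee : Rabs (e - 1) <= 2 * t).
{ replace (e - 1) with ((e - 1 - 1 * x) + x) by ring.
  eapply Rle_trans; [apply Rabs_triang | lra]. }
assert (He : Rabs e <= 2).
{ replace e with ((e - 1) + 1) by ring; eapply Rle_trans; [apply Rabs_triang|].
  rewrite Rabs_R1; lra. }
assert (Ht : 0 <= t) by apply Cmod_ge_0.
replace (Cexp (x, y) - 1 - 1 * (x, y))%C with
  (e * (c - 1 - 0 * y) + (e - 1 - 1 * x), e * (s - 0 - 1 * y) + (e - 1) * y).
2:{ unfold Cexp, Cminus, Cplus, Copp, Cmult; simpl; fold e c s; f_equal; ring. }
eapply Rle_trans; [apply Cmod_le_Rabs|].
assert (H1' : Rabs (e - 1 - 1 * x) <= eps / 20 * t) by nra.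
assert (H2' : Rabs (c - 1 - 0 * y) <= eps / 20 * t) by nra.
assert (H3' : Rabs (s - 0 - 1 * y) <= eps / 20 * t) by nra.
assert (A1 : Rabs (e * (c - 1 - 0 * y) + (e - 1 - 1 * x)) <= 2 * (eps / 20 * t) + eps / 20 * t).
{ eapply Rle_trans; [apply Rabs_triang|]; rewrite Rabs_mult.
  apply Rplus_le_compat; [apply Rmult_le_compat|]; try apply Rabs_pos; assumption. }
assert (A2 : Rabs (e * (s - 0 - 1 * y) + (e - 1) * y) <= 2 * (eps / 20 * t) + 2 * t * (eps / 20)).
{ eapply Rle_trans; [apply Rabs_triang|]; rewrite !Rabs_mult.
  apply Rplus_le_compat; apply Rmult_le_compat; try apply Rabs_pos; try assumption; lra. }
nra.
Qed.

Lemma cdiff_Cexp (z : C) : cdiff Cexp z.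
Proof.
apply (cdiff_ext (fun w => Cexp z * Cexp (w - z))%C).
{ intros w; rewrite <- Cexp_plus; f_equal; ring. }
apply cdiff_scal, (cdiff_comp Cexp (fun w => w - z)%C).
- replace (z - z)%C with (RtoC 0) by ring; apply cdiff_Cexp_0.
- apply cdiff_minus; [apply cdiff_id | apply cdiff_const].
Qed.

(** * Goursat's theorem *)

Lemma nested_intervals (a w : nat -> R) :
  (forall n, a n <= a (S n)) -> (forall n, a (S n) + w (S n) <= a n + w n) ->
  (forall n, 0 <= w n) -> exists x, forall n, a n <= x <= a n + w n.
Proof.
intros Ha Hb Hw.
assert (Ha' : forall n k, a n <= a (n + k)%nat).
{ intros n k; induction k as [|k IH]; [rewrite Nat.add_0_r; lra|].
  rewrite Nat.add_succ_r; eapply Rle_trans; [exact IH | apply Ha]. }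
assert (Hb' : forall n k, a (n + k)%nat + w (n + k)%nat <= a n + w n).
{ intros n k; induction k as [|k IH]; [rewrite Nat.add_0_r; lra|].
  rewrite Nat.add_succ_r; eapply Rle_trans; [apply Hb | exact IH]. }
assert (Hab : forall k n, a k <= a n + w n).
{ intros k n; specialize (Ha' k n); specialize (Hb' n k).
  rewrite Nat.add_comm in Hb'; specialize (Hw (k + n)%nat); lra. }
destruct (completeness (fun y => exists n, y = a n)) as [x [Hx1 Hx2]].
- exists (a 0%nat + w 0%nat); intros y [n ->]; apply Hab.
- exists (a 0%nat), 0%nat; reflexivity.
- exists x; intros n; split.
  + apply Hx1; exists n; reflexivity.
  + apply Hx2; intros y [k ->]; apply Hab.
Qed.

(* Goursat's bisection argument for an additive rectangle function. *)
Lemma additive_rectangle_zero (J : R -> R -> R -> R -> R) (a0 c0 W h : R) :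
  0 < W -> 0 < h ->
  (forall a m b c n d, a0 <= a <= m -> m <= b <= a0 + W -> c0 <= c <= n -> n <= d <= c0 + h ->
    J a b c d = J a m c n + J m b c n + (J a m n d + J m b n d)) ->
  (forall x y, a0 <= x <= a0 + W -> c0 <= y <= c0 + h -> forall eps, 0 < eps ->
    exists delta, 0 < delta /\ forall a b c d,
      a0 <= a <= x -> x <= b <= a0 + W -> c0 <= c <= y -> y <= d <= c0 + h ->
      (b - a) + (d - c) < delta -> Rabs (J a b c d) <= eps * ((b - a) + (d - c)) ^ 2) ->
  J a0 (a0 + W) c0 (c0 + h) = 0.
Proof.
intros HW Hh Hadd Hloc.
set (J0 := J a0 (a0 + W) c0 (c0 + h)).
set (wd := fun n : nat => W / 2 ^ n); set (ht := fun n : nat => h / 2 ^ n).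
assert (Hw0 : forall n, 0 < wd n).
{ intros n; apply Rdiv_lt_0_compat; [exact HW | apply pow_lt; lra]. }
assert (Hh0 : forall n, 0 < ht n).
{ intros n; apply Rdiv_lt_0_compat; [exact Hh | apply pow_lt; lra]. }
assert (HwS : forall n, wd n = wd (S n) + wd (S n)).
{ intros n; unfold wd; simpl; field; apply pow_nonzero; lra. }
assert (HhS : forall n, ht n = ht (S n) + ht (S n)).
{ intros n; unfold ht; simpl; field; apply pow_nonzero; lra. }
(* [p] is the lower left corner of a rectangle of generation [n] that keeps at least the share
   4^(-n) of |J0|; one of its four quarters always keeps its own share. *)
set (P := fun n (p : R * R) => a0 <= fst p /\ fst p + wd n <= a0 + W /\
  c0 <= snd p /\ snd p + ht n <= c0 + h /\
  Rabs J0 / 4 ^ n <= Rabs (J (fst p) (fst p + wd n) (snd p) (snd p + ht n))).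
set (Nx := fun n (p q : R * R) => P (S n) q /\
  fst p <= fst q /\ fst q + wd (S n) <= fst p + wd n /\
  snd p <= snd q /\ snd q + ht (S n) <= snd p + ht n).
assert (step : forall n p, P n p -> exists q, Nx n p q).
{ intros n [a c] (H1 & H2 & H3 & H4 & H5); simpl in *.
  pose proof (Hw0 (S n)) as Hw; pose proof (Hh0 (S n)) as Hhn.
  pose proof (HwS n) as EW; pose proof (HhS n) as EH.
  rewrite (Hadd a (a + wd (S n)) (a + wd n) c (c + ht (S n)) (c + ht n)) in H5 by lra.
  replace (a + wd n) with (a + wd (S n) + wd (S n)) in H5 by lra.
  replace (c + ht n) with (c + ht (S n) + ht (S n)) in H5 by lra.
  assert (E4 : Rabs J0 / 4 ^ n = 4 * (Rabs J0 / 4 ^ S n)).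
  { simpl; field; apply pow_nonzero; lra. }
  rewrite E4 in H5.
  set (A := Rabs J0 / 4 ^ S n) in *.
  set (J1 := J a (a + wd (S n)) c (c + ht (S n))) in *.
  set (J2 := J (a + wd (S n)) (a + wd (S n) + wd (S n)) c (c + ht (S n))) in *.
  set (J3 := J a (a + wd (S n)) (c + ht (S n)) (c + ht (S n) + ht (S n))) in *.
  set (J4 := J (a + wd (S n)) (a + wd (S n) + wd (S n)) (c + ht (S n)) (c + ht (S n) + ht (S n))) in *.
  assert (H6 : 4 * A <= Rabs J1 + Rabs J2 + (Rabs J3 + Rabs J4)).
  { eapply Rle_trans; [exact H5|]; eapply Rle_trans; [apply Rabs_triang|].
    apply Rplus_le_compat; apply Rabs_triang. }
  destruct (Rle_dec A (Rabs J1)) as [K|K1].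
  { exists (a, c); unfold Nx, P; simpl; repeat split; try lra; exact K. }
  destruct (Rle_dec A (Rabs J2)) as [K|K2].
  { exists (a + wd (S n), c); unfold Nx, P; simpl; repeat split; try lra; exact K. }
  destruct (Rle_dec A (Rabs J3)) as [K|K3].
  { exists (a, c + ht (S n)); unfold Nx, P; simpl; repeat split; try lra; exact K. }
  exists (a + wd (S n), c + ht (S n)); unfold Nx, P; simpl; repeat split; try lra.
  change (A <= Rabs J4); lra. }
set (s := fix s (n : nat) : R * R := match n with
  | O => (a0, c0) | S k => epsilon (inhabits (0, 0)) (Nx k (s k)) end).
assert (Hs : forall n, P n (s n)).
{ induction n as [|n IH].
  - unfold P, wd, ht; simpl; unfold Rdiv; rewrite Rinv_1, !Rmult_1_r.
    fold J0; repeat split; lra.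
  - simpl; destruct (step n (s n) IH) as [q Hq].
    pose proof (epsilon_spec (inhabits (0, 0)) (Nx n (s n)) (ex_intro _ q Hq)) as [K _]; exact K. }
assert (Hn : forall n, Nx n (s n) (s (S n))).
{ intros n; destruct (step n (s n) (Hs n)) as [q Hq].
  exact (epsilon_spec (inhabits (0, 0)) (Nx n (s n)) (ex_intro _ q Hq)). }
destruct (nested_intervals (fun n => fst (s n)) wd) as [x Hx].
{ intros n; apply (Hn n). } { intros n; apply (Hn n). } { intros n; apply Rlt_le, Hw0. }
destruct (nested_intervals (fun n => snd (s n)) ht) as [y Hy].
{ intros n; apply (Hn n). } { intros n; apply (Hn n). } { intros n; apply Rlt_le, Hh0. }
assert (Bx : a0 <= x <= a0 + W).
{ specialize (Hx 0%nat); destruct (Hs 0%nat) as (H1 & H2 & _); lra. }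
assert (By : c0 <= y <= c0 + h).
{ specialize (Hy 0%nat); destruct (Hs 0%nat) as (_ & _ & H1 & H2 & _); lra. }
destruct (Req_dec J0 0) as [E|E]; [exact E|exfalso].
apply Rabs_pos_lt in E.
(* At generation n the local bound is eps (W+h)^2 / 4^n, which for this [eps] is half of the share
   |J0| / 4^n kept by the bisection. *)
set (eps := Rabs J0 / (2 * (W + h) ^ 2)).
assert (HWh : 0 < (W + h) ^ 2) by (apply pow_lt; lra).
assert (Heps : 0 < eps) by (apply Rdiv_lt_0_compat; lra).
destruct (Hloc x y Bx By eps Heps) as [delta [Hd Hl]].
destruct (pow_lt_1_zero (1 / 2) ltac:(rewrite Rabs_right; lra) (delta / (W + h))) as [n Hnn].
{ apply Rdiv_lt_0_compat; lra. }
specialize (Hnn n (le_n n)).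
assert (H2n : 0 < 2 ^ n) by (apply pow_lt; lra).
assert (E2 : (1 / 2) ^ n = / 2 ^ n).
{ unfold Rdiv; rewrite Rmult_1_l, pow_inv; reflexivity. }
rewrite E2, Rabs_right in Hnn by (apply Rle_ge, Rlt_le, Rinv_0_lt_compat, H2n).
destruct (Hs n) as (H1 & H2 & H3 & H4 & H5).
specialize (Hx n); specialize (Hy n); simpl in Hx, Hy.
assert (Esum : wd n + ht n = (W + h) * / 2 ^ n) by (unfold wd, ht; field; lra).
specialize (Hl (fst (s n)) (fst (s n) + wd n) (snd (s n)) (snd (s n) + ht n)
  ltac:(lra) ltac:(lra) ltac:(lra) ltac:(lra)).
replace (fst (s n) + wd n - fst (s n) + (snd (s n) + ht n - snd (s n)))
  with ((W + h) * / 2 ^ n) in Hl by lra.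
assert (Hlt : (W + h) * / 2 ^ n < delta).
{ apply Rmult_lt_reg_l with (/ (W + h)); [apply Rinv_0_lt_compat; lra|].
  replace (/ (W + h) * ((W + h) * / 2 ^ n)) with (/ 2 ^ n) by (field; lra).
  rewrite Rmult_comm; exact Hnn. }
specialize (Hl Hlt).
assert (E4 : 4 ^ n = 2 ^ n * 2 ^ n) by (rewrite <- Rpow_mult_distr; f_equal; lra).
assert (K : Rabs J0 / 4 ^ n <= Rabs J0 / 4 ^ n / 2).
{ eapply Rle_trans; [exact H5|]; eapply Rle_trans; [exact Hl|].
  unfold eps; rewrite E4; right; field; lra. }
assert (0 < Rabs J0 / 4 ^ n) by (apply Rdiv_lt_0_compat; [exact E | apply pow_lt; lra]).
lra.
Qed.

Lemma continuous_eps (f : R -> R) (x : R) :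
  (forall eps, 0 < eps -> exists d, 0 < d /\ forall y, Rabs (y - x) < d -> Rabs (f y - f x) < eps) ->
  continuous f x.
Proof.
intros H P [eps HP]; destruct (H eps (cond_pos eps)) as [d [Hd Hf]].
exists (mkposreal d Hd); intros y Hy; apply HP, Hf, Hy.
Qed.

Lemma Cmod_fst (x y z : R) : Cmod ((x, y) - (z, y)) = Rabs (x - z).
Proof.
replace ((x, y) - (z, y))%C with (RtoC (x - z)); [apply Cmod_R|].
unfold Cminus, Cplus, Copp, RtoC; simpl; f_equal; ring.
Qed.

Lemma Cmod_snd (x y z : R) : Cmod ((x, y) - (x, z)) = Rabs (y - z).
Proof.
replace ((x, y) - (x, z))%C with (Ci * RtoC (y - z))%C.
- rewrite Cmod_mult, Cmod_Ci, Cmod_R; ring.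
- unfold Cminus, Cplus, Copp, RtoC, Ci, Cmult; simpl; f_equal; ring.
Qed.

Lemma Re_minus (z w : C) : Re (z - w) = Re z - Re w.
Proof. destruct z, w; reflexivity. Qed.
Lemma Im_minus (z w : C) : Im (z - w) = Im z - Im w.
Proof. destruct z, w; reflexivity. Qed.
Lemma Re_plus (z w : C) : Re (z + w) = Re z + Re w.
Proof. destruct z, w; reflexivity. Qed.

Lemma cdiff_slices_continuous (g : C -> C) (x y : R) : cdiff g (x, y) ->
  continuous (fun t => Im (g (t, y))) x /\ continuous (fun t => Re (g (x, t))) y.
Proof.
intros H; split; apply continuous_eps; intros eps Heps;
  destruct (cdiff_continuous g _ H eps Heps) as [d [Hd Hg]];
  exists d; (split; [exact Hd|]); intros t Ht.
- rewrite <- Im_minus; eapply Rle_lt_trans; [apply im_le_Cmod|].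
  apply Hg; rewrite Cmod_fst; exact Ht.
- rewrite <- Re_minus; eapply Rle_lt_trans; [apply re_le_Cmod|].
  apply Hg; rewrite Cmod_snd; exact Ht.
Qed.

Lemma RInt_abs_le (f : R -> R) (a b M : R) : a <= b -> ex_RInt f a b ->
  (forall x, a <= x <= b -> Rabs (f x) <= M) -> Rabs (RInt f a b) <= (b - a) * M.
Proof.
intros Hab Hf HM; apply (norm_RInt_le_const f a b); [exact Hab | exact HM |].
apply (RInt_correct (V := R_CompleteNormedModule)), Hf.
Qed.

(** The left side is the imaginary part of the contour integral of [g]. This part suffices, because
    it places Re g on the vertical sides, which become circles in logarithmic coordinates. *)
Lemma goursat_rectangle (g : C -> C) (a0 b0 c0 d0 : R) : a0 < b0 -> c0 < d0 ->
  (forall x y, a0 <= x <= b0 -> c0 <= y <= d0 -> cdiff g (x, y)) ->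
  RInt (fun x => Im (g (x, c0))) a0 b0 - RInt (fun x => Im (g (x, d0))) a0 b0
  + (RInt (fun y => Re (g (b0, y))) c0 d0 - RInt (fun y => Re (g (a0, y))) c0 d0) = 0.
Proof.
intros Hab Hcd Hg.
set (J := fun a b c d => RInt (fun x => Im (g (x, c))) a b - RInt (fun x => Im (g (x, d))) a b
  + (RInt (fun y => Re (g (b, y))) c d - RInt (fun y => Re (g (a, y))) c d)).
assert (HI : forall a b y, a0 <= a -> a <= b -> b <= b0 -> c0 <= y <= d0 ->
  ex_RInt (fun x => Im (g (x, y))) a b).
{ intros a b y H1 H2 H3 Hy; apply (ex_RInt_continuous (V := R_CompleteNormedModule)).
  intros x; rewrite Rmin_left, Rmax_right by lra; intros Hx.
  apply (cdiff_slices_continuous g x y), Hg; lra. }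
assert (HR : forall c d x, c0 <= c -> c <= d -> d <= d0 -> a0 <= x <= b0 ->
  ex_RInt (fun y => Re (g (x, y))) c d).
{ intros c d x H1 H2 H3 Hx; apply (ex_RInt_continuous (V := R_CompleteNormedModule)).
  intros y; rewrite Rmin_left, Rmax_right by lra; intros Hy.
  apply (cdiff_slices_continuous g x y), Hg; lra. }
cut (J a0 (a0 + (b0 - a0)) c0 (c0 + (d0 - c0)) = 0).
{ unfold J; replace (a0 + (b0 - a0)) with b0 by ring.
  replace (c0 + (d0 - c0)) with d0 by ring; trivial. }
apply additive_rectangle_zero; try lra.
- replace (a0 + (b0 - a0)) with b0 by ring; replace (c0 + (d0 - c0)) with d0 by ring.
  intros a m b c n d H1 H2 H3 H4; unfold J.
  assert (CI : forall y, c0 <= y <= d0 -> RInt (fun x => Im (g (x, y))) a b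
    = RInt (fun x => Im (g (x, y))) a m + RInt (fun x => Im (g (x, y))) m b).
  { intros y Hy; symmetry; apply (RInt_Chasles (V := R_CompleteNormedModule)); apply HI; lra. }
  assert (CR : forall x, a0 <= x <= b0 -> RInt (fun y => Re (g (x, y))) c d
    = RInt (fun y => Re (g (x, y))) c n + RInt (fun y => Re (g (x, y))) n d).
  { intros x Hx; symmetry; apply (RInt_Chasles (V := R_CompleteNormedModule)); apply HR; lra. }
  rewrite !CI, !CR by lra; ring.
- replace (a0 + (b0 - a0)) with b0 by ring; replace (c0 + (d0 - c0)) with d0 by ring.
  intros x y Hx Hy eps Heps; destruct (Hg x y Hx Hy) as [l Hl].
  destruct (Hl (eps / 2)) as [delta [Hd Hw]]; [lra|].
  exists delta; split; [exact Hd|]; intros a b c d Ha Hb Hc Hdd Hlt.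
  set (D := b - a + (d - c)) in *.
  set (e := fun w : C => (g w - g (x, y) - l * (w - (x, y)))%C).
  assert (He : forall u v, a <= u <= b -> c <= v <= d -> Cmod (e (u, v)) <= eps / 2 * D).
  { intros u v Hu Hv.
    assert (Hm : Cmod ((u, v) - (x, y)) <= D).
    { eapply Rle_trans; [apply Cmod_le_Rabs|]; unfold D; simpl.
      apply Rplus_le_compat; apply Rabs_le; lra. }
    eapply Rle_trans; [apply Hw; lra|]; apply Rmult_le_compat_l; lra. }
  assert (EI : RInt (fun u => Im (g (u, c))) a b - RInt (fun u => Im (g (u, d))) a b
    = RInt (fun u => Im (e (u, c)) - Im (e (u, d))) a b + (b - a) * (Re l * (c - d))).
  { rewrite <- (RInt_minus (V := R_CompleteNormedModule)) by (apply HI; lra).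
    transitivity (RInt (fun u => plus (Im (e (u, c)) - Im (e (u, d))) (Re l * (c - d))) a b).
    - apply RInt_ext; intros u _; unfold e, minus, plus, opp, Re, Im, Cminus, Cplus, Copp, Cmult; simpl; ring.
    - rewrite (RInt_plus (V := R_CompleteNormedModule)).
      + rewrite RInt_const; reflexivity.
      + apply (ex_RInt_ext (fun u => plus (minus (Im (g (u, c))) (Im (g (u, d)))) (- (Re l * (c - d))))).
        * intros u _; unfold e, minus, plus, opp, Re, Im, Cminus, Cplus, Copp, Cmult; simpl; ring.
        * apply (ex_RInt_plus (V := R_NormedModule)); [|apply ex_RInt_const].
          apply (ex_RInt_minus (V := R_NormedModule)); apply HI; lra.
      + apply ex_RInt_const. }
  assert (ER : RInt (fun v => Re (g (b, v))) c d - RInt (fun v => Re (g (a, v))) c d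
    = RInt (fun v => Re (e (b, v)) - Re (e (a, v))) c d + (d - c) * (Re l * (b - a))).
  { rewrite <- (RInt_minus (V := R_CompleteNormedModule)) by (apply HR; lra).
    transitivity (RInt (fun v => plus (Re (e (b, v)) - Re (e (a, v))) (Re l * (b - a))) c d).
    - apply RInt_ext; intros u _; unfold e, minus, plus, opp, Re, Im, Cminus, Cplus, Copp, Cmult; simpl; ring.
    - rewrite (RInt_plus (V := R_CompleteNormedModule)).
      + rewrite RInt_const; reflexivity.
      + apply (ex_RInt_ext (fun v => plus (minus (Re (g (b, v))) (Re (g (a, v)))) (- (Re l * (b - a))))).
        * intros u _; unfold e, minus, plus, opp, Re, Im, Cminus, Cplus, Copp, Cmult; simpl; ring.
        * apply (ex_RInt_plus (V := R_NormedModule)); [|apply ex_RInt_const].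
          apply (ex_RInt_minus (V := R_NormedModule)); apply HR; lra.
      + apply ex_RInt_const. }
  unfold J; rewrite EI, ER.
  (* The linear parts of [g] contribute Re l (b-a)(c-d) and its opposite; only the differentiability
     errors remain. *)
  match goal with |- Rabs (?A + ?B + (?C + ?E)) <= _ =>
    replace (A + B + (C + E)) with (A + C) by ring end.
  eapply Rle_trans; [apply Rabs_triang|].
  replace (eps * D ^ 2) with ((b - a) * (eps * D) + (d - c) * (eps * D)) by (unfold D; ring).
  apply Rplus_le_compat.
  + apply RInt_abs_le; [lra| |].
    * apply (ex_RInt_ext (fun u => plus (minus (Im (g (u, c))) (Im (g (u, d)))) (- (Re l * (c - d))))).
      { intros u _; unfold e, minus, plus, opp, Re, Im, Cminus, Cplus, Copp, Cmult; simpl; ring. }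
      apply (ex_RInt_plus (V := R_NormedModule)); [|apply ex_RInt_const].
      apply (ex_RInt_minus (V := R_NormedModule)); apply HI; lra.
    * intros u Hu; rewrite <- Im_minus; eapply Rle_trans; [apply im_le_Cmod|].
      eapply Rle_trans; [apply Cmod_minus_le|].
      pose proof (He u c Hu ltac:(lra)); pose proof (He u d Hu ltac:(lra)); lra.
  + apply RInt_abs_le; [lra| |].
    * apply (ex_RInt_ext (fun v => plus (minus (Re (g (b, v))) (Re (g (a, v)))) (- (Re l * (b - a))))).
      { intros u _; unfold e, minus, plus, opp, Re, Im, Cminus, Cplus, Copp, Cmult; simpl; ring. }
      apply (ex_RInt_plus (V := R_NormedModule)); [|apply ex_RInt_const].
      apply (ex_RInt_minus (V := R_NormedModule)); apply HR; lra.
    * intros u Hu; rewrite <- Re_minus; eapply Rle_trans; [apply re_le_Cmod|].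
      eapply Rle_trans; [apply Cmod_minus_le|].
      pose proof (He b u ltac:(lra) Hu); pose proof (He a u ltac:(lra) Hu); lra.
Qed.

(** * Maximum principles *)

Lemma Cexp_log_polar (x y : R) : Cexp (x, y) = (RtoC (exp x) * eit y)%C.
Proof. unfold Cexp, eit, RtoC, Cmult; simpl; f_equal; ring. Qed.

Lemma Cmod_eit (t : R) : Cmod (eit t) = 1.
Proof.
unfold eit; rewrite Cmod_eq.
replace (cos t ^ 2 + sin t ^ 2) with (Rsqr (sin t) + Rsqr (cos t)) by (unfold Rsqr; ring).
rewrite sin2_cos2; apply sqrt_1.
Qed.

(* In logarithmic coordinates the circle means become integrals over vertical sides of a
   rectangle of height 2 pi, whose horizontal sides cancel by periodicity. *)
Lemma re_le_circle_max (G : C -> C) (R0 rho v : R) : 0 < rho < R0 ->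
  (forall z, Cmod z < R0 -> cdiff G z) ->
  (forall t, Re (G (RtoC rho * eit t)%C) <= v) -> Re (G 0%C) <= v.
Proof.
intros [Hr HR] HG Hv; apply Rnot_lt_le; intros Hlt.
set (eta := (Re (G 0%C) - v) / 2).
destruct (cdiff_continuous G 0) with (eps := eta) as [d [Hd Hc]].
{ apply HG; rewrite Cmod_0; lra. } { unfold eta; lra. }
set (x2 := ln rho); set (x1 := Rmin (ln d) x2 - 1).
assert (E2 : exp x2 = rho) by (apply exp_ln, Hr).
assert (H12 : x1 < x2) by (unfold x1; pose proof (Rmin_r (ln d) x2); lra).
assert (H1d : exp x1 < d).
{ rewrite <- (exp_ln d Hd); apply exp_increasing; unfold x1; pose proof (Rmin_l (ln d) x2); lra. }
assert (HP : 0 < 2 * PI) by (pose proof PI_RGT_0; lra).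
set (g := fun w => G (Cexp w)).
assert (Hg : forall x y, x1 <= x <= x2 -> 0 <= y <= 2 * PI -> cdiff g (x, y)).
{ intros x y Hx _; apply (cdiff_comp G Cexp); [|apply cdiff_Cexp].
  apply HG; rewrite Cmod_Cexp; simpl.
  apply Rle_lt_trans with rho; [|exact HR]; rewrite <- E2.
  destruct (proj2 Hx) as [K|K]; [left; apply exp_increasing, K | right; f_equal; exact K]. }
pose proof (goursat_rectangle g x1 x2 0 (2 * PI) H12 HP Hg) as HJ.
assert (EP : RInt (fun x => Im (g (x, 0))) x1 x2 = RInt (fun x => Im (g (x, 2 * PI))) x1 x2).
{ apply RInt_ext; intros x _; unfold g; do 2 f_equal; unfold Cexp; simpl.
  rewrite cos_0, sin_0, cos_2PI, sin_2PI; reflexivity. }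
assert (HI : forall x, x1 <= x <= x2 -> ex_RInt (fun y => Re (g (x, y))) 0 (2 * PI)).
{ intros x Hx; apply (ex_RInt_continuous (V := R_CompleteNormedModule)).
  intros y; rewrite Rmin_left, Rmax_right by lra; intros Hy.
  apply (cdiff_slices_continuous g x y), Hg; lra. }
assert (Hub : RInt (fun y => Re (g (x2, y))) 0 (2 * PI) <= 2 * PI * v).
{ replace (2 * PI * v) with (RInt (fun _ => v) 0 (2 * PI)).
  - apply RInt_le; [lra | apply HI; lra | apply ex_RInt_const |].
    intros y _; unfold g; rewrite Cexp_log_polar, E2; apply Hv.
  - rewrite RInt_const; unfold scal; simpl; unfold mult; simpl; ring. }
assert (Hlb : 2 * PI * (Re (G 0%C) - eta) <= RInt (fun y => Re (g (x1, y))) 0 (2 * PI)).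
{ replace (2 * PI * (Re (G 0%C) - eta)) with (RInt (fun _ => Re (G 0%C) - eta) 0 (2 * PI)).
  - apply RInt_le; [lra | apply ex_RInt_const | apply HI; lra |].
    intros y _; unfold g.
    assert (K : Cmod (G (Cexp (x1, y)) - G 0) < eta).
    { apply Hc; replace (Cexp (x1, y) - 0)%C with (Cexp (x1, y)) by ring.
      rewrite Cmod_Cexp; exact H1d. }
    pose proof (re_le_Cmod (G (Cexp (x1, y)) - G 0)) as K2; rewrite Re_minus in K2.
    apply Rabs_le_between in K2; lra.
  - rewrite RInt_const; unfold scal; simpl; unfold mult; simpl; ring. }
assert (2 * PI * (Re (G 0%C) - eta) <= 2 * PI * v) by lra.
apply Rmult_le_reg_l in H; [|exact HP]; unfold eta in H; lra.
Qed.

(** Heine-Borel on the square around the disk. Compactness gives closeness in each coordinate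
    separately, so |w-z| is only bounded by twice the radius: hence [2 * d]. Its conclusion is
    doubly negated, hence [NNPP]. *)
Lemma square_uniform (r : R) (Q : C -> R -> Prop) :
  (forall z d d', 0 < d' <= d -> Q z d -> Q z d') ->
  (forall z, exists d, 0 < d /\ forall w, Cmod (w - z) < 2 * d -> Q w d) ->
  exists d, 0 < d /\ forall w, Cmod w <= r -> Q w d.
Proof.
intros Hmon Hloc.
assert (Hch : forall x y : R, exists d : posreal, forall w, Cmod (w - (x, y)) < 2 * d -> Q w d).
{ intros x y; destruct (Hloc (x, y)) as [d [Hd Hw]]; exists (mkposreal d Hd); exact Hw. }
set (delta := fun x y => proj1_sig (constructive_indefinite_description _ (Hch x y))).
destruct (compactness_value_2d (- r) r (- r) r delta) as [d Hd].
exists d; split; [apply cond_pos|]; intros [x y] Hw.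
pose proof (re_le_Cmod (x, y)) as Hx; pose proof (im_le_Cmod (x, y)) as Hy; simpl in Hx, Hy.
apply NNPP; intros Hn.
apply (Hd x y); [apply Rabs_le_between; lra | apply Rabs_le_between; lra|].
intros (u & v & _ & _ & H1 & H2 & H3); apply Hn.
apply Hmon with (delta u v); [split; [apply cond_pos | exact H3]|].
unfold delta in *; destruct (constructive_indefinite_description _ (Hch u v)) as [e He]; simpl in *.
apply He; eapply Rle_lt_trans; [apply Cmod_le_Rabs|]; simpl; unfold Rminus in *; lra.
Qed.

(** The uniform radius d of [square_uniform] doubles as a bound. Used with u <= 1/d it shows that
    the supremum S is finite; if S were not attained, used with u <= S - d it would contradict
    minimality of S. Closedness of [X] is stated as openness of its complement. *)
Lemma compact_max (X : C -> Prop) (r : R) (u : C -> R) :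
  (forall z, X z -> Cmod z <= r) ->
  (forall z, ~ X z -> exists d, 0 < d /\ forall w, Cmod (w - z) < d -> ~ X w) ->
  (forall z, X z -> forall eps, 0 < eps -> exists d, 0 < d /\
     forall w, Cmod (w - z) < d -> Rabs (u w - u z) < eps) ->
  (exists z, X z) -> exists z, X z /\ forall w, X w -> u w <= u z.
Proof.
intros Hb Hcl Hu [z0 Hz0].
destruct (square_uniform r (fun w d => X w -> u w <= / d)) as [d1 [Hd1 H1]].
{ intros z d d' Hd H Hz; eapply Rle_trans; [apply H, Hz|].
  apply Rinv_le_contravar; lra. }
{ intros z; destruct (classic (X z)) as [Hz|Hz].
  - destruct (Hu z Hz 1 Rlt_0_1) as [d [Hd Hw]].
    set (m := Rmax 1 (u z + 1)).
    assert (Hm : 1 <= m) by apply Rmax_l.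
    assert (Hm' : u z + 1 <= m) by apply Rmax_r.
    assert (Hmi : 0 < / m) by (apply Rinv_0_lt_compat; lra).
    exists (Rmin (d / 2) (/ m)); split; [apply Rmin_pos; lra|].
    intros w Hwz _.
    assert (K : Rabs (u w - u z) < 1).
    { apply Hw; eapply Rlt_le_trans; [exact Hwz|]; pose proof (Rmin_l (d / 2) (/ m)); lra. }
    apply Rabs_def2 in K; apply Rle_trans with (/ / m).
    + rewrite Rinv_inv; lra.
    + apply Rinv_le_contravar; [apply Rmin_pos; lra | apply Rmin_r].
  - destruct (Hcl z Hz) as [d [Hd Hw]]; exists (d / 2); split; [lra|].
    intros w Hwz HX; exfalso; apply (Hw w); [lra | exact HX]. }
destruct (completeness (fun y => exists z, X z /\ y = u z)) as [S [HS1 HS2]].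
{ exists (/ d1); intros y [z [Hz ->]]; apply H1; [apply Hb, Hz | exact Hz]. }
{ exists (u z0), z0; split; [exact Hz0 | reflexivity]. }
apply NNPP; intros Hno.
assert (Hlt : forall z, X z -> u z < S).
{ intros z Hz; assert (Hle : u z <= S) by (apply HS1; exists z; split; [exact Hz | reflexivity]).
  destruct Hle as [K|K]; [exact K|]; exfalso; apply Hno; exists z; split; [exact Hz|].
  intros w Hw; rewrite K; apply HS1; exists w; split; [exact Hw | reflexivity]. }
destruct (square_uniform r (fun w d => X w -> u w <= S - d)) as [d2 [Hd2 H2]].
{ intros z d d' Hd H Hz; specialize (H Hz); lra. }
{ intros z; destruct (classic (X z)) as [Hz|Hz].
  - pose proof (Hlt z Hz) as HlS.
    destruct (Hu z Hz ((S - u z) / 2)) as [d [Hd Hw]]; [lra|].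
    exists (Rmin (d / 2) ((S - u z) / 2)); split; [apply Rmin_pos; lra|].
    intros w Hwz _; pose proof (Rmin_l (d / 2) ((S - u z) / 2)) as M1.
    pose proof (Rmin_r (d / 2) ((S - u z) / 2)) as M2.
    assert (K : Rabs (u w - u z) < (S - u z) / 2) by (apply Hw; lra).
    apply Rabs_def2 in K; lra.
  - destruct (Hcl z Hz) as [d [Hd Hw]]; exists (d / 2); split; [lra|].
    intros w Hwz HX; exfalso; apply (Hw w); [lra | exact HX]. }
assert (HS : S <= S - d2); [|lra].
apply HS2; intros y [z [Hz ->]]; apply H2; [apply Hb, Hz | exact Hz].
Qed.

Lemma Cmod_sqr_add (a b : C) :
  Cmod (a + b) ^ 2 = Cmod a ^ 2 + 2 * Re (Cconj a * b) + Cmod b ^ 2.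
Proof. rewrite !Cmod2_alt; destruct a, b; simpl; ring. Qed.

(* Perturbing |Phi|^2 by eps |z|^2 makes the mean value inequality strict, so an interior
   maximum is impossible. *)
Lemma max_modulus (Phi : C -> C) (X : C -> Prop) (r B : R) :
  0 <= B ->
  (forall z, X z -> Cmod z <= r) ->
  (forall z, ~ X z -> exists d, 0 < d /\ forall w, Cmod (w - z) < d -> ~ X w) ->
  (forall z, X z -> cdiff Phi z) ->
  (forall z, X z -> Cmod (Phi z) <= B \/
     exists d, 0 < d /\ forall w, Cmod (w - z) < d -> X w) ->
  forall z, X z -> Cmod (Phi z) <= B.
Proof.
intros HB Hb Hcl HD Hdi z0 Hz0; apply Rnot_lt_le; intros Hlt.
assert (Hr : 0 <= r) by (eapply Rle_trans; [apply Cmod_ge_0 | apply (Hb z0 Hz0)]).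
set (gap := Cmod (Phi z0) ^ 2 - B ^ 2).
assert (Hgap : 0 < gap) by (unfold gap; nra).
(* The perturbation is below the gap on |z| <= r, so a point with |Phi| <= B cannot maximise [u]. *)
set (eps := gap / (2 * (r ^ 2 + 1))).
assert (Hr2 : 0 < r ^ 2 + 1) by nra.
assert (Heps : 0 < eps) by (apply Rdiv_lt_0_compat; lra).
assert (Her : eps * r ^ 2 < gap).
{ unfold eps; apply Rmult_lt_reg_r with (2 * (r ^ 2 + 1)); [lra|].
  replace (gap / (2 * (r ^ 2 + 1)) * r ^ 2 * (2 * (r ^ 2 + 1))) with (gap * r ^ 2) by (field; lra).
  nra. }
set (u := fun z => Cmod (Phi z) ^ 2 + eps * Cmod z ^ 2).
assert (Hsq : forall (h : C -> C) z, cdiff h z -> forall e, 0 < e -> exists d, 0 < d /\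
  forall w, Cmod (w - z) < d -> Rabs (Cmod (h w) ^ 2 - Cmod (h z) ^ 2) < e).
{ intros h z Hh e He; set (m := Cmod (h z)).
  assert (Hm : 0 <= m) by apply Cmod_ge_0.
  destruct (cdiff_continuous h z Hh (Rmin 1 (e / (2 * m + 2)))) as [d [Hd Hw]].
  { apply Rmin_pos; [lra | apply Rdiv_lt_0_compat; lra]. }
  exists d; split; [exact Hd|]; intros w Hwz; specialize (Hw w Hwz).
  set (x := Cmod (h w)).
  assert (Hx : 0 <= x) by apply Cmod_ge_0.
  assert (K1 : Cmod (h w - h z) < 1) by (eapply Rlt_le_trans; [exact Hw | apply Rmin_l]).
  assert (K2 : Cmod (h w - h z) < e / (2 * m + 2)) by (eapply Rlt_le_trans; [exact Hw | apply Rmin_r]).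
  assert (K3 : (2 * m + 2) * Cmod (h w - h z) < e).
  { apply Rmult_lt_compat_l with (r := 2 * m + 2) in K2; [|lra].
    replace ((2 * m + 2) * (e / (2 * m + 2))) with e in K2 by (field; lra); exact K2. }
  pose proof (Cmod_triangle_rev (h w) (h z)) as T1; pose proof (Cmod_triangle_rev (h z) (h w)) as T2.
  rewrite (Cmod_minus_sym (h z)) in T2; fold x m in T1, T2.
  pose proof (Cmod_ge_0 (h w - h z)) as T0.
  apply Rabs_def1; nra. }
destruct (compact_max X r u Hb Hcl) as [zs [HXs Hmax]].
{ intros z Hz e He.
  destruct (Hsq Phi z (HD z Hz) (e / 2)) as [d1 [Hd1 H1]]; [lra|].
  destruct (Hsq (fun w => w) z (cdiff_id z) (e / (2 * eps))) as [d2 [Hd2 H2]].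
  { apply Rdiv_lt_0_compat; lra. }
  exists (Rmin d1 d2); split; [apply Rmin_pos; assumption|]; intros w Hw.
  specialize (H1 w ltac:(eapply Rlt_le_trans; [exact Hw | apply Rmin_l])).
  specialize (H2 w ltac:(eapply Rlt_le_trans; [exact Hw | apply Rmin_r])).
  unfold u; replace (Cmod (Phi w) ^ 2 + eps * Cmod w ^ 2 - (Cmod (Phi z) ^ 2 + eps * Cmod z ^ 2))
    with ((Cmod (Phi w) ^ 2 - Cmod (Phi z) ^ 2) + eps * (Cmod w ^ 2 - Cmod z ^ 2)) by ring.
  eapply Rle_lt_trans; [apply Rabs_triang|]; rewrite Rabs_mult, (Rabs_right eps) by lra.
  apply Rmult_lt_compat_l with (r := eps) in H2; [|exact Heps].
  replace (eps * (e / (2 * eps))) with (e / 2) in H2 by (field; lra); lra. }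
{ exists z0; exact Hz0. }
destruct (Hdi zs HXs) as [Hs|[d [Hd Hin]]].
- pose proof (Hmax z0 Hz0) as K; unfold u in K.
  pose proof (Hb zs HXs) as K1; pose proof (Cmod_ge_0 zs) as K2.
  pose proof (Cmod_ge_0 (Phi zs)) as K3; pose proof (pow2_ge_0 (Cmod z0)) as K4.
  assert (Cmod zs ^ 2 <= r ^ 2) by (apply pow_incr; lra).
  assert (Cmod (Phi zs) ^ 2 <= B ^ 2) by (apply pow_incr; lra).
  unfold gap in Her; nra.
- set (P := Phi zs).
  (* The square is linearised around P: |p|^2 = |P|^2 + 2 Re (conj P (p-P)) + |p-P|^2, and dropping
     the last square turns maximality at [zs] into an upper bound for the real part of an analytic
     function, lowered by eps |z|^2. *)
  set (G := fun z => (2 * Cconj P * Phi (zs + z) + 2 * eps * Cconj zs * z)%C).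
  assert (K : Re (G 0%C) <= 2 * Cmod P ^ 2 - eps * (d / 2) ^ 2).
  { apply (re_le_circle_max G d (d / 2)); [lra| |].
    - intros z Hz; apply cdiff_plus; apply cdiff_scal; [|apply cdiff_id].
      apply (cdiff_comp Phi (fun z => zs + z)%C).
      + apply HD, Hin; replace (zs + z - zs)%C with z by ring; exact Hz.
      + apply cdiff_plus; [apply cdiff_const | apply cdiff_id].
    - intros t; set (z := (RtoC (d / 2) * eit t)%C).
      assert (Hz : Cmod z = d / 2).
      { unfold z; rewrite Cmod_mult, Cmod_eit, Cmod_R, Rabs_right; lra. }
      assert (Hm : u (zs + z)%C <= u zs).
      { apply Hmax, Hin; replace (zs + z - zs)%C with z by ring; lra. }
      unfold u in Hm; rewrite (Cmod_sqr_add zs z), Hz in Hm.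
      set (p := Phi (zs + z)%C) in *.
      pose proof (Cmod_sqr_add P (p - P)) as E.
      replace (P + (p - P))%C with p in E by ring.
      pose proof (pow2_ge_0 (Cmod (p - P))) as E0.
      fold P in Hm; rewrite E in Hm.
      assert (EG : Re (G z) = 2 * Re (Cconj P * (p - P)) + 2 * Cmod P ^ 2
                     + 2 * eps * Re (Cconj zs * z)).
      { unfold G; fold p; rewrite Cmod2_alt; generalize p P z; intros [] [] [].
        destruct zs; simpl; ring. }
      rewrite EG; nra. }
  assert (E0 : Re (G 0%C) = 2 * Cmod P ^ 2).
  { unfold G; replace (zs + 0)%C with zs by ring; fold P; rewrite Cmod2_alt.
    destruct P, zs; simpl; ring. }
  assert (0 < eps * (d / 2) ^ 2) by (apply Rmult_lt_0_compat; [exact Heps | apply pow_lt; lra]); lra.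
Qed.

(** * Bounded convergence off a null set *)

Lemma continuous_Rabs_comp (f : R -> R) (x : R) : continuous f x -> continuous (fun y => Rabs (f y)) x.
Proof. intros H; apply (continuous_comp f Rabs); [exact H | apply continuous_Rabs]. Qed.

Lemma continuous_Rmax_fun (f g : R -> R) (x : R) :
  continuous f x -> continuous g x -> continuous (fun y => Rmax (f y) (g y)) x.
Proof.
intros Hf Hg.
apply (continuous_ext (fun y => (f y + g y + Rabs (f y - g y)) * / 2)).
{ intros y; unfold Rmax; destruct (Rle_dec (f y) (g y));
  [rewrite Rabs_left1 by lra | rewrite Rabs_right by lra]; match goal with |- ?u = ?v => change (@eq R u v) end; field. }
apply (continuous_mult (K := R_AbsRing)); [|apply continuous_const].
apply (continuous_plus (V := R_NormedModule)).
- apply (continuous_plus (V := R_NormedModule)); assumption.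
- apply continuous_Rabs_comp, (continuous_minus (V := R_NormedModule)); assumption.
Qed.

Lemma continuous_Rmin_fun (f g : R -> R) (x : R) :
  continuous f x -> continuous g x -> continuous (fun y => Rmin (f y) (g y)) x.
Proof.
intros Hf Hg.
apply (continuous_ext (fun y => f y + g y - Rmax (f y) (g y))).
{ intros y; unfold Rmax, Rmin; destruct (Rle_dec (f y) (g y)); match goal with |- ?u = ?v => change (@eq R u v) end; ring. }
apply (continuous_minus (V := R_NormedModule)).
- apply (continuous_plus (V := R_NormedModule)); assumption.
- apply continuous_Rmax_fun; assumption.
Qed.

Lemma ex_RInt_cont (f : R -> R) (a b : R) : (forall x, continuous f x) -> ex_RInt f a b.
Proof. intros H; apply (ex_RInt_continuous (V := R_CompleteNormedModule)); intros; apply H. Qed.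

Definition indic (al be x : R) : R :=
  if Rlt_dec al x then (if Rlt_dec x be then 1 else 0) else 0.

(** On the larger interval [A, B] the indicator is a step function with integral exactly be - al;
    the parts outside [a, b] are nonnegative. *)
Lemma RInt_indic (a b al be : R) : a <= b -> al <= be ->
  ex_RInt (indic al be) a b /\ RInt (indic al be) a b <= be - al.
Proof.
intros Hab Hal; set (A := Rmin a al); set (B := Rmax b be).
assert (HA1 : A <= a) by apply Rmin_l. assert (HA2 : A <= al) by apply Rmin_r.
assert (HB1 : b <= B) by apply Rmax_l. assert (HB2 : be <= B) by apply Rmax_r.
assert (HI : is_RInt (indic al be) A B (be - al)).
{ replace (be - al) with (plus (plus (scal (al - A) 0) (scal (be - al) 1)) (scal (B - be) 0)).
  2:{ unfold plus, scal; simpl; unfold mult; simpl; ring. }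
  apply (is_RInt_Chasles (V := R_NormedModule)) with be;
    [apply (is_RInt_Chasles (V := R_NormedModule)) with al|].
  - apply (is_RInt_ext (fun _ => 0)); [|apply (is_RInt_const (V := R_NormedModule))].
    intros x; rewrite Rmin_left, Rmax_right by lra; intros Hx; unfold indic.
    destruct (Rlt_dec al x); [lra | reflexivity].
  - apply (is_RInt_ext (fun _ => 1)); [|apply (is_RInt_const (V := R_NormedModule))].
    intros x; rewrite Rmin_left, Rmax_right by lra; intros Hx; unfold indic.
    destruct (Rlt_dec al x); [|lra]; destruct (Rlt_dec x be); [reflexivity | lra].
  - apply (is_RInt_ext (fun _ => 0)); [|apply (is_RInt_const (V := R_NormedModule))].
    intros x; rewrite Rmin_left, Rmax_right by lra; intros Hx; unfold indic.
    destruct (Rlt_dec al x); [|reflexivity]; destruct (Rlt_dec x be); [lra | reflexivity]. }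
assert (E : ex_RInt (indic al be) A B) by (eexists; exact HI).
assert (E1 : ex_RInt (indic al be) A b) by (apply (ex_RInt_Chasles_1 (V := R_CompleteNormedModule)) with B; [lra | exact E]).
assert (E2 : ex_RInt (indic al be) b B) by (apply (ex_RInt_Chasles_2 (V := R_CompleteNormedModule)) with A; [lra | exact E]).
assert (E3 : ex_RInt (indic al be) A a) by (apply (ex_RInt_Chasles_1 (V := R_CompleteNormedModule)) with b; [lra | exact E1]).
assert (E4 : ex_RInt (indic al be) a b) by (apply (ex_RInt_Chasles_2 (V := R_CompleteNormedModule)) with A; [lra | exact E1]).
assert (Hpos : forall x, 0 <= indic al be x).
{ intros x; unfold indic; destruct (Rlt_dec al x); [destruct (Rlt_dec x be)|]; lra. }
split; [exact E4|].
pose proof (RInt_Chasles (V := R_CompleteNormedModule) _ _ _ _ E1 E2) as C1.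
pose proof (RInt_Chasles (V := R_CompleteNormedModule) _ _ _ _ E3 E4) as C2.
unfold plus in C1, C2; simpl in C1, C2.
rewrite (is_RInt_unique _ _ _ _ HI) in C1.
pose proof (RInt_ge_0 (indic al be) b B HB1 E2 (fun x _ => Hpos x)).
pose proof (RInt_ge_0 (indic al be) A a HA1 E3 (fun x _ => Hpos x)).
lra.
Qed.

Section BoundedConvergence.

Variables (g : nat -> R -> R) (a b : R).
Hypothesis Hab : a < b.
Hypothesis Hg : forall n x, continuous (g n) x.
Hypothesis Hg01 : forall n x, 0 <= g n x <= 1.

(** Continuous approximations from below to the supremum of the g m with m >= n, which itself need
    not be Riemann integrable. *)
Fixpoint seqmax (n k : nat) (x : R) : R :=
  match k with O => g n x | S k' => Rmax (seqmax n k' x) (g (n + S k') x) end.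

Lemma seqmax_continuous n k x : continuous (seqmax n k) x.
Proof.
induction k as [|k IH]; [apply Hg | apply continuous_Rmax_fun; [exact IH | apply Hg]].
Qed.

Lemma seqmax_ge n k m x : (n <= m <= n + k)%nat -> g m x <= seqmax n k x.
Proof.
induction k as [|k IH]; intros Hm; simpl.
- replace m with n by lia; lra.
- destruct (Nat.eq_dec m (n + S k)) as [->|Hne]; [apply Rmax_r|].
  eapply Rle_trans; [apply IH; lia | apply Rmax_l].
Qed.

Lemma seqmax_attained n k x : exists m, (n <= m <= n + k)%nat /\ seqmax n k x = g m x.
Proof.
induction k as [|k [m [Hm E]]]; simpl.
- exists n; split; [lia | reflexivity].
- unfold Rmax; destruct (Rle_dec (seqmax n k x) (g (n + S k) x)).
  + exists (n + S k)%nat; split; [lia | reflexivity].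
  + exists m; split; [lia | exact E].
Qed.

Lemma seqmax_01 n k x : 0 <= seqmax n k x <= 1.
Proof. destruct (seqmax_attained n k x) as [m [_ ->]]; apply Hg01. Qed.

Lemma seqmax_le n k n' k' x : (n' <= n)%nat -> (n + k <= n' + k')%nat ->
  seqmax n k x <= seqmax n' k' x.
Proof.
intros H1 H2; destruct (seqmax_attained n k x) as [m [Hm ->]]; apply seqmax_ge; lia.
Qed.

Lemma integral_le_length (f : R -> R) : (forall x, continuous f x) -> (forall x, f x <= 1) ->
  RInt f a b <= b - a.
Proof.
intros Hc Hf; replace (b - a) with (RInt (fun _ => 1) a b).
- apply RInt_le; [lra | apply ex_RInt_cont, Hc | apply ex_RInt_const | intros; apply Hf].
- rewrite RInt_const; unfold scal; simpl; unfold mult; simpl; ring.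
Qed.

(** Otherwise f is at most d plus the sum of the indicators of the intervals, and integrating gives
    at most d (b-a) + e. *)
Lemma uncovered_level_point (f : R -> R) (al be : nat -> R) (N : nat) (d e : R) :
  (forall x, continuous f x) -> (forall x, f x <= 1) -> (forall n, al n <= be n) ->
  sum_f_R0 (fun n => be n - al n) N <= e -> d * (b - a) + e < RInt f a b -> 0 <= d ->
  exists x, a <= x <= b /\ d <= f x /\ forall i, (i <= N)%nat -> ~ (al i < x < be i).
Proof.
intros Hc Hf Hle Hsum HI Hd; apply NNPP; intros Hno.
set (s := fun x => sum_f_R0 (fun i => indic (al i) (be i) x) N).
assert (Hi0 : forall i x, 0 <= indic (al i) (be i) x).
{ intros i x; unfold indic; destruct (Rlt_dec (al i) x); [destruct (Rlt_dec x (be i))|]; lra. }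
assert (HS : forall M, ex_RInt (fun x => sum_f_R0 (fun i => indic (al i) (be i) x) M) a b /\
  RInt (fun x => sum_f_R0 (fun i => indic (al i) (be i) x) M) a b
    <= sum_f_R0 (fun n => be n - al n) M).
{ induction M as [|M [IH1 IH2]]; simpl; [apply RInt_indic; [lra | apply Hle]|].
  destruct (RInt_indic a b (al (S M)) (be (S M))) as [K1 K2]; [lra | apply Hle|].
  split; [apply (ex_RInt_plus (V := R_NormedModule)); assumption|].
  rewrite (RInt_plus (V := R_CompleteNormedModule)) by assumption; unfold plus; simpl; lra. }
assert (Hs0 : forall x M, 0 <= sum_f_R0 (fun i => indic (al i) (be i) x) M).
{ intros x M; apply cond_pos_sum; intros; apply Hi0. }
assert (Hs1 : forall x M i, (i <= M)%nat -> al i < x < be i ->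
  1 <= sum_f_R0 (fun i => indic (al i) (be i) x) M).
{ intros x M i Hi Hx; induction M as [|M IH]; simpl.
  - replace i with 0%nat in Hx by lia; unfold indic.
    destruct (Rlt_dec (al 0%nat) x); [destruct (Rlt_dec x (be 0%nat))|]; lra.
  - destruct (Nat.eq_dec i (S M)) as [->|Hne].
    + specialize (Hs0 x M); unfold indic at 2.
      destruct (Rlt_dec (al (S M)) x); [destruct (Rlt_dec x (be (S M)))|]; lra.
    + specialize (Hi0 (S M) x); specialize (IH ltac:(lia)); lra. }
destruct (HS N) as [K1 K2].
assert (K : RInt f a b <= RInt (fun x => plus d (s x)) a b).
{ apply RInt_le; [lra | apply ex_RInt_cont, Hc | |].
  - apply (ex_RInt_plus (V := R_NormedModule)); [apply ex_RInt_const | exact K1].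
  - intros x Hx; unfold plus; simpl.
    destruct (Rle_dec d (f x)) as [D|D]; [|specialize (Hs0 x N); unfold s; lra].
    destruct (classic (exists i, (i <= N)%nat /\ al i < x < be i)) as [[i [Hi Hxi]]|Hn].
    + specialize (Hs1 x N i Hi Hxi); specialize (Hf x); unfold s; lra.
    + exfalso; apply Hno; exists x; split; [lra|]; split; [exact D|].
      intros i Hi Hxi; apply Hn; exists i; split; assumption. }
rewrite (RInt_plus (V := R_CompleteNormedModule)) in K by (apply ex_RInt_const || exact K1).
rewrite RInt_const in K; unfold plus, scal in K; simpl in K; unfold mult in K; simpl in K.
unfold s in K; lra.
Qed.

(** Monotone convergence by compactness. With [delta]/4 spent on the cover of E and [delta]/4 on the
    level d, each H n has a point where H n >= d outside the first n covering intervals. A cluster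
    point of these avoids every interval, since the intervals are open, and keeps every H n positive
    by monotonicity and continuity. *)
Lemma decreasing_positive_point (H : nat -> R -> R) (E : R -> Prop) (delta : R) :
  (forall n x, continuous (H n) x) -> (forall n x, H n x <= 1) ->
  (forall n x, H (S n) x <= H n x) -> null_set E -> 0 < delta ->
  (forall n, delta <= RInt (H n) a b) ->
  exists x, a <= x <= b /\ ~ E x /\ forall n, 0 < H n x.
Proof.
intros Hc H1 Hdec HE Hd HI.
destruct (HE (delta / 4)) as (al & be & Hle & Hcov & Hsum); [lra|].
set (d := delta / (4 * (b - a))).
assert (Hd0 : 0 < d) by (apply Rdiv_lt_0_compat; lra).
assert (Hdb : d * (b - a) = delta / 4) by (unfold d; field; lra).
assert (Hpt : forall n, exists x, a <= x <= b /\ d <= H n x /\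
  forall i, (i <= n)%nat -> ~ (al i < x < be i)).
{ intros n; apply (uncovered_level_point _ _ _ _ _ (delta / 4)); auto; [|lra].
  specialize (HI n); lra. }
set (u := fun n => proj1_sig (constructive_indefinite_description _ (Hpt n))).
assert (Hu : forall n, a <= u n <= b /\ d <= H n (u n) /\
  forall i, (i <= n)%nat -> ~ (al i < u n < be i)).
{ intros n; unfold u; destruct (constructive_indefinite_description _ (Hpt n)); assumption. }
assert (Hmon : forall n m x, (n <= m)%nat -> H m x <= H n x).
{ intros n m x Hnm; induction Hnm; [lra | eapply Rle_trans; [apply Hdec | assumption]]. }
destruct (Bolzano_Weierstrass u (fun x => a <= x <= b) (compact_P3 a b)) as [l Hl].
{ intros n; apply Hu. }
assert (Hnear : forall e N, 0 < e -> exists p, (N <= p)%nat /\ Rabs (u p - l) < e).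
{ intros e N He; destruct (Hl (fun y => Rabs (y - l) < e) N) as [p Hp].
  - exists (mkposreal e He); intros y Hy; exact Hy.
  - exists p; exact Hp. }
exists l; split; [|split].
- split; apply Rnot_lt_le; intros K.
  + destruct (Hnear (a - l) 0%nat) as [p [_ Hp]]; [lra|]; apply Rabs_def2 in Hp.
    destruct (Hu p) as [B _]; lra.
  + destruct (Hnear (l - b) 0%nat) as [p [_ Hp]]; [lra|]; apply Rabs_def2 in Hp.
    destruct (Hu p) as [B _]; lra.
- intros HEl; destruct (Hcov l HEl) as [i Hi].
  destruct (Hnear (Rmin (l - al i) (be i - l)) i) as [p [Hip Hp]]; [apply Rmin_pos; lra|].
  destruct (Hu p) as (_ & _ & K); apply (K i Hip); apply Rabs_def2 in Hp.
  pose proof (Rmin_l (l - al i) (be i - l)); pose proof (Rmin_r (l - al i) (be i - l)); lra.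
- intros n; apply Rnot_le_lt; intros K.
  destruct (proj1 (filterlim_locally (H n) (H n l)) (Hc n l) (mkposreal d Hd0)) as [e He].
  destruct (Hnear e n (cond_pos e)) as [p [Hnp Hp]].
  specialize (He (u p) Hp); change (Rabs (H n (u p) - H n l) < d) in He.
  apply Rabs_def2 in He; destruct (Hu p) as (_ & K2 & _); specialize (Hmon n p (u p) Hnp); lra.
Qed.

(* The functions h_n = max (g_n .. g_(n+k_n)) nearly realise the supremum of the integrals of
   such maxima, so taking their running minimum loses at most half of delta. *)
Lemma positive_infinitely_often (E : R -> Prop) (delta : R) :
  null_set E -> 0 < delta -> (forall n, delta <= RInt (g n) a b) ->
  exists x, a <= x <= b /\ ~ E x /\ forall n, exists m, (n <= m)%nat /\ 0 < g m x.
Proof.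
intros HE Hd HI.
assert (HJ : forall n, { J : R | is_lub (fun y => exists k, y = RInt (seqmax n k) a b) J }).
{ intros n; apply completeness.
  - exists (b - a); intros y [k ->]; apply integral_le_length; [apply seqmax_continuous|].
    intros x; apply seqmax_01.
  - exists (RInt (seqmax n 0) a b), 0%nat; reflexivity. }
set (J := fun n => proj1_sig (HJ n)).
assert (HJ1 : forall n k, RInt (seqmax n k) a b <= J n).
{ intros n k; unfold J; destruct (HJ n) as [j [H1 H2]]; simpl; apply H1; exists k; reflexivity. }
set (e := fun n : nat => delta / 2 * (1 / 2) ^ S n).
assert (He : forall n, 0 < e n).
{ intros n; apply Rmult_lt_0_compat; [lra | apply pow_lt; lra]. }
assert (Hk : forall n, exists k, J n - e n <= RInt (seqmax n k) a b).
{ intros n; apply NNPP; intros Hno; unfold J in Hno; destruct (HJ n) as [j [H1 H2]]; simpl in Hno.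
  assert (j <= j - e n); [|specialize (He n); lra].
  apply H2; intros y [k ->]; apply Rnot_lt_le; intros K; apply Hno; exists k; lra. }
set (k := fun n => proj1_sig (constructive_indefinite_description _ (Hk n))).
assert (Hk' : forall n, J n - e n <= RInt (seqmax n (k n)) a b).
{ intros n; unfold k; destruct (constructive_indefinite_description _ (Hk n)); assumption. }
set (h := fun n => seqmax n (k n)).
set (H := fix H (n : nat) : R -> R := match n with
  | O => h O | S m => fun x => Rmin (H m x) (h (S m) x) end).
assert (Hc : forall n x, continuous (H n) x).
{ induction n as [|n IH]; intros x; simpl; [apply seqmax_continuous|].
  apply continuous_Rmin_fun; [apply IH | apply seqmax_continuous]. }
assert (Hh : forall n x, H n x <= h n x).
{ intros [|n] x; simpl; [lra | apply Rmin_r]. }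
assert (HHI : forall n, J n - (delta / 2 - delta / 2 * (1 / 2) ^ S n) <= RInt (H n) a b).
{ induction n as [|n IH].
  - simpl; specialize (Hk' 0%nat); unfold e in Hk'; simpl in Hk'; fold (h 0%nat) in Hk'; lra.
  (* The maximum lies below some [seqmax n k], so min + max = sum gives a minimum whose integral has
     lost only e (S n) more than before. *)
  - assert (Hmax : RInt (fun x => Rmax (H n x) (h (S n) x)) a b <= J n).
    { eapply Rle_trans; [|apply (HJ1 n (k n + S (k (S n))))%nat].
      apply RInt_le; [lra | | |].
      - apply ex_RInt_cont; intros x; apply continuous_Rmax_fun; [apply Hc | apply seqmax_continuous].
      - apply ex_RInt_cont; intros x; apply seqmax_continuous.
      - intros x _; apply Rmax_lub.
        + eapply Rle_trans; [apply Hh|]; apply seqmax_le; lia.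
        + apply seqmax_le; lia. }
    assert (Esum : RInt (H (S n)) a b + RInt (fun x => Rmax (H n x) (h (S n) x)) a b
      = RInt (H n) a b + RInt (h (S n)) a b).
    { rewrite <- (RInt_plus (V := R_CompleteNormedModule) (H (S n))), <- (RInt_plus (V := R_CompleteNormedModule) (H n)).
      - apply RInt_ext; intros x _; unfold plus; simpl.
        unfold Rmin, Rmax; destruct (Rle_dec (H n x) (h (S n) x)); ring.
      - apply ex_RInt_cont, Hc.
      - apply ex_RInt_cont; intros x; apply seqmax_continuous.
      - apply ex_RInt_cont, Hc.
      - apply ex_RInt_cont; intros x; apply continuous_Rmax_fun; [apply Hc | apply seqmax_continuous]. }
    specialize (Hk' (S n)); fold (h (S n)) in Hk'; unfold e in Hk'.
    assert (Ep : (1 / 2) ^ S n = 2 * (1 / 2) ^ S (S n)) by (simpl; field).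
    rewrite Ep in IH; lra. }
destruct (decreasing_positive_point H E (delta / 2)) as (x & Hx & HEx & Hpos); auto; [| |lra| |].
- intros n x; eapply Rle_trans; [apply Hh | apply seqmax_01].
- intros n x; simpl; apply Rmin_l.
- intros n; specialize (HHI n); specialize (HJ1 n 0%nat); change (RInt (g n) a b <= J n) in HJ1; specialize (HI n).
  assert (0 < delta / 2 * (1 / 2) ^ S n) by (apply Rmult_lt_0_compat; [lra | apply pow_lt; lra]).
  lra.
- exists x; split; [exact Hx|]; split; [exact HEx|]; intros n.
  destruct (seqmax_attained n (k n) x) as [m [Hm Em]]; exists m; split; [lia|].
  rewrite <- Em; eapply Rlt_le_trans; [apply (Hpos n) | apply Hh].
Qed.

End BoundedConvergence.

(** * Poisson barriers *)

Lemma Rabs_sin_le (x : R) : Rabs (sin x) <= Rabs x.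
Proof.
assert (H : forall y, 0 < y -> Rabs (sin y) <= y).
{ intros y Hy; apply Rabs_le; split; [|apply Rlt_le, sin_lt_x, Hy].
  pose proof (SIN_bound y); destruct (Rle_dec y PI) as [K|K].
  - pose proof (sin_ge_0 y ltac:(lra) K); lra.
  - pose proof PI2_1; lra. }
destruct (Rtotal_order x 0) as [K|[->|K]].
- rewrite <- (Rabs_Ropp x), <- (Rabs_Ropp (sin x)), <- sin_neg, (Rabs_right (- x)) by lra.
  apply H; lra.
- rewrite sin_0; lra.
- rewrite (Rabs_right x) by lra; apply H, K.
Qed.

Lemma eit_lipschitz (s t : R) : Cmod (eit s - eit t) <= Rabs (s - t).
Proof.
assert (H : Cmod (eit s - eit t) ^ 2 <= Rabs (s - t) ^ 2).
{ rewrite Cmod2_alt; unfold eit; simpl Re; simpl Im.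
  set (u := (s - t) / 2); set (v := (s + t) / 2).
  replace s with (v + u) by (unfold u, v; field).
  replace (cos t) with (cos (v - u)) by (f_equal; unfold u, v; field).
  replace (sin t) with (sin (v - u)) by (f_equal; unfold u, v; field).
  replace (Rabs (v + u - t)) with (2 * Rabs u).
  2:{ replace (v + u - t) with (2 * u) by (unfold u, v; field).
      rewrite Rabs_mult, (Rabs_right 2); lra. }
  rewrite cos_plus, sin_plus, cos_minus, sin_minus.
  replace ((cos v * cos u - sin v * sin u + - (cos v * cos u + sin v * sin u)) ^ 2 +
    (sin v * cos u + cos v * sin u + - (sin v * cos u - cos v * sin u)) ^ 2)
    with (4 * (Rsqr (sin v) + Rsqr (cos v)) * sin u ^ 2) by (unfold Rsqr; ring).
  rewrite sin2_cos2, <- (pow2_abs (sin u)).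
  pose proof (Rabs_sin_le u); pose proof (Rabs_pos (sin u)).
  assert (Rabs (sin u) ^ 2 <= Rabs u ^ 2) by (apply pow_incr; lra); nra. }
apply Rnot_lt_le; intros K.
pose proof (Rabs_pos (s - t)); nra.
Qed.

Lemma polar_form (w : C) : exists t, 0 <= t <= 2 * PI /\ w = (RtoC (Cmod w) * eit t)%C.
Proof.
pose proof PI_RGT_0 as HPI.
destruct (classic (w = 0%C)) as [->|Hw].
{ exists 0; split; [lra|]; rewrite Cmod_0; ring. }
apply Cmod_gt_0 in Hw; set (m := Cmod w) in *; destruct w as [x y].
assert (E : x ^ 2 + y ^ 2 = m ^ 2) by (unfold m; rewrite Cmod2_alt; reflexivity).
pose proof (re_le_Cmod (x, y)) as Hx; simpl in Hx; fold m in Hx.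
apply Rabs_le_between in Hx.
set (c := x / m).
assert (Ec : x = m * c) by (unfold c; field; lra).
assert (Hc : -1 <= c <= 1) by (split; apply Rmult_le_reg_l with m; lra).
pose proof (acos_bound c) as Hb.
assert (Es : Rsqr (m * sqrt (1 - Rsqr c)) = Rsqr y).
{ rewrite Rsqr_mult, Rsqr_sqrt by (unfold Rsqr; nra).
  unfold Rsqr; replace (m * m * (1 - c * c)) with (m ^ 2 - (m * c) ^ 2) by ring.
  rewrite <- Ec; lra. }
assert (Hsq : 0 <= m * sqrt (1 - Rsqr c)) by (apply Rmult_le_pos; [lra | apply sqrt_pos]).
destruct (Rle_dec 0 y) as [Hy|Hy].
- exists (acos c); split; [lra|].
  unfold eit, RtoC, Cmult; simpl; rewrite cos_acos, sin_acos by exact Hc.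
  apply Rsqr_inj in Es; [|exact Hsq | exact Hy].
  rewrite <- Es, Ec; f_equal; ring.
- exists (2 * PI - acos c); split; [lra|].
  assert (Es' : m * sqrt (1 - Rsqr c) = - y).
  { apply Rsqr_inj; [exact Hsq | lra | rewrite <- Rsqr_neg; exact Es]. }
  unfold eit, RtoC, Cmult; simpl.
  rewrite cos_minus, sin_minus, cos_2PI, sin_2PI, cos_acos, sin_acos by exact Hc.
  f_equal; [rewrite Ec; ring|]; lra.
Qed.

(** * Continuous shadows of points of the disk on the circle *)

Definition clip (x : R) : R := Rmax 0 (Rmin 1 x).

Lemma clip_01 (x : R) : 0 <= clip x <= 1.
Proof.
unfold clip, Rmax, Rmin; destruct (Rle_dec 1 x); destruct (Rle_dec 0 _); lra.
Qed.

Lemma clip_lipschitz (x y : R) : Rabs (clip x - clip y) <= Rabs (x - y).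
Proof.
unfold clip, Rmax, Rmin; destruct (Rle_dec 1 x), (Rle_dec 1 y);
  repeat destruct (Rle_dec 0 _); unfold Rabs; repeat destruct (Rcase_abs _); lra.
Qed.

(** A Lipschitz substitute for the indicator of the angles whose cone contains w: it is 1 up to
    distance 2 (1-|w|) and vanishes from distance 3 (1-|w|) on. *)
Definition tent (w : C) (t : R) : R := clip (3 - Cmod (eit t - w) / (1 - Cmod w)).

Lemma tent_lipschitz (w : C) (r s t : R) : Cmod w <= r -> r < 1 ->
  Rabs (tent w s - tent w t) <= Rabs (s - t) / (1 - r).
Proof.
intros Hw Hr; eapply Rle_trans; [apply clip_lipschitz|].
replace (3 - Cmod (eit s - w) / (1 - Cmod w) - (3 - Cmod (eit t - w) / (1 - Cmod w)))
  with ((Cmod (eit t - w) - Cmod (eit s - w)) * / (1 - Cmod w)) by (unfold Rdiv; ring).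
rewrite Rabs_mult; apply Rmult_le_compat; try apply Rabs_pos.
- pose proof (Cmod_triangle_rev (eit t - w) (eit s - w)) as H1.
  pose proof (Cmod_triangle_rev (eit s - w) (eit t - w)) as H2.
  replace (eit t - w - (eit s - w))%C with (eit t - eit s)%C in H1 by ring.
  replace (eit s - w - (eit t - w))%C with (eit s - eit t)%C in H2 by ring.
  pose proof (eit_lipschitz s t) as H3; rewrite (Cmod_minus_sym (eit t) (eit s)) in H1.
  apply Rabs_le; lra.
- rewrite Rabs_right by (apply Rle_ge, Rlt_le, Rinv_0_lt_compat; lra).
  apply Rinv_le_contravar; lra.
Qed.

Lemma tent_sup (Z : C -> Prop) (r : R) : r < 1 -> (forall w, Z w -> Cmod w <= r) ->
  exists b : R -> R, (forall t, 0 <= b t <= 1) /\ (forall t w, Z w -> tent w t <= b t) /\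
    (forall t, 0 < b t -> exists w, Z w /\ 0 < tent w t) /\
    (forall s t, Rabs (b s - b t) <= Rabs (s - t) / (1 - r)).
Proof.
intros Hr HZ.
(* The value 0 is adjoined so that the supremum also exists for empty Z. *)
assert (HS : forall t, { y | is_lub (fun y => y = 0 \/ exists w, Z w /\ y = tent w t) y }).
{ intros t; apply completeness.
  - exists 1; intros y [->|[w [_ ->]]]; [lra | apply clip_01].
  - exists 0; left; reflexivity. }
set (b := fun t => proj1_sig (HS t)).
assert (Hb : forall t, is_lub (fun y => y = 0 \/ exists w, Z w /\ y = tent w t) (b t)).
{ intros t; unfold b; destruct (HS t); assumption. }
assert (Hup : forall t w, Z w -> tent w t <= b t).
{ intros t w Hw; apply (Hb t); right; exists w; split; [exact Hw | reflexivity]. }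
assert (H0 : forall t, 0 <= b t) by (intros t; apply (Hb t); left; reflexivity).
exists b; split; [|split; [exact Hup|split]].
- intros t; split; [apply H0|]; apply (Hb t); intros y [->|[w [_ ->]]]; [lra | apply clip_01].
- intros t Ht; apply NNPP; intros Hno; assert (b t <= 0); [|lra].
  apply (Hb t); intros y [->|[w [Hw ->]]]; [lra|].
  apply Rnot_lt_le; intros K; apply Hno; exists w; split; assumption.
- assert (H1 : forall s t, b s <= b t + Rabs (s - t) / (1 - r)).
  { intros s t; apply (Hb s); intros y [->|[w [Hw ->]]].
    - specialize (H0 t); assert (0 <= Rabs (s - t) / (1 - r)); [|lra].
      apply Rmult_le_pos; [apply Rabs_pos | apply Rlt_le, Rinv_0_lt_compat; lra].
    - pose proof (tent_lipschitz w r s t (HZ w Hw) Hr) as K; apply Rabs_le_between in K.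
      specialize (Hup t w Hw); lra. }
  intros s t; pose proof (H1 s t); pose proof (H1 t s) as K.
  rewrite Rabs_minus_sym in K; apply Rabs_le; lra.
Qed.

Fixpoint csum (f : nat -> C) (n : nat) : C :=
  match n with O => f O | S k => (csum f k + f (S k))%C end.

Lemma Re_csum (f : nat -> C) (n : nat) : Re (csum f n) = sum_f_R0 (fun k => Re (f k)) n.
Proof. induction n as [|n IH]; [reflexivity|]; simpl sum_f_R0; rewrite <- IH; apply Re_plus. Qed.

Lemma cdiff_csum (f : nat -> C -> C) (n : nat) (z : C) :
  (forall k, cdiff (f k) z) -> cdiff (fun w => csum (fun k => f k w) n) z.
Proof.
intros H; induction n as [|n IH]; simpl; [apply H | apply cdiff_plus; [exact IH | apply H]].
Qed.

Lemma sum_block_le (x : nat -> R) (v : R) (n l m : nat) :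
  (forall j, 0 <= x j) -> (forall j, (n < j <= n + l)%nat -> v <= x j) -> (n + l <= m)%nat ->
  INR l * v <= sum_f_R0 x m.
Proof.
intros H0 Hv Hm.
assert (H1 : INR l * v <= sum_f_R0 x (n + l)).
{ clear Hm; induction l as [|l IH].
  - rewrite Nat.add_0_r; simpl; rewrite Rmult_0_l; apply cond_pos_sum, H0.
  - rewrite Nat.add_succ_r, S_INR; simpl.
    assert (INR l * v <= sum_f_R0 x (n + l)) by (apply IH; intros j Hj; apply Hv; lia).
    specialize (Hv (S (n + l)) ltac:(lia)); lra. }
eapply Rle_trans; [exact H1|].
induction Hm as [|m Hm IH]; [lra|]; simpl; specialize (H0 (S m)); lra.
Qed.

Lemma riemann_sum_le (b : R -> R) (L h : R) (n : nat) : 0 < h -> 0 <= L ->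
  (forall t, continuous b t) -> (forall s t, Rabs (b s - b t) <= L * Rabs (s - t)) ->
  sum_f_R0 (fun j => h * (b (INR j * h) - L * h)) n <= RInt b 0 (INR (S n) * h).
Proof.
intros Hh HL Hc Hb.
assert (Hstep : forall j, h * (b (INR j * h) - L * h) <= RInt b (INR j * h) (INR (S j) * h)).
{ intros j; replace (h * (b (INR j * h) - L * h))
    with (RInt (fun _ => b (INR j * h) - L * h) (INR j * h) (INR (S j) * h)).
  - apply RInt_le; [rewrite S_INR; lra | apply ex_RInt_const | apply ex_RInt_cont, Hc |].
    intros t Ht; rewrite S_INR in Ht; specialize (Hb t (INR j * h)).
    rewrite (Rabs_right (t - INR j * h)) in Hb by lra; apply Rabs_le_between in Hb.
    assert (L * (t - INR j * h) <= L * h) by (apply Rmult_le_compat_l; lra); lra.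
  - rewrite RInt_const, S_INR; unfold scal; simpl; unfold mult; simpl; ring. }
induction n as [|n IH].
- pose proof (Hstep 0%nat) as K; simpl in K |- *; rewrite Rmult_0_l in K |- *; exact K.
- rewrite tech5; eapply Rle_trans; [apply Rplus_le_compat; [exact IH | apply Hstep]|].
  right; apply (RInt_Chasles (V := R_CompleteNormedModule)); apply ex_RInt_cont, Hc.
Qed.

Lemma poisson_kernel (zeta z : C) : Cmod zeta = 1 -> zeta <> z ->
  Re ((zeta + z) / (zeta - z)) = (1 - Cmod z ^ 2) / Cmod (zeta - z) ^ 2.
Proof.
intros H1 Hne.
assert (Hd : 0 < Cmod (zeta - z)).
{ apply Cmod_gt_0; intros K; apply Hne; replace zeta with (zeta - z + z)%C by ring; rewrite K; ring. }
assert (E1 : Cmod zeta ^ 2 = 1) by (rewrite H1; ring).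
assert (E2 : 0 < Cmod (zeta - z) ^ 2) by (apply pow_lt, Hd).
rewrite Cmod2_alt in E1, E2 |- *; rewrite <- E1, Cmod2_alt.
destruct zeta as [a b], z as [x y]; simpl in *; field.
intros K; simpl in *; nra.
Qed.

(** With m nodes of spacing h and t = 1-|w|, at least t/(2h) nodes lie near w, each with weight 1/m
    and Poisson kernel at least 1/(4t). The product is 1/(8 m h), and m h = 2 pi. *)
Definition barrier_height : R := / (16 * PI).

(** Q is the Herglotz sum of b over equally spaced nodes. The lower bound on Z holds because b = 1
    on the shadow of each point; the upper bound at z0 compares the Riemann sum of b with its
    integral, the kernel there being at most 2/(1-|z0|). *)
Lemma barrier_from_weight (Z : C -> Prop) (r delta : R) (b : R -> R) (z0 : C) :
  r < 1 -> (forall w, Z w -> Cmod w <= r) -> Cmod z0 < 1 -> 0 < delta ->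
  (forall t, 0 <= b t <= 1) -> (forall t w, Z w -> tent w t <= b t) ->
  (forall s t, Rabs (b s - b t) <= Rabs (s - t) / (1 - r)) ->
  RInt b 0 (2 * PI) < delta ->
  exists Q : C -> C, (forall z, Cmod z < 1 -> cdiff Q z) /\
    (forall z, Cmod z < 1 -> 0 <= Re (Q z)) /\ (forall w, Z w -> barrier_height <= Re (Q w)) /\
    Re (Q z0) <= 2 * delta / (1 - Cmod z0).
Proof.
intros Hr HZ Hz0 Hd Hb01 HbZ Hblip HbI.
pose proof PI_RGT_0 as HPI; pose proof PI_4 as HPI4.
set (L := / (1 - r)).
assert (HL : 0 < L) by (apply Rinv_0_lt_compat; lra).
assert (Hbl : forall s t, Rabs (b s - b t) <= L * Rabs (s - t)).
{ intros s t; rewrite Rmult_comm; apply Hblip. }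
assert (Hbc : forall t, continuous b t).
{ intros t; apply continuous_eps; intros eps Heps; exists (eps / L).
  split; [apply Rdiv_lt_0_compat; lra|]; intros y Hy.
  eapply Rle_lt_trans; [apply Hbl|].
  apply Rmult_lt_compat_l with (r := L) in Hy; [|exact HL].
  replace (L * (eps / L)) with eps in Hy by (field; lra); exact Hy. }
(* Requirements on the mesh h: 2h <= 1-r makes each shadow contain enough nodes, and h (2 + 16 L) <=
   delta absorbs the Riemann sum error h + 9 L h. *)
set (e := Rmin (Rmin 1 ((1 - r) / 2)) ((delta) / (2 + 16 * L))).
assert (He : 0 < e).
{ repeat apply Rmin_pos; try lra; apply Rdiv_lt_0_compat; lra. }
destruct (nfloor_ex (2 * PI / e)) as [m0 [_ Hm0]].
{ apply Rlt_le, Rdiv_lt_0_compat; lra. }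
set (m := S m0).
set (h := 2 * PI / INR m).
assert (Hm : 0 < INR m) by (apply lt_0_INR; unfold m; lia).
assert (Hh : 0 < h) by (apply Rdiv_lt_0_compat; lra).
assert (Hmh : INR m * h = 2 * PI) by (unfold h; field; lra).
assert (Hhe : h < e).
{ apply Rmult_lt_reg_l with (INR m); [exact Hm|]; rewrite Hmh.
  unfold m; rewrite S_INR; apply Rmult_lt_compat_r with (r := e) in Hm0; [|exact He].
  replace (2 * PI / e * e) with (2 * PI) in Hm0 by (field; lra); exact Hm0. }
assert (Hh1 : h < 1).
{ eapply Rlt_le_trans; [exact Hhe|]; unfold e; eapply Rle_trans; apply Rmin_l. }
assert (Hhr : 2 * h <= 1 - r).
{ assert (h <= (1 - r) / 2); [|lra]. apply Rlt_le; eapply Rlt_le_trans; [exact Hhe|]; unfold e.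
  eapply Rle_trans; [apply Rmin_l | apply Rmin_r]. }
assert (Hhd : h * (2 + 16 * L) <= delta).
{ assert (K : h <= delta / (2 + 16 * L)).
  { apply Rlt_le; eapply Rlt_le_trans; [exact Hhe|]; apply Rmin_r. }
  apply Rmult_le_compat_r with (r := 2 + 16 * L) in K; [|lra].
  replace (delta / (2 + 16 * L) * (2 + 16 * L)) with delta in K by (field; lra); exact K. }
set (zt := fun j : nat => eit (INR j * h)).
assert (Hzt : forall j, Cmod (zt j) = 1) by (intros j; apply Cmod_eit).
assert (Hne : forall j z, Cmod z < 1 -> zt j <> z).
{ intros j z Hz K; specialize (Hzt j); rewrite K in Hzt; lra. }
set (wt := fun j : nat => b (INR j * h) / INR m).
assert (Hwt : forall j, 0 <= wt j).
{ intros j; apply Rmult_le_pos; [apply Hb01 | apply Rlt_le, Rinv_0_lt_compat, Hm]. }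
(* The sum includes j = m, so the node at angle 0 occurs again at 2 pi. Lower bounds only gain from
   this; the upper bound pays an extra h. *)
set (Q := fun z => csum (fun j => RtoC (wt j) * ((zt j + z) / (zt j - z)))%C m).
assert (HQ : forall z, Cmod z < 1 ->
  Re (Q z) = sum_f_R0 (fun j => wt j * ((1 - Cmod z ^ 2) / Cmod (zt j - z) ^ 2)) m).
{ intros z Hz; unfold Q; rewrite Re_csum; apply sum_eq; intros j _.
  rewrite <- (poisson_kernel (zt j) z (Hzt j) (Hne j z Hz)).
  generalize ((zt j + z) / (zt j - z))%C; intros [x y]; unfold RtoC, Cmult; simpl; ring. }
assert (Hdist : forall j z, Cmod z < 1 -> 0 < Cmod (zt j - z)).
{ intros j z Hz; pose proof (Cmod_triangle_rev (zt j) z); rewrite Hzt in H; lra. }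
assert (Hker : forall j z, Cmod z < 1 -> 0 <= (1 - Cmod z ^ 2) / Cmod (zt j - z) ^ 2).
{ intros j z Hz; pose proof (Cmod_ge_0 z); apply Rmult_le_pos; [nra|].
  apply Rlt_le, Rinv_0_lt_compat, pow_lt, Hdist, Hz. }
exists Q; split; [|split; [|split]].
- intros z Hz; apply cdiff_csum; intros j; apply cdiff_scal; unfold Cdiv; apply cdiff_mult.
  + apply cdiff_plus; [apply cdiff_const | apply cdiff_id].
  + apply (cdiff_comp (fun w => / w)%C (fun w => zt j - w)%C).
    * apply cdiff_inv, Cmod_gt_0, Hdist, Hz.
    * apply cdiff_minus; [apply cdiff_const | apply cdiff_id].
- intros z Hz; rewrite HQ by exact Hz; apply cond_pos_sum; intros j.
  apply Rmult_le_pos; [apply Hwt | apply Hker, Hz].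
- intros w Hw; pose proof (HZ w Hw) as Hwr; pose proof (Cmod_ge_0 w) as Hw0.
  set (t := 1 - Cmod w).
  assert (Ht : 1 - r <= t <= 1) by (unfold t; lra).
  destruct (polar_form w) as [th [Hth Eth]].
  (* A one-sided arc of length t next to [th], taken on the side that stays inside [0, 2 pi], so
     that no node has to be wrapped around. *)
  assert (Hu : exists u, 0 <= u /\ u + t <= 2 * PI /\
    forall s, u <= s <= u + t -> Rabs (s - th) <= t).
  { destruct (Rle_dec th PI) as [K|K].
    - exists th; pose proof PI2_1; split; [lra|split; [lra|]]; intros s Hs; apply Rabs_le; lra.
    - exists (th - t); pose proof PI2_1; split; [lra|split; [lra|]]; intros s Hs; apply Rabs_le; lra. }
  destruct Hu as (u & Hu0 & Hu1 & Hu2).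
  destruct (nfloor_ex (u / h)) as [n [Hn1 Hn2]].
  { apply Rmult_le_pos; [lra | apply Rlt_le, Rinv_0_lt_compat, Hh]. }
  destruct (nfloor_ex (t / h)) as [l [Hl1 Hl2]].
  { apply Rmult_le_pos; [lra | apply Rlt_le, Rinv_0_lt_compat, Hh]. }
  assert (Hn1' : INR n * h <= u).
  { apply Rmult_le_compat_r with (r := h) in Hn1; [|lra].
    replace (u / h * h) with u in Hn1 by (field; lra); exact Hn1. }
  assert (Hn2' : u < (INR n + 1) * h).
  { apply Rmult_lt_compat_r with (r := h) in Hn2; [|lra].
    replace (u / h * h) with u in Hn2 by (field; lra); exact Hn2. }
  assert (Hl1' : INR l * h <= t).
  { apply Rmult_le_compat_r with (r := h) in Hl1; [|lra].
    replace (t / h * h) with t in Hl1 by (field; lra); exact Hl1. }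
  assert (Hl2' : t < (INR l + 1) * h).
  { apply Rmult_lt_compat_r with (r := h) in Hl2; [|lra].
    replace (t / h * h) with t in Hl2 by (field; lra); exact Hl2. }
  assert (Hlow : INR l * (/ INR m * / (4 * t)) <= Re (Q w)).
  { rewrite HQ by lra; apply (sum_block_le _ _ n l m).
    - intros j; apply Rmult_le_pos; [apply Hwt | apply Hker; lra].
    - intros j Hj.
      assert (Hj1 : INR n + 1 <= INR j) by (rewrite <- S_INR; apply le_INR; lia).
      assert (Hj2 : INR j <= INR n + INR l) by (rewrite <- plus_INR; apply le_INR; lia).
      assert (Hs : Rabs (INR j * h - th) <= t).
      { apply Hu2; split; nra. }
      assert (Hzw : Cmod (zt j - w) <= 2 * t).
      { replace (zt j - w)%C with ((zt j - eit th) + (eit th - w))%C by ring.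
        eapply Rle_trans; [apply Cmod_triangle|].
        assert (Cmod (zt j - eit th) <= t) by (eapply Rle_trans; [apply eit_lipschitz | exact Hs]).
        assert (Cmod (eit th - w) = t); [|lra].
        rewrite Eth at 1; replace (eit th - RtoC (Cmod w) * eit th)%C
          with (RtoC (1 - Cmod w) * eit th)%C by (rewrite RtoC_minus; ring).
        rewrite Cmod_mult, Cmod_eit, Cmod_R, Rabs_right by lra; unfold t; ring. }
      pose proof (Hdist j w ltac:(lra)) as Hd0.
      (* The node is at distance at most t from eit th, which is at distance t from w: the total 2t
         lies on the plateau of the tent. *)
      assert (Hb1 : b (INR j * h) = 1).
      { apply Rle_antisym; [apply Hb01|]; eapply Rle_trans; [|apply (HbZ _ w Hw)].
        unfold tent; fold (zt j) t.
        assert (Cmod (zt j - w) / t <= 2).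
        { apply Rmult_le_reg_r with t; [lra|]; unfold Rdiv; rewrite Rmult_assoc, Rinv_l; lra. }
        unfold clip; rewrite Rmin_left by lra; apply Rmax_r. }
      unfold wt; rewrite Hb1; unfold Rdiv at 1; rewrite Rmult_1_l.
      apply Rmult_le_compat_l; [apply Rlt_le, Rinv_0_lt_compat, Hm|].
      apply Rle_trans with (t / (2 * t) ^ 2).
      { right; field; lra. }
      apply Rmult_le_compat; [lra | apply Rlt_le, Rinv_0_lt_compat, pow_lt; lra | unfold t; nra|].
      apply Rinv_le_contravar; [apply pow_lt, Hd0 | apply pow_incr; lra].
    - apply INR_le; rewrite plus_INR; apply Rmult_le_reg_r with h; [exact Hh|].
      rewrite Hmh; lra. }
  eapply Rle_trans; [|exact Hlow].
  assert (Hlt : t / (2 * h) <= INR l).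
  { apply Rmult_le_reg_r with (2 * h); [lra|].
    unfold Rdiv; rewrite Rmult_assoc, Rinv_l by lra; lra. }
  apply Rle_trans with (t / (2 * h) * (/ INR m * / (4 * t))).
  + right; unfold barrier_height, h; field; lra.
  + apply Rmult_le_compat_r; [|exact Hlt].
    apply Rmult_le_pos; apply Rlt_le, Rinv_0_lt_compat; lra.
- rewrite HQ by exact Hz0; pose proof (Cmod_ge_0 z0) as Hz00.
  set (p := 1 - Cmod z0) in *.
  assert (Hk : forall j, (1 - Cmod z0 ^ 2) / Cmod (zt j - z0) ^ 2 <= 2 / p).
  { intros j; apply Rle_trans with (2 * p / p ^ 2); [|right; field; unfold p; lra].
    apply Rmult_le_compat; [unfold p in *; nra | apply Rlt_le, Rinv_0_lt_compat, pow_lt, Hdist, Hz0 |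
      unfold p; nra |].
    apply Rinv_le_contravar; [apply pow_lt; unfold p; lra|].
    apply pow_incr; pose proof (Cmod_triangle_rev (zt j) z0) as K; rewrite Hzt in K; unfold p; lra. }
  apply Rle_trans with (sum_f_R0 (fun j => h * (b (INR j * h) - L * h) + L * h * h) m * (2 / p / (2 * PI))).
  { rewrite Rmult_comm, scal_sum; apply sum_Rle; intros j _.
    replace ((h * (b (INR j * h) - L * h) + L * h * h) * (2 / p / (2 * PI)))
      with (wt j * (2 / p)) by (unfold wt, h; field; unfold p; lra).
    apply Rmult_le_compat_l; [apply Hwt | apply Hk]. }
  assert (Es : sum_f_R0 (fun j => h * (b (INR j * h) - L * h) + L * h * h) m
    <= RInt b 0 (2 * PI) + h + INR (S m) * (L * h * h)).
  { rewrite sum_plus, (sum_cte (L * h * h) m).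
    apply Rplus_le_compat; [|rewrite Rmult_comm; lra].
    eapply Rle_trans; [apply riemann_sum_le; [exact Hh | lra | exact Hbc | exact Hbl]|].
    rewrite S_INR, Rmult_plus_distr_r, Hmh, Rmult_1_l.
    rewrite <- (RInt_Chasles (V := R_CompleteNormedModule) b 0 (2 * PI) (2 * PI + h))
      by apply ex_RInt_cont, Hbc.
    unfold plus; simpl; apply Rplus_le_compat_l.
    replace h with (RInt (fun _ => 1) (2 * PI) (2 * PI + h)) at 2.
    - apply RInt_le; [lra | apply ex_RInt_cont, Hbc | apply ex_RInt_const |]; intros t _; apply Hb01.
    - rewrite RInt_const; unfold scal; simpl; unfold mult; simpl; ring. }
  assert (Es2 : INR (S m) * (L * h * h) <= 9 * (L * h)).
  { rewrite S_INR; replace ((INR m + 1) * (L * h * h)) with ((INR m * h + h) * (L * h)) by ring.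
    apply Rmult_le_compat_r; [apply Rmult_le_pos; lra | rewrite Hmh; lra]. }
  assert (Es3 : sum_f_R0 (fun j => h * (b (INR j * h) - L * h) + L * h * h) m <= 2 * delta).
  { assert (0 <= L * h) by (apply Rmult_le_pos; lra); lra. }
  apply Rle_trans with (2 * delta * (2 / p / (2 * PI))).
  + apply Rmult_le_compat_r; [|exact Es3].
    assert (0 < 2 / p / (2 * PI)); [|lra].
    repeat apply Rdiv_lt_0_compat; unfold p; lra.
  + replace (2 * delta * (2 / p / (2 * PI))) with (2 * delta / p * / PI) by (field; unfold p; lra).
    rewrite <- (Rmult_1_r (2 * delta / p)) at 2; apply Rmult_le_compat_l.
    * apply Rlt_le, Rdiv_lt_0_compat; unfold p; lra.
    * rewrite <- Rinv_1; apply Rinv_le_contravar; [lra | pose proof PI2_1; lra].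
Qed.

(** If the integrals of all the suprema of tents stayed above d1, [positive_infinitely_often] would
    give an angle off E whose cone meets infinitely many Z n. So some integral is small, and its
    weight yields Q; d1 undoes the factor 2/(1-|z0|). *)
Lemma barrier (Z : nat -> C -> Prop) (E : R -> Prop) (z0 : C) (delta : R) :
  null_set E -> Cmod z0 < 1 -> 0 < delta ->
  (forall n, exists r, r < 1 /\ forall w, Z n w -> Cmod w <= r) ->
  (forall t, 0 <= t <= 2 * PI -> ~ E t -> exists n0, forall n, (n0 <= n)%nat ->
    forall w, Z n w -> ~ Cmod (w - eit t) < 3 * (1 - Cmod w)) ->
  exists n (Q : C -> C), (forall z, Cmod z < 1 -> cdiff Q z) /\
    (forall z, Cmod z < 1 -> 0 <= Re (Q z)) /\ (forall w, Z n w -> barrier_height <= Re (Q w)) /\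
    Re (Q z0) <= delta.
Proof.
intros HE Hz0 Hd HZ Hnt.
assert (Hb : forall n, exists b : R -> R, exists r, r < 1 /\ (forall w, Z n w -> Cmod w <= r) /\
    (forall t, 0 <= b t <= 1) /\ (forall t w, Z n w -> tent w t <= b t) /\
    (forall t, 0 < b t -> exists w, Z n w /\ 0 < tent w t) /\
    (forall s t, Rabs (b s - b t) <= Rabs (s - t) / (1 - r))).
{ intros n; destruct (HZ n) as [r [Hr HZr]]; destruct (tent_sup (Z n) r Hr HZr) as [b Hb].
  exists b, r; tauto. }
set (b := fun n => proj1_sig (constructive_indefinite_description _ (Hb n))).
assert (Hb' : forall n, exists r, r < 1 /\ (forall w, Z n w -> Cmod w <= r) /\
    (forall t, 0 <= b n t <= 1) /\ (forall t w, Z n w -> tent w t <= b n t) /\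
    (forall t, 0 < b n t -> exists w, Z n w /\ 0 < tent w t) /\
    (forall s t, Rabs (b n s - b n t) <= Rabs (s - t) / (1 - r))).
{ intros n; unfold b; destruct (constructive_indefinite_description _ (Hb n)); assumption. }
set (d1 := delta * (1 - Cmod z0) / 2).
assert (Hd1 : 0 < d1) by (unfold d1; apply Rmult_lt_0_compat; [apply Rmult_lt_0_compat|]; lra).
assert (Hex : exists n, RInt (b n) 0 (2 * PI) < d1).
{ apply NNPP; intros Hno.
  destruct (positive_infinitely_often b 0 (2 * PI)) with (E := E) (delta := d1)
    as (x & Hx & HEx & Hio); auto.
  - pose proof PI_RGT_0; lra.
  - intros n x; destruct (Hb' n) as (r & Hr & _ & _ & _ & _ & Hl).
    apply continuous_eps; intros eps Heps; exists (eps * (1 - r)).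
    split; [apply Rmult_lt_0_compat; lra|]; intros y Hy.
    eapply Rle_lt_trans; [apply Hl|].
    apply Rmult_lt_reg_r with (1 - r); [lra|].
    unfold Rdiv; rewrite Rmult_assoc, Rinv_l, Rmult_1_r by lra; exact Hy.
  - intros n x; destruct (Hb' n) as (r & _ & _ & H & _); apply H.
  - intros n; apply Rnot_lt_le; intros K; apply Hno; exists n; exact K.
  - destruct (Hnt x Hx HEx) as [n0 Hn0]; destruct (Hio n0) as [m [Hm Hpos]].
    destruct (Hb' m) as (r & Hr & HZr & _ & _ & Hw & _); destruct (Hw x Hpos) as [w [HZw Ht]].
    apply (Hn0 m Hm w HZw); specialize (HZr w HZw).
    apply Rnot_le_lt; intros K; unfold tent, clip in Ht.
    assert (3 <= Cmod (eit x - w) / (1 - Cmod w)).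
    { apply Rmult_le_reg_r with (1 - Cmod w); [lra|].
      unfold Rdiv; rewrite Rmult_assoc, Rinv_l, Rmult_1_r, Cmod_minus_sym by lra; exact K. }
    rewrite Rmax_left in Ht; [lra|]; eapply Rle_trans; [apply Rmin_r | lra]. }
destruct Hex as [n Hn]; destruct (Hb' n) as (r & Hr & HZr & H01 & HbZ & _ & Hl).
destruct (barrier_from_weight (Z n) r d1 (b n) z0) as (Q & HQ1 & HQ2 & HQ3 & HQ4); auto.
exists n, Q; repeat split; auto.
eapply Rle_trans; [exact HQ4|]; unfold d1; right; field; lra.
Qed.

(** * Boundedness *)

Lemma pow_exp (x : R) (n : nat) : exp x ^ n = exp (INR n * x).
Proof.
induction n as [|n IH]; [simpl; rewrite Rmult_0_l, exp_0; reflexivity|].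
rewrite S_INR; simpl; rewrite IH, <- exp_plus; f_equal; ring.
Qed.

(** For y = 1/n <= 1/2, (1-y) exp (2y) >= (1-y)(1+2y) >= 1; the n-th power gives x^n e^2 >= 1. *)
Lemma one_minus_inv_pow (n : nat) (x : R) : (2 <= n)%nat -> 1 - / INR n <= x -> 1 <= 9 * x ^ n.
Proof.
intros Hn Hx.
assert (HN : 2 <= INR n) by (apply (le_INR 2 n), Hn).
set (y := / INR n) in *.
assert (Hy0 : 0 < y) by (apply Rinv_0_lt_compat; lra).
assert (Hy : y <= / 2) by (apply Rinv_le_contravar; lra).
assert (H1 : 1 <= x * exp (2 * y)).
{ apply Rle_trans with ((1 - y) * (1 + 2 * y)); [nra|].
  apply Rmult_le_compat; try lra; apply Rlt_le, exp_ineq1; lra. }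
assert (H2 : 1 <= (x * exp (2 * y)) ^ n) by (apply pow_R1_Rle, H1).
rewrite Rpow_mult_distr in H2.
assert (E : exp (2 * y) ^ n = exp 1 * exp 1).
{ rewrite pow_exp, <- exp_plus; f_equal; unfold y; field; lra. }
rewrite E in H2; pose proof exp_le_3; pose proof (exp_pos 1).
assert (0 <= x ^ n) by (apply pow_le; lra).
assert (exp 1 * exp 1 <= 9) by nra.
assert (x ^ n * (exp 1 * exp 1) <= x ^ n * 9) by (apply Rmult_le_compat_l; assumption); lra.
Qed.

Fixpoint psum (u : nat -> R) (n : nat) : R :=
  match n with O => 0 | S k => psum u k + u k end.

Lemma psum_mono (u : nat -> R) (i n : nat) : (forall n, 0 <= u n) -> (i <= n)%nat ->
  psum u i <= psum u n.
Proof. intros Hu Hi; induction Hi as [|p Hp IH]; [lra|]; simpl; specialize (Hu p); lra. Qed.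

Lemma psum_tail (u : nat -> R) (l eps : R) : (forall n, 0 <= u n) ->
  (forall n, psum u n <= l) -> 0 < eps ->
  exists i0, forall i n, (i0 <= i)%nat -> psum u n - psum u i <= eps.
Proof.
intros Hu Hl Heps.
destruct (completeness (fun y => exists n, y = psum u n)) as [s [Hs1 Hs2]].
- exists l; intros y [n ->]; apply Hl.
- exists (psum u 0), 0%nat; reflexivity.
- assert (Hex : exists i0, s - eps <= psum u i0).
  { apply NNPP; intros Hno; assert (s <= s - eps); [|lra].
    apply Hs2; intros y [n ->]; apply Rnot_lt_le; intros K; apply Hno; exists n; lra. }
  destruct Hex as [i0 Hi0]; exists i0; intros i n Hi.
  assert (psum u n <= s) by (apply Hs1; exists n; reflexivity).
  pose proof (psum_mono u i0 i Hu Hi); lra.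
Qed.

Lemma exp_le (x y : R) : x <= y -> exp x <= exp y.
Proof. intros [H| ->]; [left; apply exp_increasing, H | lra]. Qed.

Lemma Re_scal (x : R) (z : C) : Re (RtoC x * z) = x * Re z.
Proof. destruct z; unfold RtoC, Cmult; simpl; ring. Qed.

Lemma Cmod_mult_Cexp (L : R) (h q : C) :
  Cmod (h * Cexp (RtoC (- L) * q)) = Cmod h * exp (- L * Re q).
Proof. rewrite Cmod_mult, Cmod_Cexp, Re_scal; reflexivity. Qed.

Lemma cdiff_damped (h q : C -> C) (L : R) (z : C) : cdiff h z -> cdiff q z ->
  cdiff (fun w => h w * Cexp (RtoC (- L) * q w))%C z.
Proof.
intros Hh Hq; apply cdiff_mult; [exact Hh|].
apply (cdiff_comp Cexp (fun w => RtoC (- L) * q w)%C); [apply cdiff_Cexp | apply cdiff_scal, Hq].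
Qed.

Lemma Cmod_lt_open (z : C) (s : R) : Cmod z < s ->
  exists d, 0 < d /\ forall w, Cmod (w - z) < d -> Cmod w < s.
Proof.
intros H; exists (s - Cmod z); split; [lra|]; intros w Hw.
pose proof (Cmod_triangle_rev w z); lra.
Qed.

Lemma Cmod_gt_open (z : C) (s : R) : s < Cmod z ->
  exists d, 0 < d /\ forall w, Cmod (w - z) < d -> s < Cmod w.
Proof.
intros H; exists (Cmod z - s); split; [lra|]; intros w Hw.
pose proof (Cmod_triangle_rev z w) as K; rewrite Cmod_minus_sym in K; lra.
Qed.

Lemma cdiff_Cmod_lt_open (f : C -> C) (z : C) (s : R) : cdiff f z -> Cmod (f z) < s ->
  exists d, 0 < d /\ forall w, Cmod (w - z) < d -> Cmod (f w) < s.
Proof.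
intros Hf H; destruct (cdiff_continuous f z Hf (s - Cmod (f z))) as [d [Hd Hw]]; [lra|].
exists d; split; [exact Hd|]; intros w Hwz; specialize (Hw w Hwz).
pose proof (Cmod_triangle_rev (f w) (f z)); lra.
Qed.

Lemma cdiff_Cmod_gt_open (f : C -> C) (z : C) (s : R) : cdiff f z -> s < Cmod (f z) ->
  exists d, 0 < d /\ forall w, Cmod (w - z) < d -> s < Cmod (f w).
Proof.
intros Hf H; destruct (cdiff_continuous f z Hf (Cmod (f z) - s)) as [d [Hd Hw]]; [lra|].
exists d; split; [exact Hd|]; intros w Hwz; specialize (Hw w Hwz).
pose proof (Cmod_triangle_rev (f z) (f w)) as K; rewrite Cmod_minus_sym in K; lra.
Qed.

(* [shifted F a N z] is z^N F(z) - sum_(k < N) a_k z^(N-1-k): the function F minus a partial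
   sum of the anti-analytic series, multiplied by z^N to remove the pole at 0. *)
Fixpoint shifted (F : C -> C) (a : nat -> C) (N : nat) (z : C) : C :=
  match N with O => F z | S n => (z * shifted F a n z - a n)%C end.

(** Each scale is the square of the previous one, so the logarithm only doubles. Base 3 gives ln 3
    >= 1, hence ln (scale i) >= 2^i, where omega is sampled. *)
Definition scale (i : nat) : nat := 3 ^ (2 ^ i).
Definition rad (i : nat) : R := 1 - / INR (scale i).

Lemma scale_ge (i : nat) : (i < scale i)%nat /\ (2 <= scale i)%nat.
Proof.
unfold scale.
assert (H : (i < 2 ^ i)%nat) by (apply Nat.pow_gt_lin_r; lia).
assert (H' : (2 ^ i < 3 ^ 2 ^ i)%nat) by (apply Nat.pow_gt_lin_r; lia).
lia.
Qed.

Lemma scale_S (i : nat) : scale (S i) = (scale i * scale i)%nat.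
Proof. unfold scale; rewrite <- Nat.pow_add_r; f_equal; simpl; lia. Qed.

Lemma INR_scale_ge (i : nat) : 2 <= INR (scale i).
Proof. apply (le_INR 2), scale_ge. Qed.

Lemma rad_bounds (i : nat) : 0 < rad i < 1.
Proof.
unfold rad; pose proof (INR_scale_ge i) as H.
assert (0 < / INR (scale i)) by (apply Rinv_0_lt_compat; lra).
assert (/ INR (scale i) <= / 2) by (apply Rinv_le_contravar; lra); lra.
Qed.

Lemma rad_mono (i j : nat) : (i <= j)%nat -> rad i <= rad j.
Proof.
intros H; induction H as [|j H IH]; [lra|]; eapply Rle_trans; [exact IH|].
unfold rad; pose proof (INR_scale_ge j) as K; rewrite scale_S, mult_INR.
apply Rplus_le_compat_l, Ropp_le_contravar, Rinv_le_contravar; nra.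
Qed.

Section Main.

Variables (F : C -> C) (a : nat -> C) (E : R -> Prop) (S0 : R) (T : nat -> R).
Variables (K K' : R) (m i1 : nat) (phi : nat -> R) (lphi : R).

(** An upper bound M for the upper limit of |h| at eit t inside the cone of aperture 3, the aperture
    at which tents vanish. *)
Definition nt_bounded (h : C -> C) (t M : R) : Prop :=
  forall eta, 0 < eta -> exists d, 0 < d /\ forall z, Cmod z < 1 ->
    Cmod (z - eit t) < 3 * (1 - Cmod z) -> Cmod (z - eit t) < d -> Cmod (h z) < M + eta.

Hypothesis HF : forall z, Cmod z < 1 -> cdiff F z.
Hypothesis HS0 : 0 <= S0.
Hypothesis HK : 1 <= K.
Hypothesis HK' : 0 < K'.
Hypothesis Hgrow : forall z, Cmod z < 1 -> Cmod (F z) <= K * (/ (1 - Cmod z)) ^ m.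
Hypothesis Hshift : forall N z, Cmod z < 1 -> Cmod (shifted F a N z - z ^ N * F z) <= S0.
Hypothesis HE : null_set E.
Hypothesis Hnt : forall t, 0 <= t <= 2 * PI -> ~ E t -> forall N, nt_bounded (shifted F a N) t (T N).
Hypothesis HT0 : T 0%nat <= 2 * S0.
Hypothesis Hphi : forall i, 0 < phi i.
Hypothesis Hsum : forall n, psum (fun i => / phi i) n <= lphi.

(** Half of the decay exponent phi i 2^i of the coefficients beyond [scale i]; the other half is
    spent on making the tail summable. *)
Definition damping (i : nat) : R := phi i * 2 ^ i / 2.

Hypothesis HT : forall i, (i1 <= i)%nat -> T (scale i) <= K' * exp (- damping i).

(* The factor 9 >= e^2 compensates |z|^N >= (1 - 1/N)^N >= e^(-2). *)
Definition bad_level : R := 9 * (S0 + 1).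
(** Dominates all boundary bounds of [barrier_step]: growth on the inner circle, |F| <= bad_level,
    and closeness to f on the outer circle. *)
Definition growth_const : R := K + bad_level + S0 + 2 * K'.
(** The loss of level is at most (ln growth_const + 2 m ln N) / L with ln N = 2^i ln 3 and L = phi i
    2^i / 2. This is at most step_loss / phi i because 2^i >= 1. *)
Definition step_loss : R := 2 * ln growth_const + 4 * INR m * ln 3.

Lemma cdiff_shifted N z : Cmod z < 1 -> cdiff (shifted F a N) z.
Proof.
intros Hz; induction N as [|N IH]; simpl; [apply HF, Hz|].
apply cdiff_minus; [apply cdiff_mult; [apply cdiff_id | exact IH] | apply cdiff_const].
Qed.

Lemma shifted_le N z : Cmod z < 1 -> Cmod (shifted F a N z) <= Cmod (F z) + S0.
Proof.
intros Hz; specialize (Hshift N z Hz).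
pose proof (Cmod_triangle_rev (shifted F a N z) (z ^ N * F z)) as H.
rewrite Cmod_mult, Cmod_pow in H.
assert (H1 : Cmod z ^ N <= 1).
{ rewrite <- (pow1 N); apply pow_incr; pose proof (Cmod_ge_0 z); lra. }
pose proof (Cmod_ge_0 (F z)); nra.
Qed.

Lemma shifted_ge_1 i z : rad i <= Cmod z < 1 -> bad_level <= Cmod (F z) ->
  1 <= Cmod (shifted F a (scale i) z).
Proof.
intros [Hr Hz] HB; specialize (Hshift (scale i) z Hz).
pose proof (Cmod_triangle_rev (z ^ scale i * F z) (shifted F a (scale i) z)) as H.
rewrite Cmod_minus_sym, Cmod_mult, Cmod_pow in H.
pose proof (one_minus_inv_pow (scale i) (Cmod z) (proj2 (scale_ge i)) Hr) as H1.
unfold bad_level in HB; nra.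
Qed.

Lemma damping_pos i : 0 < damping i.
Proof.
unfold damping; apply Rdiv_lt_0_compat; [|lra]; apply Rmult_lt_0_compat; [apply Hphi | apply pow_lt; lra].
Qed.

Lemma growth_const_ge_1 : 1 <= growth_const.
Proof. unfold growth_const, bad_level; lra. Qed.

Lemma step_loss_ge_0 : 0 <= step_loss.
Proof.
unfold step_loss; pose proof growth_const_ge_1; pose proof (pos_INR m).
assert (0 <= ln growth_const) by (rewrite <- ln_1; apply ln_le; lra).
assert (0 <= ln 3) by (rewrite <- ln_1; apply ln_le; lra); nra.
Qed.

(** * Propagation of the barrier through the scales *)

Lemma barrier_step (Q : C -> C) (r c : R) (i : nat) :
  rad (S i) < r < 1 -> c <= 1 ->
  (forall z, Cmod z < 1 -> cdiff Q z) -> (forall z, Cmod z < 1 -> 0 <= Re (Q z)) ->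
  (forall w, rad (S i) <= Cmod w <= r -> bad_level <= Cmod (F w) -> c <= Re (Q w)) ->
  (forall w, Cmod w = r -> Cmod (shifted F a (scale i) w) < 2 * K' * exp (- damping i) \/ c <= Re (Q w)) ->
  (forall w, rad i <= Cmod w <= r -> bad_level <= Cmod (F w) -> c - step_loss * / phi i <= Re (Q w)).
Proof.
intros [Hr1 Hr2] Hc1 HQ HQ0 Hbad Hcirc z0 [Hz1 Hz2] Hz0.
set (X := fun z => Cmod z <= r /\ (Cmod z <= rad (S i) \/ Cmod (F z) <= bad_level)).
set (N := INR (scale i)).
assert (HN : 2 <= N) by apply INR_scale_ge.
assert (HN1 : 1 <= N ^ (2 * m)) by (apply pow_R1_Rle; lra).
set (L := damping i) in *.
assert (HL : 0 < L) by apply damping_pos.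
assert (HB0 : 0 < bad_level) by (unfold bad_level; lra).
(* Outside X the bad point already lies beyond [rad (S i)], where the hypothesis gives the full
   level c. *)
destruct (classic (X z0)) as [HX0|HX0].
2:{ assert (c <= Re (Q z0)).
    { apply Hbad; [|exact Hz0]; split; [|exact Hz2]; apply Rnot_lt_le; intros Hlt; apply HX0.
      split; [exact Hz2 | left; lra]. }
    assert (0 <= step_loss * / phi i); [|lra].
    apply Rmult_le_pos; [apply step_loss_ge_0 | apply Rlt_le, Rinv_0_lt_compat, Hphi]. }
set (B := growth_const * N ^ (2 * m) * exp (- L * c)).
assert (HB : forall x y, 0 <= x <= growth_const * N ^ (2 * m) -> c <= y -> x * exp (- L * y) <= B).
{ intros x y Hx Hy; unfold B; apply Rmult_le_compat; [lra | apply Rlt_le, exp_pos | lra|].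
  apply exp_le; nra. }
assert (HMP : Cmod (shifted F a (scale i) z0 * Cexp (RtoC (- L) * Q z0)) <= B).
{ apply (max_modulus (fun w => shifted F a (scale i) w * Cexp (RtoC (- L) * Q w))%C X r B).
  - unfold B; apply Rmult_le_pos; [|apply Rlt_le, exp_pos]; pose proof growth_const_ge_1; nra.
  - intros z [H _]; exact H.
  - intros z Hz; destruct (Rle_dec (Cmod z) r) as [Hzr|Hzr].
    + assert (H1 : rad (S i) < Cmod z) by (apply Rnot_le_lt; intros G; apply Hz; split; [lra | left; lra]).
      assert (H2 : bad_level < Cmod (F z)) by (apply Rnot_le_lt; intros G; apply Hz; split; [lra | right; lra]).
      destruct (Cmod_gt_open z _ H1) as [d1 [Hd1 G1]].
      destruct (cdiff_Cmod_gt_open F z _ (HF z ltac:(lra)) H2) as [d2 [Hd2 G2]].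
      exists (Rmin d1 d2); split; [apply Rmin_pos; assumption|]; intros w Hw [_ [W|W]].
      * specialize (G1 w ltac:(eapply Rlt_le_trans; [exact Hw | apply Rmin_l])); lra.
      * specialize (G2 w ltac:(eapply Rlt_le_trans; [exact Hw | apply Rmin_r])); lra.
    + destruct (Cmod_gt_open z r ltac:(lra)) as [d [Hd G]]; exists d; split; [exact Hd|].
      intros w Hw [W _]; specialize (G w Hw); lra.
  - intros z [Hz _]; apply cdiff_damped; [apply cdiff_shifted; lra | apply HQ; lra].
  - intros z HXz; pose proof HXz as [Hzr Hz].
    destruct (Rlt_dec (Cmod z) (rad (S i))) as [Hlt|Hge].
    { right; destruct (Cmod_lt_open z _ Hlt) as [d [Hd G]]; exists d; split; [exact Hd|].
      intros w Hw; specialize (G w Hw); split; [lra | left; lra]. }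
    pose proof (shifted_le (scale i) z ltac:(lra)) as Hsh.
    pose proof (Cmod_ge_0 (shifted F a (scale i) z)) as Hsh0.
    destruct (Req_dec (Cmod z) r) as [Er|Nr].
    { left; rewrite Cmod_mult_Cexp.
      assert (HFz : Cmod (F z) <= bad_level) by (destruct Hz as [Hz|Hz]; lra).
      destruct (Hcirc z Er) as [G|G].
      (* Here Q gives nothing beyond Re Q >= 0; the bound exp (- L) <= exp (- L c) uses c <= 1. *)
      - apply Rle_trans with (2 * K' * exp (- L) * 1).
        + apply Rmult_le_compat; [exact Hsh0 | apply Rlt_le, exp_pos | lra|].
          rewrite <- exp_0; apply exp_le; specialize (HQ0 z ltac:(lra)); nra.
        + rewrite Rmult_1_r; unfold B; apply Rmult_le_compat; [lra | apply Rlt_le, exp_pos | |].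
          * unfold growth_const; nra.
          * apply exp_le; nra.
      - apply HB; [|exact G]; unfold growth_const; split; [exact Hsh0 | nra]. }
    destruct (Rlt_dec (Cmod (F z)) bad_level) as [Hsm|Hbg].
    { right; destruct (Cmod_lt_open z r ltac:(lra)) as [d1 [Hd1 G1]].
      destruct (cdiff_Cmod_lt_open F z _ (HF z ltac:(lra)) Hsm) as [d2 [Hd2 G2]].
      exists (Rmin d1 d2); split; [apply Rmin_pos; assumption|]; intros w Hw.
      specialize (G1 w ltac:(eapply Rlt_le_trans; [exact Hw | apply Rmin_l])).
      specialize (G2 w ltac:(eapply Rlt_le_trans; [exact Hw | apply Rmin_r])).
      split; [lra | right; lra]. }
    (* What remains is bad and has |z| >= rad (S i), so Re Q >= c. Either |z| = rad (S i), where
       1/(1-|z|) = N^2 and the growth gives N^(2m), or |F| is exactly [bad_level]. *)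
    left; rewrite Cmod_mult_Cexp; apply HB; [|apply Hbad; lra].
    split; [exact Hsh0|]; eapply Rle_trans; [exact Hsh|].
    destruct Hz as [Hz|Hz]; [|unfold growth_const; nra].
    assert (HFz : Cmod (F z) <= K * N ^ (2 * m)).
    { eapply Rle_trans; [apply Hgrow; lra|].
      assert (Ez : Cmod z = rad (S i)) by lra.
      rewrite Ez; unfold rad; rewrite scale_S, mult_INR; fold N.
      replace (1 - (1 - / (N * N))) with (/ (N * N)) by ring; rewrite Rinv_inv.
      right; f_equal; rewrite pow_mult; f_equal; ring. }
    unfold growth_const; nra.
  - exact HX0. }
rewrite Cmod_mult_Cexp in HMP.
pose proof (shifted_ge_1 i z0 ltac:(lra) Hz0) as Hge1.
apply Rnot_lt_le; intros Hlt.
assert (Hexp : exp (- L * Re (Q z0)) <= B).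
{ eapply Rle_trans; [|exact HMP]; rewrite <- (Rmult_1_l (exp _)) at 1.
  apply Rmult_le_compat_r; [apply Rlt_le, exp_pos | exact Hge1]. }
assert (Hstrict : exp (- L * c + 2 ^ i * (ln growth_const + 2 * INR m * ln 3)) < exp (- L * Re (Q z0))).
{ apply exp_increasing.
  assert (EL : L * (step_loss * / phi i) = 2 ^ i * (ln growth_const + 2 * INR m * ln 3)).
  { unfold L, damping, step_loss; field; specialize (Hphi i); lra. }
  rewrite <- EL; nra. }
assert (HBle : B <= exp (- L * c + 2 ^ i * (ln growth_const + 2 * INR m * ln 3))).
{ rewrite exp_plus, Rmult_comm; unfold B; rewrite Rmult_comm.
  rewrite (Rmult_comm (exp (2 ^ i * _))).
  apply Rmult_le_compat_l; [apply Rlt_le, exp_pos|].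
  rewrite Rmult_plus_distr_l, exp_plus; pose proof growth_const_ge_1 as HK2.
  assert (H2i : 1 <= 2 ^ i) by (apply pow_R1_Rle; lra).
  apply Rmult_le_compat; [lra | lra | |].
  - rewrite <- (exp_ln growth_const) at 1 by lra; apply exp_le.
    assert (0 <= ln growth_const) by (rewrite <- ln_1; apply ln_le; lra); nra.
  - right; unfold N, scale; rewrite pow_INR, <- pow_mult.
    replace (INR 3) with 3 by (simpl; ring).
    rewrite <- (exp_ln (3 ^ (2 ^ i * (2 * m)))) by (apply pow_lt; lra).
    rewrite ln_pow by lra; f_equal; rewrite !mult_INR, pow_INR.
    replace (INR 2) with 2 by (simpl; ring); ring. }
lra.
Qed.

(** The outer circle and Q stay fixed while the inner radius shrinks by one scale at a time; the
    circle hypothesis survives because the level only decreases. *)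
Lemma barrier_descent (Q : C -> C) (r : R) (n k : nat) :
  rad n < r < 1 -> barrier_height <= 1 ->
  (forall z, Cmod z < 1 -> cdiff Q z) -> (forall z, Cmod z < 1 -> 0 <= Re (Q z)) ->
  (forall w, rad n <= Cmod w <= r -> bad_level <= Cmod (F w) -> barrier_height <= Re (Q w)) ->
  (forall i w, (i1 <= i <= n)%nat -> Cmod w = r ->
     Cmod (shifted F a (scale i) w) < 2 * K' * exp (- damping i) \/ barrier_height <= Re (Q w)) ->
  (i1 + k <= n)%nat ->
  forall w, rad (n - k) <= Cmod w <= r -> bad_level <= Cmod (F w) ->
    barrier_height - step_loss * (psum (fun i => / phi i) n - psum (fun i => / phi i) (n - k)) <= Re (Q w).
Proof.
intros Hr Hc HQ HQ0 Hbad Hcirc; induction k as [|k IH]; intros Hk w Hw HFw.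
- rewrite Nat.sub_0_r in *; unfold Rminus; rewrite Rplus_opp_r, Rmult_0_r, Ropp_0, Rplus_0_r.
  apply Hbad; assumption.
- specialize (IH ltac:(lia)).
  set (i := (n - S k)%nat) in *; replace (n - k)%nat with (S i) in IH by (unfold i; lia).
  set (g := psum (fun i => / phi i)) in *.
  assert (Hmono : g (S i) <= g n).
  { apply psum_mono; [intros p; apply Rlt_le, Rinv_0_lt_compat, Hphi | unfold i; lia]. }
  pose proof step_loss_ge_0 as HC3.
  assert (Eg : g (S i) = g i + / phi i) by reflexivity.
  replace (barrier_height - step_loss * (g n - g i)) with (barrier_height - step_loss * (g n - g (S i)) - step_loss * / phi i) by (rewrite Eg; ring).
  apply (barrier_step Q r); auto.
  + split; [|lra]; apply Rle_lt_trans with (rad n); [apply rad_mono; unfold i; lia | lra].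
  + nra.
  + intros v Hv; destruct (Hcirc i v ltac:(unfold i; lia) Hv) as [G|G]; [left; exact G | right; nra].
Qed.

Lemma barrier_height_bounds : 0 < barrier_height <= 1.
Proof.
unfold barrier_height; pose proof PI2_1; split; [apply Rinv_0_lt_compat; lra|].
rewrite <- Rinv_1; apply Rinv_le_contravar; lra.
Qed.

(** The order of quantifiers matters: n must be fixed before r, because the outer radius is later
    chosen in terms of n. If every n failed for some r n, the bad points in the annuli from rad (i0
    + n) to r n would form a sequence contradicting [barrier]. *)
Lemma small_exceptional_barrier (z0 : C) (i0 : nat) (delta : R) : Cmod z0 < 1 -> 0 < delta ->
  exists n, (i0 <= n)%nat /\ forall r, r < 1 -> exists Q : C -> C,
    (forall z, Cmod z < 1 -> cdiff Q z) /\ (forall z, Cmod z < 1 -> 0 <= Re (Q z)) /\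
    (forall w, rad n <= Cmod w <= r -> bad_level <= Cmod (F w) -> barrier_height <= Re (Q w)) /\ Re (Q z0) <= delta.
Proof.
intros Hz0 Hd; apply NNPP; intros Hno.
assert (Hr : forall n, exists r, r < 1 /\ ~ exists Q : C -> C,
    (forall z, Cmod z < 1 -> cdiff Q z) /\ (forall z, Cmod z < 1 -> 0 <= Re (Q z)) /\
    (forall w, rad (i0 + n) <= Cmod w <= r -> bad_level <= Cmod (F w) -> barrier_height <= Re (Q w)) /\
    Re (Q z0) <= delta).
{ intros n; apply NNPP; intros H; apply Hno; exists (i0 + n)%nat; split; [lia|].
  intros r Hr; apply NNPP; intros H'; apply H; exists r; split; assumption. }
set (r := fun n => proj1_sig (constructive_indefinite_description _ (Hr n))).
assert (Hr' : forall n, r n < 1 /\ ~ exists Q : C -> C,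
    (forall z, Cmod z < 1 -> cdiff Q z) /\ (forall z, Cmod z < 1 -> 0 <= Re (Q z)) /\
    (forall w, rad (i0 + n) <= Cmod w <= r n -> bad_level <= Cmod (F w) -> barrier_height <= Re (Q w)) /\
    Re (Q z0) <= delta).
{ intros n; unfold r; destruct (constructive_indefinite_description _ (Hr n)); assumption. }
destruct (barrier (fun n w => rad (i0 + n) <= Cmod w <= r n /\ bad_level <= Cmod (F w)) E z0 delta)
  as (n & Q & H1 & H2 & H3 & H4); auto.
- intros n; exists (r n); split; [apply Hr' | intros w [H _]; apply H].
- intros t Ht HEt.
  destruct (Hnt t Ht HEt 0%nat 1 Rlt_0_1) as [d [Hd0 Hw]].
  destruct (nfloor_ex (3 / d)) as [n0 [_ Hn0]]; [apply Rlt_le, Rdiv_lt_0_compat; lra|].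
  exists (S n0); intros n Hn w [[Hw1 Hw2] HFw] Hcone.
  assert (Hwlt : Cmod w < 1) by (specialize (Hr' n); lra).
  assert (Hsc : INR n0 + 1 <= INR (scale (i0 + n))).
  { rewrite <- S_INR; apply le_INR; pose proof (scale_ge (i0 + n)); lia. }
  assert (Hlt : Cmod (w - eit t) < d).
  { eapply Rlt_le_trans; [exact Hcone|]; unfold rad in Hw1.
    pose proof (INR_scale_ge (i0 + n)) as Hs2.
    apply Rle_trans with (3 * / INR (scale (i0 + n))); [lra|].
    apply Rmult_le_reg_r with (INR (scale (i0 + n))); [lra|].
    rewrite Rmult_assoc, Rinv_l, Rmult_1_r by lra.
    apply Rmult_lt_compat_l with (r := d) in Hn0; [|exact Hd0].
    replace (d * (3 / d)) with 3 in Hn0 by (field; lra); nra. }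
  specialize (Hw w Hwlt Hcone Hlt); simpl in Hw; unfold bad_level in HFw; lra.
- apply (proj2 (Hr' n)); exists Q; repeat split; auto.
Qed.

(** One circle serves all the scales from i1 to n. Nontangential convergence is not uniform in the
    scale, but finitely many scales have a common distance, and the radii r k tend to 1. *)
Lemma circle_barrier (z0 : C) (n : nat) (s delta : R) : Cmod z0 < 1 -> 0 < delta -> s < 1 ->
  exists r (Q : C -> C), s < r < 1 /\
    (forall z, Cmod z < 1 -> cdiff Q z) /\ (forall z, Cmod z < 1 -> 0 <= Re (Q z)) /\
    (forall i w, (i1 <= i <= n)%nat -> Cmod w = r ->
       Cmod (shifted F a (scale i) w) < 2 * K' * exp (- damping i) \/ barrier_height <= Re (Q w)) /\
    Re (Q z0) <= delta.
Proof.
intros Hz0 Hd Hs.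
set (r := fun k : nat => 1 - (1 - s) * / (INR k + 2)).
assert (Hk2 : forall k, 0 < / (INR k + 2) < 1).
{ intros k; pose proof (pos_INR k); split; [apply Rinv_0_lt_compat; lra|].
  rewrite <- Rinv_1; apply Rinv_lt_contravar; lra. }
assert (Hr : forall k, s < r k < 1) by (intros k; specialize (Hk2 k); unfold r; nra).
destruct (barrier (fun k w => Cmod w = r k /\ exists i, (i1 <= i <= n)%nat /\
    2 * K' * exp (- damping i) <= Cmod (shifted F a (scale i) w)) E z0 delta)
  as (k & Q & H1 & H2 & H3 & H4); auto.
- intros k; exists (r k); split; [apply Hr | intros w [H _]; lra].
- intros t Ht HEt.
  assert (Hfin : forall p, exists d, 0 < d /\ forall i, (i1 <= i <= p)%nat -> forall z, Cmod z < 1 ->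
    Cmod (z - eit t) < 3 * (1 - Cmod z) -> Cmod (z - eit t) < d ->
    Cmod (shifted F a (scale i) z) < 2 * K' * exp (- damping i)).
  { assert (Hone : forall i, (i1 <= i)%nat -> exists d, 0 < d /\ forall z, Cmod z < 1 ->
      Cmod (z - eit t) < 3 * (1 - Cmod z) -> Cmod (z - eit t) < d ->
      Cmod (shifted F a (scale i) z) < 2 * K' * exp (- damping i)).
    { intros i Hi; pose proof (exp_pos (- damping i)) as He.
      destruct (Hnt t Ht HEt (scale i) (K' * exp (- damping i))) as [d [Hd0 Hw]].
      { apply Rmult_lt_0_compat; assumption. }
      exists d; split; [exact Hd0|]; intros z Hz1 Hz2 Hz3; specialize (Hw z Hz1 Hz2 Hz3).
      specialize (HT i Hi); lra. }
    induction p as [|p [d [Hd0 IH]]].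
    - destruct (le_lt_dec i1 0) as [G|G].
      + destruct (Hone 0%nat G) as [d [Hd0 H]]; exists d; split; [exact Hd0|].
        intros i Hi; replace i with 0%nat by lia; exact H.
      + exists 1; split; [lra|]; intros i Hi; lia.
    - destruct (le_lt_dec i1 (S p)) as [G|G].
      + destruct (Hone (S p) G) as [d' [Hd0' H]]; exists (Rmin d d'); split; [apply Rmin_pos; assumption|].
        intros i Hi z Hz1 Hz2 Hz3; destruct (Nat.eq_dec i (S p)) as [->|Hne].
        * apply H; auto; eapply Rlt_le_trans; [exact Hz3 | apply Rmin_r].
        * apply IH; auto; [lia|]; eapply Rlt_le_trans; [exact Hz3 | apply Rmin_l].
      + exists 1; split; [lra|]; intros i Hi; lia. }
  destruct (Hfin n) as [d [Hd0 Hw]].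
  destruct (nfloor_ex (3 * (1 - s) / d)) as [n0 [_ Hn0]].
  { apply Rlt_le, Rdiv_lt_0_compat; lra. }
  exists n0; intros k Hk w [Hwr [i [Hi Hwi]]] Hcone.
  assert (Hkn : INR n0 <= INR k) by (apply le_INR, Hk).
  assert (Hlt : Cmod (w - eit t) < d).
  { eapply Rlt_le_trans; [exact Hcone|]; rewrite Hwr; unfold r; pose proof (pos_INR k).
    apply Rmult_le_reg_r with (INR k + 2); [lra|].
    replace (3 * (1 - (1 - (1 - s) * / (INR k + 2))) * (INR k + 2)) with (3 * (1 - s)) by (field; lra).
    apply Rmult_lt_compat_l with (r := d) in Hn0; [|exact Hd0].
    replace (d * (3 * (1 - s) / d)) with (3 * (1 - s)) in Hn0 by (field; lra); nra. }
  specialize (Hr k); specialize (Hw i Hi w ltac:(lra) Hcone Hlt); lra.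
- exists (r k), Q; repeat split; auto; try apply Hr.
  intros i w Hi Hw; destruct (Rlt_dec (Cmod (shifted F a (scale i) w)) (2 * K' * exp (- damping i)))
    as [G|G]; [left; exact G | right].
  apply H3; split; [exact Hw|]; exists i; split; [exact Hi | lra].
Qed.

Lemma bounded_in_disk : exists B, 0 < B /\ forall z, Cmod z < 1 -> Cmod (F z) <= B.
Proof.
pose proof barrier_height_bounds as Hc0; pose proof step_loss_ge_0 as HC3.
(* From here on the descent loses at most half of [barrier_height], whereas the two barriers
   together are at most a quarter of it at z0: no bad z0 can exist. *)
destruct (psum_tail (fun i => / phi i) lphi (barrier_height / (2 * step_loss + 2))) as [j0 Hj0].
{ intros n; apply Rlt_le, Rinv_0_lt_compat, Hphi. } { exact Hsum. }
{ apply Rdiv_lt_0_compat; lra. }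
set (i0 := Nat.max i1 j0).
assert (Hgood : forall z, rad i0 <= Cmod z < 1 -> Cmod (F z) < bad_level).
{ intros z0 [Hz1 Hz2]; apply Rnot_le_lt; intros Hbad.
  destruct (small_exceptional_barrier z0 i0 (barrier_height / 8) Hz2) as (n & Hn & Hn1); [lra|].
  destruct (circle_barrier z0 n (Rmax (rad n) (Cmod z0)) (barrier_height / 8) Hz2)
    as (r & Q2 & Hr & HQ2 & HQ20 & HQ2c & HQ2z); [lra | |].
  { apply Rmax_lub_lt; [apply rad_bounds | exact Hz2]. }
  pose proof (Rmax_l (rad n) (Cmod z0)); pose proof (Rmax_r (rad n) (Cmod z0)).
  destruct (Hn1 r (proj2 Hr)) as (Q1 & HQ1 & HQ10 & HQ1b & HQ1z).
  set (Q := fun z => (Q1 z + Q2 z)%C).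
  assert (HRe : forall z, Re (Q z) = Re (Q1 z) + Re (Q2 z)) by (intros z; apply Re_plus).
  assert (Hk : barrier_height - step_loss * (psum (fun i => / phi i) n - psum (fun i => / phi i) (n - (n - i0)))
    <= Re (Q z0)).
  { apply (barrier_descent Q r); auto; try lra.
    - intros z Hz; apply cdiff_plus; [apply HQ1, Hz | apply HQ2, Hz].
    - intros z Hz; rewrite HRe; specialize (HQ10 z Hz); specialize (HQ20 z Hz); lra.
    - intros w Hw HFw; rewrite HRe; specialize (HQ1b w Hw HFw); specialize (HQ20 w ltac:(lra)); lra.
    - intros i w Hi Hw; destruct (HQ2c i w Hi Hw) as [G|G]; [left; exact G | right].
      rewrite HRe; specialize (HQ10 w ltac:(lra)); lra.
    - unfold i0 in *; lia.
    - replace (n - (n - i0))%nat with i0 by lia; lra. }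
  replace (n - (n - i0))%nat with i0 in Hk by lia.
  specialize (Hj0 i0 n ltac:(unfold i0; lia)).
  assert (step_loss * (psum (fun i => / phi i) n - psum (fun i => / phi i) i0) <= barrier_height / 2).
  { apply Rle_trans with (step_loss * (barrier_height / (2 * step_loss + 2))).
    - apply Rmult_le_compat_l; [exact HC3 | exact Hj0].
    - apply Rmult_le_reg_r with (2 * step_loss + 2); [lra|].
      replace (step_loss * (barrier_height / (2 * step_loss + 2)) * (2 * step_loss + 2)) with (step_loss * barrier_height) by (field; lra); nra. }
  rewrite HRe in Hk; lra. }
set (B := K * INR (scale i0) ^ m).
assert (HB : 0 <= B).
{ apply Rmult_le_pos; [lra|]; apply pow_le, pos_INR. }
assert (Hbig : 0 < bad_level) by (unfold bad_level; lra).
exists (B + bad_level); split; [lra|]; intros z Hz.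
destruct (Rle_dec (rad i0) (Cmod z)) as [G|G].
- specialize (Hgood z ltac:(lra)); lra.
- apply Rle_trans with B; [|lra]; eapply Rle_trans; [apply Hgrow, Hz|].
  apply Rmult_le_compat_l; [lra|]; apply pow_incr; split.
  + apply Rlt_le, Rinv_0_lt_compat; lra.
  + pose proof (INR_scale_ge i0); rewrite <- (Rinv_inv (INR (scale i0))).
    apply Rinv_le_contravar; [apply Rinv_0_lt_compat; lra | unfold rad in G; lra].
Qed.

End Main.

(** * Vanishing of the coefficients *)

(** Same damping as before, but a global bound B replaces the growth, so a single barrier on one
    circle suffices. *)
Lemma bounded_le_boundary (h : C -> C) (E : R -> Prop) (B M : R) (z0 : C) :
  (forall z, Cmod z < 1 -> cdiff h z) -> 0 < B -> (forall z, Cmod z < 1 -> Cmod (h z) <= B) ->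
  null_set E -> 0 <= M -> (forall t, 0 <= t <= 2 * PI -> ~ E t -> nt_bounded h t M) ->
  Cmod z0 < 1 -> Cmod (h z0) <= M.
Proof.
intros Hh HB HhB HE HM Hnt Hz0; pose proof barrier_height_bounds as Hc0.
assert (Heta : forall eta, 0 < eta -> Cmod (h z0) <= (M + eta) * (1 + eta)).
{ intros eta He.
  (* Then B exp (- L barrier_height) = B exp (- B/eta) <= eta by exp x >= x, which tames the
     exceptional points of the circle. Taking Re Q(z0) <= ln (1+eta) / L makes undoing the damping
     at z0 cost only a factor 1+eta. *)
  set (L := B / (eta * barrier_height)).
  assert (Hec : 0 < eta * barrier_height) by (apply Rmult_lt_0_compat; lra).
  assert (HL : 0 < L) by (apply Rdiv_lt_0_compat; lra).
  assert (Hln : 0 < ln (1 + eta)) by (rewrite <- ln_1; apply ln_increasing; lra).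
  set (r := fun k : nat => 1 - (1 - Cmod z0) * / (INR k + 2)).
  assert (Hk2 : forall k, 0 < / (INR k + 2) < 1).
  { intros k; pose proof (pos_INR k); split; [apply Rinv_0_lt_compat; lra|].
    rewrite <- Rinv_1; apply Rinv_lt_contravar; lra. }
  assert (Hr : forall k, Cmod z0 < r k < 1) by (intros k; specialize (Hk2 k); unfold r; nra).
  destruct (barrier (fun k w => Cmod w = r k /\ M + eta <= Cmod (h w)) E z0 (ln (1 + eta) / L))
    as (k & Q & H1 & H2 & H3 & H4); auto.
  - apply Rdiv_lt_0_compat; assumption.
  - intros k; exists (r k); split; [apply Hr | intros w [H _]; lra].
  - intros t Ht HEt; destruct (Hnt t Ht HEt eta He) as [d [Hd0 Hw]].
    destruct (nfloor_ex (3 * (1 - Cmod z0) / d)) as [n0 [_ Hn0]].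
    { apply Rlt_le, Rdiv_lt_0_compat; lra. }
    exists n0; intros k Hk w [Hwr Hwi] Hcone.
    assert (Hkn : INR n0 <= INR k) by (apply le_INR, Hk).
    assert (Hlt : Cmod (w - eit t) < d).
    { eapply Rlt_le_trans; [exact Hcone|]; rewrite Hwr; unfold r; pose proof (pos_INR k).
      apply Rmult_le_reg_r with (INR k + 2); [lra|].
      replace (3 * (1 - (1 - (1 - Cmod z0) * / (INR k + 2))) * (INR k + 2))
        with (3 * (1 - Cmod z0)) by (field; lra).
      apply Rmult_lt_compat_l with (r := d) in Hn0; [|exact Hd0].
      replace (d * (3 * (1 - Cmod z0) / d)) with (3 * (1 - Cmod z0)) in Hn0 by (field; lra); nra. }
    specialize (Hr k); specialize (Hw w ltac:(lra) Hcone Hlt); lra.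
  - specialize (Hr k).
    assert (HMP : Cmod (h z0 * Cexp (RtoC (- L) * Q z0)) <= M + eta).
    { apply (max_modulus (fun w => h w * Cexp (RtoC (- L) * Q w))%C (fun z => Cmod z <= r k) (r k)).
      - lra.
      - intros z Hz; exact Hz.
      - intros z Hz; destruct (Cmod_gt_open z (r k) ltac:(lra)) as [d [Hd G]].
        exists d; split; [exact Hd|]; intros w Hw; specialize (G w Hw); lra.
      - intros z Hz; apply cdiff_damped; [apply Hh | apply H1]; lra.
      - intros z Hz; destruct (Req_dec (Cmod z) (r k)) as [Er|Nr].
        + left; rewrite Cmod_mult_Cexp; pose proof (Cmod_ge_0 (h z)) as Hhz.
          destruct (Rle_dec (M + eta) (Cmod (h z))) as [G|G].
          * specialize (H3 z (conj Er G)).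
            apply Rle_trans with (B * exp (- (L * barrier_height))).
            { apply Rmult_le_compat; [exact Hhz | apply Rlt_le, exp_pos | apply HhB; lra|].
              apply exp_le; nra. }
            assert (ELc : L * barrier_height = B / eta) by (unfold L; field; lra).
            rewrite ELc, exp_Ropp.
            assert (HBe : 0 < B / eta) by (apply Rdiv_lt_0_compat; lra).
            assert (He1 : B / eta <= exp (B / eta)) by (pose proof (exp_ineq1 (B / eta)); lra).
            apply Rle_trans with (B * / (B / eta)).
            { apply Rmult_le_compat_l; [lra|]; apply Rinv_le_contravar; lra. }
            replace (B * / (B / eta)) with eta by (field; lra); lra.
          * rewrite <- (Rmult_1_r (M + eta)); apply Rmult_le_compat; [exact Hhz | apply Rlt_le, exp_pos | lra|].
            rewrite <- exp_0; apply exp_le; specialize (H2 z ltac:(lra)); nra.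
        + right; destruct (Cmod_lt_open z (r k) ltac:(lra)) as [d [Hd G]].
          exists d; split; [exact Hd|]; intros w Hw; specialize (G w Hw); lra.
      - lra. }
    rewrite Cmod_mult_Cexp in HMP.
    assert (HLQ : L * Re (Q z0) <= ln (1 + eta)).
    { apply Rmult_le_compat_l with (r := L) in H4; [|lra].
      replace (L * (ln (1 + eta) / L)) with (ln (1 + eta)) in H4 by (field; lra); exact H4. }
    assert (Hexp : exp (L * Re (Q z0)) <= 1 + eta).
    { rewrite <- (exp_ln (1 + eta)) by lra; apply exp_le, HLQ. }
    replace (Cmod (h z0)) with (Cmod (h z0) * exp (- L * Re (Q z0)) * exp (L * Re (Q z0))).
    + apply Rmult_le_compat; [|apply Rlt_le, exp_pos | exact HMP | exact Hexp].
      apply Rmult_le_pos; [apply Cmod_ge_0 | apply Rlt_le, exp_pos].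
    + rewrite Rmult_assoc, <- exp_plus; replace (- L * Re (Q z0) + L * Re (Q z0)) with 0 by ring.
      rewrite exp_0; ring. }
apply Rnot_lt_le; intros Hlt; set (g := Cmod (h z0) - M) in *.
set (eta := Rmin 1 (g / (2 * (M + 2)))).
assert (Heta0 : 0 < eta) by (apply Rmin_pos; [lra | apply Rdiv_lt_0_compat; unfold g; lra]).
assert (He1 : eta <= 1) by apply Rmin_l.
assert (He2 : eta * (M + 2) <= g / 2).
{ apply Rle_trans with (g / (2 * (M + 2)) * (M + 2)).
  - apply Rmult_le_compat_r; [lra | apply Rmin_r].
  - right; field; lra. }
specialize (Heta eta Heta0); unfold g in *; nra.
Qed.

Lemma Re_conj (z : C) : Re (Cconj z) = Re z.
Proof. destruct z; reflexivity. Qed.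

Lemma Cconj_mult (z w : C) : Cconj (z * w) = (Cconj z * Cconj w)%C.
Proof. destruct z, w; unfold Cconj, Cmult; simpl; f_equal; ring. Qed.

Lemma Cconj_pow (z : C) (n : nat) : Cconj (z ^ n) = (Cconj z ^ n)%C.
Proof.
induction n as [|n IH]; simpl; [unfold Cconj, RtoC; simpl; f_equal; ring|].
rewrite Cconj_mult, IH; reflexivity.
Qed.

Lemma Cconj_inv_circle (z : C) (rho : R) : 0 < rho -> Cmod z = rho ->
  Cconj (/ z) = (RtoC (/ rho ^ 2) * z)%C.
Proof.
intros Hr Hz.
assert (E : Re z ^ 2 + Im z ^ 2 = rho ^ 2) by (rewrite <- Hz, Cmod2_alt; reflexivity).
assert (0 < rho ^ 2) by (apply pow_lt, Hr).
destruct z as [x y]; unfold Cconj, Cinv, RtoC, Cmult; simpl in *.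
rewrite !Rmult_1_r in *; rewrite E; f_equal; field; lra.
Qed.

(* Analytic polynomial which on the circle |z| = rho has the same real part as
   lambda (a_0 / z + ... + a_(j-1) / z^j). *)
Fixpoint reflected (lambda : C) (a : nat -> C) (rho : R) (j : nat) (z : C) : C :=
  match j with
  | O => 0%C
  | S k => (reflected lambda a rho k z + Cconj (lambda * a k) * (RtoC (/ rho ^ 2) * z) ^ S k)%C
  end.

Lemma cdiff_reflected lambda a rho j z : cdiff (reflected lambda a rho j) z.
Proof.
induction j as [|j IH]; [apply cdiff_const|].
apply cdiff_plus; [exact IH|]; apply cdiff_scal.
apply (cdiff_pow (fun w => RtoC (/ rho ^ 2) * w)%C), cdiff_scal, cdiff_id.
Qed.

Lemma reflected_0 lambda a rho j : reflected lambda a rho j 0 = 0%C.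
Proof. induction j as [|j IH]; [reflexivity|]; simpl reflected; rewrite IH; simpl; ring. Qed.

(** z^(-j) times the (N+j)-th shifted function is the N-th one minus a principal part in 1/z. On the
    circle, conjugation turns that principal part into an analytic polynomial without changing real
    parts, so the mean value inequality applies. *)
Lemma re_reflected (F : C -> C) (a : nat -> C) (lambda : C) (N j : nat) (rho : R) (z : C) :
  0 < rho -> Cmod z = rho ->
  Re (lambda * shifted F a N z - reflected lambda (fun k => a (N + k)%nat) rho j z)
  = Re (lambda * ((/ z) ^ j * shifted F a (N + j) z)).
Proof.
intros Hr Hz; assert (Hz0 : z <> 0%C) by (apply Cmod_gt_0; lra).
induction j as [|j IH].
- rewrite Nat.add_0_r; apply (f_equal Re); simpl; ring.
- rewrite Nat.add_succ_r; simpl shifted; set (b := fun k => a (N + k)%nat) in *.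
  change (reflected lambda b rho (S j) z) with
    (reflected lambda b rho j z + Cconj (lambda * b j) * (RtoC (/ rho ^ 2) * z) ^ S j)%C.
  replace (lambda * shifted F a N z - (reflected lambda b rho j z +
     Cconj (lambda * b j) * (RtoC (/ rho ^ 2) * z) ^ S j))%C with
    ((lambda * shifted F a N z - reflected lambda b rho j z)
     - Cconj (lambda * b j) * (RtoC (/ rho ^ 2) * z) ^ S j)%C by ring.
  rewrite Re_minus, IH, <- (Cconj_inv_circle z rho Hr Hz), <- Cconj_pow, <- Cconj_mult, Re_conj, <- Re_minus.
  apply (f_equal Re); unfold b; simpl; field; exact Hz0.
Qed.

(** [shifted F a (S n)] equals - a n at 0, and the reflected polynomial vanishes there; with lambda
    = - conj (a n) the real part of G(0) is |a n|^2. On a circle it is bounded through T (S n + j),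
    which tends to 0 with j. *)
Lemma coefficient_zero (F : C -> C) (a : nat -> C) (T : nat -> R) (n : nat) :
  (forall z, Cmod z < 1 -> cdiff F z) ->
  (forall N z, Cmod z < 1 -> Cmod (shifted F a N z) <= T N) ->
  (forall eps, 0 < eps -> exists N0, forall N, (N0 <= N)%nat -> T N < eps) ->
  a n = 0%C.
Proof.
intros HF HT Hlim.
set (lambda := (- Cconj (a n))%C).
assert (Hl : Cmod lambda = Cmod (a n)) by (unfold lambda; rewrite Cmod_opp; apply Cmod_conj).
assert (Hj : forall j, Cmod (a n) ^ 2 <= Cmod (a n) * (2 * T (S n + j)%nat)).
(* Bernoulli's inequality gives rho^j >= 1/2, so the factor |1/z|^j costs at most 2. *)
{ intros j; set (rho := 1 - / (2 * INR j + 2)).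
  pose proof (pos_INR j) as Hj.
  assert (Hi : 0 < / (2 * INR j + 2) <= / 2).
  { split; [apply Rinv_0_lt_compat; lra | apply Rinv_le_contravar; lra]. }
  assert (Hrho : 0 < rho < 1) by (unfold rho; lra).
  assert (Hpow : / 2 <= rho ^ j).
  { apply Rle_trans with (1 + INR j * (- / (2 * INR j + 2))).
    - assert (INR j * / (2 * INR j + 2) <= / 2); [|lra].
      apply Rmult_le_reg_r with (2 * INR j + 2); [lra|].
      rewrite Rmult_assoc, Rinv_l by lra; lra.
    - unfold rho, Rminus.
      clear - Hi; set (x := / (2 * INR j + 2)) in *; clearbody x.
      induction j as [|j IH]; [simpl; lra|]; rewrite S_INR; simpl.
      pose proof (pos_INR j); nra. }
  set (G := fun z => (lambda * shifted F a (S n) z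
    - reflected lambda (fun k => a (S n + k)%nat) rho j z)%C).
  assert (K : Re (G 0%C) <= Cmod (a n) * (2 * T (S n + j)%nat)).
  { apply (re_le_circle_max G 1 rho); [exact Hrho| |].
    - intros z Hz; apply cdiff_minus; [|apply cdiff_reflected].
      apply cdiff_scal, cdiff_shifted; [exact HF | exact Hz].
    - intros t; set (z := (RtoC rho * eit t)%C).
      assert (Hz : Cmod z = rho) by (unfold z; rewrite Cmod_mult, Cmod_eit, Cmod_R, Rabs_right; lra).
      assert (Hz0 : z <> 0%C) by (apply Cmod_gt_0; lra).
      unfold G; rewrite (re_reflected F a lambda (S n) j rho z) by lra.
      eapply Rle_trans; [apply Rle_abs|]; eapply Rle_trans; [apply re_le_Cmod|].
      rewrite !Cmod_mult, Cmod_pow, Cmod_inv, Hl, Hz by exact Hz0.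
      apply Rmult_le_compat_l; [apply Cmod_ge_0|].
      apply Rmult_le_compat; [| apply Cmod_ge_0 | | apply HT; lra].
      + apply pow_le, Rlt_le, Rinv_0_lt_compat; lra.
      + rewrite pow_inv, <- (Rinv_inv 2); apply Rinv_le_contravar; lra. }
  assert (EG : Re (G 0%C) = Cmod (a n) ^ 2).
  { unfold G; rewrite reflected_0; simpl shifted; unfold lambda; rewrite Cmod2_alt.
    replace (- Cconj (a n) * (0 * shifted F a n 0 - a n) - 0)%C with (Cconj (a n) * a n)%C by ring.
    destruct (a n); simpl; ring. }
  rewrite EG in K; exact K. }
apply Cmod_eq_0; destruct (Req_dec (Cmod (a n)) 0) as [H|H]; [exact H|exfalso].
pose proof (Cmod_ge_0 (a n)) as H0.
destruct (Hlim (Cmod (a n) / 2)) as [N0 HN0]; [lra|].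
specialize (HN0 (S n + N0)%nat ltac:(lia)); specialize (Hj N0); nra.
Qed.

(** * Decay of the coefficients *)

Lemma sum_n_psum (u : nat -> R) (n : nat) : sum_n u n = psum u (S n).
Proof.
induction n as [|n IH]; [rewrite sum_O; simpl; ring|].
rewrite sum_Sn, IH; reflexivity.
Qed.

Lemma Series_psum (u : nat -> R) (n : nat) : ex_series u ->
  Series u = psum u n + Series (fun k => u (n + k)%nat).
Proof.
intros Hu; induction n as [|n IH]; simpl; [rewrite Rplus_0_l; apply Series_ext; reflexivity|].
rewrite IH, Rplus_assoc; f_equal.
rewrite Series_incr_1 by (apply (ex_series_incr_n u n), Hu).
rewrite Nat.add_0_r; f_equal; apply Series_ext; intros k; f_equal; lia.
Qed.

Lemma Series_zero : Series (fun _ => 0) = 0.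
Proof. rewrite (Series_ext _ (fun _ => 0 * 0)) by (intros; ring); rewrite Series_scal_l; ring. Qed.

Lemma Series_nonneg (u : nat -> R) : ex_series u -> (forall n, 0 <= u n) -> 0 <= Series u.
Proof.
intros Hu H0; rewrite <- Series_zero at 1; apply Series_le; [|exact Hu].
intros n; split; [lra | apply H0].
Qed.

Lemma psum_le_Series (u : nat -> R) (n : nat) : ex_series u -> (forall n, 0 <= u n) ->
  psum u n <= Series u.
Proof.
intros Hu H0; rewrite (Series_psum u n Hu).
assert (0 <= Series (fun k => u (n + k)%nat)); [|lra].
apply Series_nonneg; [apply (ex_series_incr_n u n), Hu | intros k; apply H0].
Qed.

Lemma Series_tail_small (u : nat -> R) (eps : R) : ex_series u -> 0 < eps ->
  exists N0, forall N, (N0 <= N)%nat -> Series (fun k => u (N + k)%nat) < eps.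
Proof.
intros Hu He; pose proof (Series_correct u Hu) as H.
destruct (proj1 (filterlim_locally _ _) H (mkposreal eps He)) as [N0 HN0].
exists (S N0); intros [|N] HN; [lia|].
specialize (HN0 N ltac:(lia)); rewrite sum_n_psum in HN0.
change (Rabs (psum u (S N) - Series u) < eps) in HN0.
rewrite (Series_psum u (S N) Hu) in HN0; apply Rabs_def2 in HN0; lra.
Qed.

Lemma telescoping_series (N : nat) :
  is_series (fun k => / INR (S (N + k)) - / INR (S (S (N + k)))) (/ INR (S N)).
Proof.
set (f := fun k => / INR (S (N + k)) - / INR (S (S (N + k)))).
assert (Hs : forall n, psum f n = / INR (S N) - / INR (S (N + n))).
{ induction n as [|n IH]; [rewrite Nat.add_0_r; change (psum f 0) with 0; ring|].
  change (psum f (S n)) with (psum f n + f n); rewrite IH, Nat.add_succ_r; unfold f; ring. }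
apply (filterlim_locally (sum_n f)).
intros eps; destruct (nfloor_ex (/ eps)) as [n0 [_ Hn0]].
{ apply Rlt_le, Rinv_0_lt_compat, cond_pos. }
exists n0; intros n Hn; rewrite sum_n_psum, Hs.
set (q := INR (S (N + S n))).
assert (Hq : / eps < q).
{ eapply Rlt_le_trans; [exact Hn0|]; rewrite <- S_INR; apply le_INR; lia. }
assert (He : 0 < / eps) by (apply Rinv_0_lt_compat, cond_pos).
change (Rabs (/ INR (S N) - / q - / INR (S N)) < eps).
replace (/ INR (S N) - / q - / INR (S N)) with (- / q) by ring.
rewrite Rabs_Ropp, Rabs_right by (apply Rle_ge, Rlt_le, Rinv_0_lt_compat; lra).
rewrite <- (Rinv_inv eps); apply Rinv_lt_contravar; [apply Rmult_lt_0_compat; lra | exact Hq].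
Qed.

(** Comparison with a telescoping series: 1/x^2 <= 2 (1/x - 1/(x+1)) for x >= 1. *)
Lemma inverse_square_tail (u : nat -> R) (N : nat) (D : R) : 0 <= D ->
  (forall k, 0 <= u k) -> (forall k, (N <= k)%nat -> u k <= D * / INR (S k) ^ 2) ->
  ex_series u /\ Series (fun k => u (N + k)%nat) <= 2 * D.
Proof.
intros HD H0 Hu.
set (v := fun k : nat => 2 * D * (/ INR (S (N + k)) - / INR (S (S (N + k))))).
assert (Hv : is_series v (2 * D * / INR (S N))).
{ exact (is_series_scal (2 * D) _ _ (telescoping_series N)). }
assert (Huv : forall k, 0 <= u (N + k)%nat <= v k).
{ intros k; split; [apply H0|]; eapply Rle_trans; [apply Hu; lia|].
  unfold v; change (D * / INR (S (N + k)) ^ 2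
    <= 2 * D * (/ INR (S (N + k)) - / INR (S (S (N + k))))).
  rewrite (S_INR (S (N + k))).
  assert (Hx : 1 <= INR (S (N + k))) by (apply (le_INR 1); lia).
  set (x := INR (S (N + k))) in *.
  replace (2 * D * (/ x - / (x + 1))) with (D * (2 * / (x * (x + 1)))) by (field; lra).
  apply Rmult_le_compat_l; [exact HD|].
  replace (2 * / (x * (x + 1))) with (/ (x * (x + 1) / 2)) by (field; lra).
  apply Rinv_le_contravar; nra. }
assert (Hex : ex_series (fun k => u (N + k)%nat)).
{ apply (ex_series_le (K := R_AbsRing) (V := R_CompleteNormedModule) _ v); [|eexists; exact Hv].
  intros k; change (Rabs (u (N + k)%nat) <= v k); rewrite Rabs_right; [apply Huv | apply Rle_ge, H0]. }
split; [apply (ex_series_incr_n u N), Hex|].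
eapply Rle_trans; [apply Series_le; [exact Huv | eexists; exact Hv]|].
rewrite (is_series_unique _ _ Hv).
assert (1 <= INR (S N)) by (apply (le_INR 1); lia).
assert (/ INR (S N) <= 1) by (rewrite <- Rinv_1; apply Rinv_le_contravar; lra); nra.
Qed.

Lemma pow_n_Cpow (z : C) (n : nat) : pow_n z n = (z ^ n)%C.
Proof. induction n as [|n IH]; simpl; [reflexivity | rewrite IH; reflexivity]. Qed.

Lemma psum_block (u : nat -> R) (v : R) (n l : nat) :
  (forall j, (n <= j < n + l)%nat -> v <= u j) -> psum u n + INR l * v <= psum u (n + l).
Proof.
intros H; induction l as [|l IH]; [rewrite Nat.add_0_r; simpl; lra|].
rewrite Nat.add_succ_r, S_INR; simpl psum.
specialize (IH ltac:(intros j Hj; apply H; lia)); specialize (H (n + l)%nat ltac:(lia)); lra.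
Qed.

(** Cauchy condensation: omega is increasing because omega(t)/t is, so the dyadic block ending at
    2^(i+1) contributes at least 2^i / omega(2^(i+1)), which is half of 1/phi (i+1). *)
Lemma condensation (omega : R -> R) :
  (forall t, 0 < t -> 0 < omega t) ->
  (forall s t, 0 < s -> s <= t -> omega s / s <= omega t / t) ->
  ex_series (fun n : nat => / omega (INR (S n))) ->
  exists l, forall n, psum (fun i => / (omega (2 ^ i) / 2 ^ i)) n <= l.
Proof.
intros Hpos Hinc Hser.
set (u := fun n : nat => / omega (INR (S n))) in *.
set (phi := fun i : nat => omega (2 ^ i) / 2 ^ i).
assert (H2 : forall i, 0 < 2 ^ i) by (intros i; apply pow_lt; lra).
assert (Hphi : forall i, 0 < phi i) by (intros i; apply Rdiv_lt_0_compat; [apply Hpos|]; apply H2).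
assert (HS : forall n, 0 < INR (S n)) by (intros n; apply lt_0_INR; lia).
assert (Hu : forall n, 0 <= u n) by (intros n; apply Rlt_le, Rinv_0_lt_compat, Hpos, HS).
assert (Hmon : forall s t, 0 < s -> s <= t -> omega s <= omega t).
{ intros s t Hs Hst; specialize (Hinc s t Hs Hst).
  assert (Ht : 0 < omega t / t) by (apply Rdiv_lt_0_compat; [apply Hpos|]; lra).
  replace (omega s) with (omega s / s * s) by (field; lra).
  replace (omega t) with (omega t / t * t) by (field; lra).
  apply Rmult_le_compat; try lra.
  apply Rlt_le, Rdiv_lt_0_compat; [apply Hpos|]; lra. }
assert (Hi : forall i, psum (fun i => / phi i) (S i) <= / phi 0%nat + 2 * psum u (2 ^ i)).
{ induction i as [|i IH].
  - simpl psum; rewrite Rplus_0_l; specialize (Hu 0%nat); lra.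
  - change (psum (fun i => / phi i) (S (S i)))
      with (psum (fun i => / phi i) (S i) + / phi (S i)).
    assert (HB : psum u (2 ^ i) + INR (2 ^ i) * / omega (2 ^ S i) <= psum u (2 ^ i + 2 ^ i)).
    { apply psum_block; intros j Hj; unfold u; apply Rinv_le_contravar; [apply Hpos, HS|].
      apply Hmon; [apply HS|].
      replace (2 ^ S i) with (INR (2 ^ S i)) by (rewrite pow_INR; reflexivity).
      apply le_INR; simpl; lia. }
    replace (2 ^ i + 2 ^ i)%nat with (2 ^ S i)%nat in HB by (simpl; lia).
    assert (E : / phi (S i) = 2 * (INR (2 ^ i) * / omega (2 ^ S i))).
    { unfold phi; rewrite pow_INR; replace (INR 2) with 2 by reflexivity.
      simpl pow; field; split; [|specialize (H2 i); lra].
      specialize (Hpos (2 * 2 ^ i) ltac:(specialize (H2 i); lra)); lra. }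
    rewrite E; lra. }
exists (/ phi 0%nat + 2 * Series u); intros n.
apply Rle_trans with (psum (fun i => / phi i) (S n)).
- apply (psum_mono (fun i => / phi i)); [|lia]; intros i; apply Rlt_le, Rinv_0_lt_compat, Hphi.
- eapply Rle_trans; [apply Hi|]; pose proof (psum_le_Series u (2 ^ n) Hser Hu); lra.
Qed.

Lemma unbounded_of_summable_inv (phi : nat -> R) (l M : R) : (forall i, 0 < phi i) -> 0 < M ->
  (forall n, psum (fun i => / phi i) n <= l) -> exists i, M <= phi i.
Proof.
intros Hphi HM Hl; apply NNPP; intros Hno.
assert (Hlow : forall n, INR n * / M <= psum (fun i => / phi i) n).
{ induction n as [|n IH]; [simpl; lra|]; rewrite S_INR; simpl psum.
  assert (/ M <= / phi n); [|lra].
  apply Rinv_le_contravar; [apply Hphi|]; apply Rnot_lt_le; intros G; apply Hno; exists n; lra. }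
assert (Hl0 : 0 <= l) by (apply (Hl 0%nat)).
destruct (nfloor_ex (l * M)) as [n [_ Hn]]; [apply Rmult_le_pos; lra|].
specialize (Hl (S n)); specialize (Hlow (S n)); rewrite S_INR in Hlow.
assert (G : (INR n + 1) * / M <= l) by lra.
apply Rmult_le_compat_r with (r := M) in G; [|lra].
rewrite Rmult_assoc, Rinv_l, Rmult_1_r in G by lra; lra.
Qed.

(** With x = ln (k+1) >= 2^i, monotonicity of omega(t)/t gives omega(x) >= x phi. Setting 2x aside
    for the factor (k+1)^(-2) leaves at least 2^i (phi - 2), which is >= 2^i phi / 2 exactly when
    phi >= 4. *)
Lemma coefficient_decay (omega : R -> R) (a : nat -> C) (K : R) (k0 i k : nat) :
  (forall s t, 0 < s -> s <= t -> omega s / s <= omega t / t) -> 0 <= K ->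
  (forall k, (k0 <= k)%nat -> Cmod (a k) <= K * exp (- omega (ln (INR (S k))))) ->
  4 <= omega (2 ^ i) / 2 ^ i -> (k0 <= i)%nat -> (scale i <= k)%nat ->
  Cmod (a k) <= K * exp (- (omega (2 ^ i) / 2 ^ i * 2 ^ i / 2)) * / INR (S k) ^ 2.
Proof.
intros Hinc HK Ha Hphi Hi Hk.
set (phi := omega (2 ^ i) / 2 ^ i) in *.
assert (H2 : 0 < 2 ^ i) by (apply pow_lt; lra).
assert (Hk1 : 0 < INR (S k)) by (apply lt_0_INR; lia).
set (x := ln (INR (S k))).
assert (Hx : 2 ^ i <= x).
{ assert (Hln3 : 1 <= ln 3).
  { rewrite <- (ln_exp 1); apply ln_le; [apply exp_pos | apply exp_le_3]. }
  apply Rle_trans with (ln (INR (scale i))).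
  - unfold scale; rewrite pow_INR; replace (INR 3) with 3 by (simpl; ring).
    rewrite ln_pow by lra; rewrite pow_INR; replace (INR 2) with 2 by reflexivity; nra.
  - apply ln_le; [pose proof (INR_scale_ge i); lra | apply le_INR; lia]. }
eapply Rle_trans; [apply Ha; pose proof (scale_ge i); lia|]; fold x.
rewrite Rmult_assoc; apply Rmult_le_compat_l; [exact HK|].
assert (Homega : x * phi <= omega x).
{ specialize (Hinc (2 ^ i) x H2 Hx); fold phi in Hinc.
  replace (omega x) with (x * (omega x / x)) by (field; lra).
  apply Rmult_le_compat_l; lra. }
replace (/ INR (S k) ^ 2) with (exp (- (2 * x))).
- rewrite <- exp_plus; apply exp_le.
  assert (2 ^ i * (phi - 2) <= x * (phi - 2)) by (apply Rmult_le_compat_r; lra); nra.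
- rewrite exp_Ropp; f_equal; replace (2 * x) with (INR 2 * x) by (simpl; ring).
  rewrite <- pow_exp; unfold x; rewrite exp_ln by exact Hk1; reflexivity.
Qed.

(** * Tails of the boundary series and limits of the shifted functions *)

Definition coeff (c : Z -> C) (k : nat) : C := c (- Z.of_nat (S k))%Z.

Lemma f_term_eq (c : Z -> C) (zeta : C) (k : nat) : f_term c zeta k = (coeff c k * (/ zeta) ^ S k)%C.
Proof. unfold f_term; rewrite pow_n_Cpow; reflexivity. Qed.

Definition f_tail (c : Z -> C) (zeta : C) (N : nat) : C :=
  (Series (fun k => Re (f_term c zeta (N + k))), Series (fun k => Im (f_term c zeta (N + k)))).

Lemma Cmod_f_term (c : Z -> C) (zeta : C) (k : nat) : Cmod zeta = 1 ->
  Cmod (f_term c zeta k) = Cmod (coeff c k).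
Proof.
intros H; assert (Hz : zeta <> 0%C) by (apply Cmod_gt_0; lra).
rewrite f_term_eq, Cmod_mult, Cmod_pow, Cmod_inv, H, Rinv_1, pow1 by exact Hz; ring.
Qed.

Lemma f_term_parts_summable (c : Z -> C) (zeta : C) (N : nat) : Cmod zeta = 1 ->
  ex_series (fun k => Cmod (coeff c k)) ->
  (ex_series (fun k => Rabs (Re (f_term c zeta (N + k)))) /\
   ex_series (fun k => Rabs (Im (f_term c zeta (N + k))))) /\
  (forall k, Rabs (Re (f_term c zeta (N + k))) <= Cmod (coeff c (N + k))) /\
  (forall k, Rabs (Im (f_term c zeta (N + k))) <= Cmod (coeff c (N + k))).
Proof.
intros H Hs.
assert (HR : forall k, Rabs (Re (f_term c zeta (N + k))) <= Cmod (coeff c (N + k))).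
{ intros k; rewrite <- (Cmod_f_term c zeta (N + k) H); apply re_le_Cmod. }
assert (HI : forall k, Rabs (Im (f_term c zeta (N + k))) <= Cmod (coeff c (N + k))).
{ intros k; rewrite <- (Cmod_f_term c zeta (N + k) H); apply im_le_Cmod. }
assert (Hs' : ex_series (fun k => Cmod (coeff c (N + k)))) by (apply (ex_series_incr_n _ N) in Hs; exact Hs).
split; [|split; assumption].
split; (eapply (ex_series_le (K := R_AbsRing) (V := R_CompleteNormedModule)); [|exact Hs']);
  intros k; change (norm (Rabs ?x)) with (Rabs (Rabs x));
  [change (Rabs (Rabs (Re (f_term c zeta (N + k)))) <= Cmod (coeff c (N + k)))
  |change (Rabs (Rabs (Im (f_term c zeta (N + k)))) <= Cmod (coeff c (N + k)))];
  rewrite Rabs_Rabsolu; [apply HR | apply HI].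
Qed.

(** The factor 2 comes from bounding the real and imaginary series separately. *)
Lemma f_tail_le (c : Z -> C) (zeta : C) (N : nat) : Cmod zeta = 1 ->
  ex_series (fun k => Cmod (coeff c k)) ->
  Cmod (f_tail c zeta N) <= 2 * Series (fun k => Cmod (coeff c (N + k))).
Proof.
intros H Hs; destruct (f_term_parts_summable c zeta N H Hs) as [[E1 E2] [B1 B2]].
assert (Hs' : ex_series (fun k => Cmod (coeff c (N + k)))) by (apply (ex_series_incr_n _ N) in Hs; exact Hs).
eapply Rle_trans; [apply Cmod_le_Rabs|].
assert (G1 : Rabs (Series (fun k => Re (f_term c zeta (N + k)))) <= Series (fun k => Cmod (coeff c (N + k)))).
{ eapply Rle_trans; [apply Series_Rabs, E1|]; apply Series_le; [|exact Hs'].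
  intros k; split; [apply Rabs_pos | apply B1]. }
assert (G2 : Rabs (Series (fun k => Im (f_term c zeta (N + k)))) <= Series (fun k => Cmod (coeff c (N + k)))).
{ eapply Rle_trans; [apply Series_Rabs, E2|]; apply Series_le; [|exact Hs'].
  intros k; split; [apply Rabs_pos | apply B2]. }
lra.
Qed.

Lemma f_tail_S (c : Z -> C) (zeta : C) (N : nat) : Cmod zeta = 1 ->
  ex_series (fun k => Cmod (coeff c k)) ->
  f_tail c zeta N = (f_term c zeta N + f_tail c zeta (S N))%C.
Proof.
intros H Hs; destruct (f_term_parts_summable c zeta N H Hs) as [[E1 E2] _].
unfold f_tail; rewrite Series_incr_1 by (apply ex_series_Rabs, E1).
rewrite (Series_incr_1 (fun k => Im _)) by (apply ex_series_Rabs, E2).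
unfold Cplus; simpl; rewrite !Nat.add_0_r; f_equal; f_equal;
  apply Series_ext; intros k; rewrite Nat.add_succ_r; reflexivity.
Qed.

(** The N-th shifted function tends to zeta^N times the N-th tail of f(zeta): multiplying by z and
    subtracting the next coefficient removes exactly the leading term of the tail. *)
Lemma shifted_nt_bounded (F : C -> C) (c : Z -> C) (t : R) (N : nat) :
  ex_series (fun k => Cmod (coeff c k)) -> nt_limit F (eit t) (f_boundary c (eit t)) ->
  nt_bounded (shifted F (coeff c) N) t (2 * Series (fun k => Cmod (coeff c (N + k)))).
Proof.
intros Hs Hnt; set (zeta := eit t) in *.
assert (Hz : Cmod zeta = 1) by apply Cmod_eit.
assert (Hz0 : zeta <> 0%C) by (apply Cmod_gt_0; lra).
assert (HN : forall eta, 0 < eta -> exists d, 0 < d /\ forall z, Cmod z < 1 ->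
  Cmod (z - zeta) < 3 * (1 - Cmod z) -> Cmod (z - zeta) < d ->
  Cmod (shifted F (coeff c) N z - zeta ^ N * f_tail c zeta N) < eta).
{ induction N as [|N IH]; intros eta He.
  - destruct (Hnt 3 ltac:(lra) eta He) as [d [Hd H]]; exists d; split; [exact Hd|].
    intros z H1 H2 H3; specialize (H z H1 H2 H3).
    replace (zeta ^ 0 * f_tail c zeta 0)%C with (f_boundary c zeta); [exact H|].
    change (f_tail c zeta 0) with (f_boundary c zeta); simpl; ring.
  - set (l := (zeta ^ N * f_tail c zeta N)%C) in *.
    destruct (IH (eta / 2)) as [d [Hd H]]; [lra|].
    pose proof (Cmod_ge_0 l) as Hl.
    exists (Rmin d (eta / (2 * (Cmod l + 1)))); split.
    { apply Rmin_pos; [exact Hd | apply Rdiv_lt_0_compat; lra]. }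
    intros z H1 H2 H3.
    specialize (H z H1 H2 ltac:(eapply Rlt_le_trans; [exact H3 | apply Rmin_l])).
    assert (H4 : Cmod (z - zeta) < eta / (2 * (Cmod l + 1))) by (eapply Rlt_le_trans; [exact H3 | apply Rmin_r]).
    replace (zeta ^ S N * f_tail c zeta (S N))%C with (zeta * l - coeff c N)%C.
    2:{ unfold l; rewrite (f_tail_S c zeta N Hz Hs), f_term_eq.
        assert (E : (zeta ^ S N * (/ zeta) ^ S N)%C = 1%C).
        { rewrite <- Cpow_mult_l; replace (zeta * / zeta)%C with (RtoC 1) by (field; exact Hz0).
          apply Cpow_1_l. }
        replace (zeta * (zeta ^ N * (coeff c N * (/ zeta) ^ S N + f_tail c zeta (S N))) - coeff c N)%C
          with (coeff c N * (zeta ^ S N * (/ zeta) ^ S N) + zeta ^ S N * f_tail c zeta (S N) - coeff c N)%C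
          by (simpl; ring).
        rewrite E; ring. }
    simpl shifted.
    replace (z * shifted F (coeff c) N z - coeff c N - (zeta * l - coeff c N))%C
      with (z * (shifted F (coeff c) N z - l) + (z - zeta) * l)%C by ring.
    eapply Rle_lt_trans; [apply Cmod_triangle|]; rewrite !Cmod_mult.
    assert (H5 : Cmod (z - zeta) * (2 * (Cmod l + 1)) < eta).
    { apply Rmult_lt_compat_r with (r := 2 * (Cmod l + 1)) in H4; [|lra].
      replace (eta / (2 * (Cmod l + 1)) * (2 * (Cmod l + 1))) with eta in H4 by (field; lra); exact H4. }
    pose proof (Cmod_ge_0 z); pose proof (Cmod_ge_0 (z - zeta)).
    pose proof (Cmod_ge_0 (shifted F (coeff c) N z - l)); nra. }
intros eta He; destruct (HN eta He) as [d [Hd H]]; exists d; split; [exact Hd|].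
intros z H1 H2 H3; specialize (H z H1 H2 H3).
pose proof (Cmod_triangle_rev (shifted F (coeff c) N z) (zeta ^ N * f_tail c zeta N)) as G.
rewrite Cmod_mult, Cmod_pow, Hz, pow1, Rmult_1_l in G.
pose proof (f_tail_le c zeta N Hz Hs); lra.
Qed.

Lemma shifted_minus_le (F : C -> C) (a : nat -> C) (N : nat) (z : C) : Cmod z < 1 ->
  Cmod (shifted F a N z - z ^ N * F z) <= psum (fun k => Cmod (a k)) N.
Proof.
intros Hz; induction N as [|N IH].
- simpl; replace (F z - 1 * F z)%C with (RtoC 0) by ring; rewrite Cmod_0; lra.
- simpl shifted; simpl psum.
  replace (z * shifted F a N z - a N - z ^ S N * F z)%C
    with (z * (shifted F a N z - z ^ N * F z) - a N)%C by (simpl; ring).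
  eapply Rle_trans; [apply Cmod_minus_le|]; rewrite Cmod_mult.
  pose proof (Cmod_ge_0 z); pose proof (Cmod_ge_0 (shifted F a N z - z ^ N * F z)); nra.
Qed.

Lemma Rpower_neg_le_pow (x M : R) : 0 < x <= 1 ->
  Rpower x (- M) <= (/ x) ^ Z.to_nat (up (Rabs M)).
Proof.
intros Hx; set (m := Z.to_nat (up (Rabs M))).
assert (Hm : M <= INR m).
{ destruct (archimed (Rabs M)) as [H _]; pose proof (Rabs_pos M); pose proof (Rle_abs M).
  unfold m; rewrite INR_IZR_INZ, Z2Nat.id; [lra|].
  apply le_IZR; lra. }
assert (Hl : ln x <= 0) by (rewrite <- ln_1; apply ln_le; lra).
unfold Rpower; replace (/ x) with (exp (- ln x)) by (rewrite exp_Ropp, exp_ln; [reflexivity | lra]).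
rewrite pow_exp; apply exp_le; nra.
Qed.

Theorem theorem2 (F : C -> C) (c : Z -> C) (omega : R -> R) :
  analytic_on_disk F ->
  (exists M K : R, forall z : C, in_disk z ->
      Cmod (F z) <= K * Rpower (1 - Cmod z) (- M)) ->
  (forall t, 0 < t -> 0 < omega t) ->
  (forall s t, 0 < s -> s <= t -> omega s / s <= omega t / t) ->
  ex_series (fun n : nat => / omega (INR (S n))) ->
  (exists K : R, exists N : Z, forall n : Z, (n <= - N)%Z ->
      Cmod (c n) <= K * exp (- omega (ln (IZR (Z.abs n))))) ->
  null_set (fun theta => 0 <= theta <= 2 * PI /\
              ~ nt_limit F (eit theta) (f_boundary c (eit theta))) ->
  (forall z : C, in_disk z -> F z = 0%C) /\
  (forall theta : R, f_boundary c (eit theta) = 0%C).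
Proof.
intros HFd [M [K HK]] Hpos Hinc Hser [Kc [Nc Hc]] HE.
set (E := fun theta => 0 <= theta <= 2 * PI /\
              ~ nt_limit F (eit theta) (f_boundary c (eit theta))) in *.
assert (HF : forall z, Cmod z < 1 -> cdiff F z) by (intros z Hz; apply ex_derive_cdiff, HFd, Hz).
set (phi := fun i : nat => omega (2 ^ i) / 2 ^ i).
destruct (condensation omega Hpos Hinc Hser) as [lphi Hsum].
assert (Hphi : forall i, 0 < phi i).
{ intros i; assert (0 < 2 ^ i) by (apply pow_lt; lra).
  apply Rdiv_lt_0_compat; [apply Hpos|]; assumption. }
(* One index with phi >= 4, the threshold of [coefficient_decay], is enough since phi is
   increasing. *)
destruct (unbounded_of_summable_inv phi lphi 4 Hphi ltac:(lra) Hsum) as [i2 Hi2].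
set (a := coeff c).
set (k0 := Z.to_nat Nc).
assert (Ha : forall k, (k0 <= k)%nat -> Cmod (a k) <= Rabs Kc * exp (- omega (ln (INR (S k))))).
{ intros k Hk; unfold a, coeff.
  eapply Rle_trans; [apply Hc; unfold k0 in Hk; lia|].
  rewrite Z.abs_opp, Z.abs_eq, <- INR_IZR_INZ by lia.
  apply Rmult_le_compat_r; [apply Rlt_le, exp_pos | apply Rle_abs]. }
set (i1 := Nat.max i2 k0).
assert (Hphi4 : forall i, (i1 <= i)%nat -> 4 <= phi i).
{ intros i Hi; eapply Rle_trans; [exact Hi2|]; apply Hinc; [apply pow_lt; lra|].
  apply Rle_pow; [lra | unfold i1 in Hi; lia]. }
assert (Hdecay : forall i k, (i1 <= i)%nat -> (scale i <= k)%nat ->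
  Cmod (a k) <= Rabs Kc * exp (- damping phi i) * / INR (S k) ^ 2).
{ intros i k Hi Hk; apply (coefficient_decay omega a (Rabs Kc) k0); auto; try apply Rabs_pos.
  - apply Hphi4, Hi.
  - unfold i1 in Hi; lia. }
assert (Htail : forall i, (i1 <= i)%nat -> ex_series (fun k => Cmod (a k)) /\
  Series (fun k => Cmod (a (scale i + k)%nat)) <= 2 * (Rabs Kc * exp (- damping phi i))).
{ intros i Hi; apply (inverse_square_tail (fun k => Cmod (a k))).
  - apply Rmult_le_pos; [apply Rabs_pos | apply Rlt_le, exp_pos].
  - intros k; apply Cmod_ge_0.
  - intros k Hk; apply Hdecay; assumption. }
pose proof (proj1 (Htail i1 (le_n i1))) as Hexa.
set (T := fun N => 2 * Series (fun k => Cmod (a (N + k)%nat))).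
set (S0 := Series (fun k => Cmod (a k))).
assert (HS0 : 0 <= S0) by (apply Series_nonneg; [exact Hexa | intros k; apply Cmod_ge_0]).
assert (HT0 : forall N, 0 <= T N).
{ intros N; apply Rmult_le_pos; [lra|]; apply Series_nonneg; [|intros k; apply Cmod_ge_0].
  apply (ex_series_incr_n (fun k => Cmod (a k)) N), Hexa. }
assert (Hshift : forall N z, Cmod z < 1 -> Cmod (shifted F a N z - z ^ N * F z) <= S0).
{ intros N z Hz; eapply Rle_trans; [apply shifted_minus_le, Hz|].
  apply psum_le_Series; [exact Hexa | intros k; apply Cmod_ge_0]. }
assert (Hnt : forall t, 0 <= t <= 2 * PI -> ~ E t -> forall N, nt_bounded (shifted F a N) t (T N)).
{ intros t Ht HEt N; apply shifted_nt_bounded; [exact Hexa|].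
  apply NNPP; intros G; apply HEt; split; assumption. }
(* The 4 collects the 2 of [f_tail_le] and the 2 of [inverse_square_tail]; the 1 keeps K' positive
   when Kc = 0. *)
destruct (bounded_in_disk F a E S0 T (Rmax 1 K) (4 * Rabs Kc + 1) (Z.to_nat (up (Rabs M))) i1 phi lphi)
  as [B [HB HFB]]; auto.
{ apply Rmax_l. }
{ pose proof (Rabs_pos Kc); lra. }
{ intros z Hz; pose proof (Cmod_ge_0 z); eapply Rle_trans; [apply HK, Hz|].
  apply Rle_trans with (Rmax 1 K * Rpower (1 - Cmod z) (- M)).
  - apply Rmult_le_compat_r; [apply Rlt_le, exp_pos | apply Rmax_r].
  - apply Rmult_le_compat_l; [pose proof (Rmax_l 1 K); lra|]; apply Rpower_neg_le_pow; lra. }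
{ unfold T, S0; simpl; lra. }
{ intros i Hi; destruct (Htail i Hi) as [_ G]; unfold T.
  pose proof (exp_pos (- damping phi i)); lra. }
assert (HbT : forall N z, Cmod z < 1 -> Cmod (shifted F a N z) <= T N).
{ intros N z Hz; apply (bounded_le_boundary (shifted F a N) E (B + S0)); auto; try lra.
  - intros w Hw; apply cdiff_shifted; assumption.
  - intros w Hw; eapply Rle_trans; [apply (shifted_le F a S0 Hshift N w Hw)|].
    specialize (HFB w Hw); lra. }
assert (Ha0 : forall n, a n = 0%C).
{ intros n; apply (coefficient_zero F a T n HF HbT).
  intros eps Heps; destruct (Series_tail_small (fun k => Cmod (a k)) (eps / 2) Hexa) as [N0 HN0]; [lra|].
  exists N0; intros N HN; specialize (HN0 N HN); unfold T; lra. }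
split.
(* F is the shifted function with N = 0, and T 0 vanishes once all the coefficients do. *)
- intros z Hz; apply Cmod_eq_0; apply Rle_antisym; [|apply Cmod_ge_0].
  eapply Rle_trans; [apply (HbT 0%nat z Hz)|].
  right; unfold T; rewrite (Series_ext _ (fun _ => 0)).
  + rewrite Series_zero; ring.
  + intros k; rewrite Ha0; apply Cmod_0.
- intros theta; unfold f_boundary.
  assert (H0 : forall k, f_term c (eit theta) k = 0%C).
  { intros k; rewrite f_term_eq; change (coeff c k) with (a k); rewrite Ha0; ring. }
  unfold RtoC; f_equal; (etransitivity; [|exact Series_zero]); apply Series_ext; intros k; rewrite H0; reflexivity.
Qed.
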